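(* Let $(M,L)$ be a Finsler manifold of scalar curvature $k$, and suppose that $(M,L)$ is of $H_p$-scalar curvature $\varepsilon$ (so $\dim M\ge4$). Then the following properties are equivalent: (a) $\varepsilon=k$; (b) $(M,L)$ is of constant curvature $k$; (c) $(M,L)$ is of $H_p$-constant curvature $\varepsilon$; (d) $\mathcal{P}\cdot F=0$, where $F$ is the $\pi$-form $F(\overline{X},\overline{Y}):=\frac13\{B^{k}(\overline{X},\overline{Y})+2C^{k}(\overline{X})\ell(\overline{Y})\}$.
   Context: Pullback formalism. $M$ is a smooth $n$-dimensional manifold, $\pi:\mathcal{T}M\to M$ the bundle of nonzero tangent vectors, $\pi^{-1}(TM)\to\mathcal{T}M$ the pullback of $TM$. Sections of $\pi^{-1}(TM)$ are called $\pi$-vector fields (written with bars), tensor fields on $\pi^{-1}(TM)$ are called $\pi$-tensor fields, and $\overline{\eta}(u)=(u,u)$ is the fundamental $\pi$-vector field. There is an exact sequence $0\to\pi^{-1}(TM)\xrightarrow{\gamma}T(\mathcal{T}M)\xrightarrow{\rho}\pi^{-1}(TM)\to0$, with $\rho=(\pi_{\mathcal{T}M},\pi_* )$ (where $\pi_{\mathcal{T}M}:T(\mathcal{T}M)\to\mathcal{T}M$ is the projection) and $\gamma$ the vertical lift. A connection $D$ on $\pi^{-1}(TM)$ is regular if $T_u(\mathcal{T}M)=V_u\oplus H_u$ for all $u$, where $V_u$ is the vertical space and $H_u=\{X: D_X\overline{\eta}=0\}$; its horizontal map is $\beta=(\rho|_{H})^{-1}$. Torsion and curvature (note the sign convention)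 are $\mathbf{T}(X,Y)=D_X\rho Y-D_Y\rho X-\rho[X,Y]$ and $\mathbf{K}(X,Y)\rho Z=-D_XD_Y\rho Z+D_YD_X\rho Z+D_{[X,Y]}\rho Z$. The h-curvature is $R(\overline{X},\overline{Y})\overline{Z}=\mathbf{K}(\beta\overline{X},\beta\overline{Y})\overline{Z}$, the (v)h-torsion is $\widehat{R}(\overline{X},\overline{Y})=R(\overline{X},\overline{Y})\overline{\eta}$, and the (v)hv-torsion is $\widehat{P}(\overline{X},\overline{Y})=\mathbf{K}(\beta\overline{X},\gamma\overline{Y})\overline{\eta}$. For a Finsler manifold $(M,L)$ with Finsler metric $g$ on $\pi^{-1}(TM)$ (locally $g_{ij}=\frac12\partial^2L^2/\partial y^i\partial y^j$), the Berwald connection $D^{\circ}$ is the unique regular connection on $\pi^{-1}(TM)$ that is torsion-free ($\mathbf{T}^{\circ}=0$), has vanishing (v)hv-torsion, and satisfies $D^{\circ}_{h^{\circ}X}L=0$, $h^{\circ}=\beta\circ\rho$ being its horizontal projector. $R^{\circ}$ and $\widehat{R^{\circ}}$ denote its h-curvature and (v)h-torsion, $R^{\circ}(\overline{X},\overline{Y},\overline{Z},\overline{W}):=g(R^{\circ}(\overline{X},\overline{Y})\overline{Z},\overline{W})$, and $H(\overline{X}):=\widehat{R^{\circ}}(\overline{\eta},\overline{X})$ is the deviation tensor. The vertical covariant derivative $\stackrel{v}{D^{\circ}}$ is $(\stackrel{v}{D^{\circ}}A)(\overline{X},\dots)=(D^{\circ}_{\gamma\overline{X}}A)(\dots)$.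 Notation: $\ell(\overline{X}):=L^{-1}g(\overline{\eta},\overline{X})$, $\phi(\overline{X}):=\overline{X}-L^{-1}\ell(\overline{X})\overline{\eta}$, $\hbar(\overline{X},\overline{Y}):=g(\overline{X},\overline{Y})-\ell(\overline{X})\ell(\overline{Y})$, $\mathfrak{A}_{\overline{X},\overline{Y}}\{\omega(\overline{X},\overline{Y})\}:=\omega(\overline{X},\overline{Y})-\omega(\overline{Y},\overline{X})$. The projection operator $\mathcal{P}$ on a $(0,p)$ $\pi$-tensor field $\omega$ is $(\mathcal{P}\cdot\omega)(\overline{X}_1,\dots,\overline{X}_p):=\omega(\phi(\overline{X}_1),\dots,\phi(\overline{X}_p))$. For the function $k$ on $\mathcal{T}M$: $C^{k}(\overline{X}):=L(\stackrel{v}{D^{\circ}}k)(\overline{X})$ and $B^{k}(\overline{X},\overline{Y}):=L(\mathcal{P}\cdot\stackrel{v}{D^{\circ}}C^{k})(\overline{X},\overline{Y})$. Definitions: a Finsler manifold of dimension $n\ge3$ is of scalar curvature $k$, where $k\in C^\infty(\mathcal{T}M)$ is positively homogeneous of degree zero in $y$, if $H(\overline{X})=kL^2\phi(\overline{X})$; it is of constant curvature $k$ if moreover $k$ is constant. A Finsler manifold of dimension $n\ge4$ is of $H_p$-scalar curvature $\varepsilon$, where $\varepsilon\in C^\infty(\mathcal{T}M)$ is positively homogeneous of degree zero in $y$, if $(\mathcal{P}\cdot R^{\circ})(\overline{X},\overline{Y},\overline{Z},\overline{W})=\varepsilon\,\mathfrak{A}_{\overline{X},\overline{Y}}\{\hbar(\overline{X},\overline{Z})\hbar(\overline{Y},\overline{W})\}$;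 it is of $H_p$-constant curvature $\varepsilon$ if moreover $\varepsilon$ is constant.
   Formalization: The manifold M is assumed connected: on a disconnected M (e.g. two round 4-spheres of different radii) one has ε = k and P·F = 0, yet k and ε are only locally constant, so (b) and (c) fail. *)

(* Defs.v *)
From mathcomp Require Import all_boot all_order all_algebra.
From mathcomp Require Import all_classical all_reals all_analysis.
Set Implicit Arguments.
Unset Strict Implicit.
Unset Printing Implicit Defensive.
Import Order.TTheory GRing.Theory Num.Theory.
Import numFieldNormedType.Exports.

Local Open Scope classical_set_scope.
Local Open Scope ring_scope.

(** * Smooth functions on an open set of a finite-dimensional space *)

Fixpoint Ck (R : realType) (E W : normedModType R) (r : nat) (O : set E)
    (f : E -> W) {struct r} : Prop :=
  match r with
  | 0%N => forall a, O a -> {for a, continuous f}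
  | s.+1 => (forall a, O a -> differentiable f a) /\
            (forall v : E, Ck s O ('D_v f))
  end.

Definition smooth_on (R : realType) (E W : normedModType R) (O : set E)
    (f : E -> W) : Prop := forall r, Ck r O f.

(** * Atlases

    The maps are total; [co c] and [inv c] are meaningful only on [dom c] and
    on its image. The axioms are stated separately ([smooth_manifold]), so that
    the induced atlas of the slit tangent bundle is plain data. *)

Record atlas (R : realType) (E : normedModType R) (P : Type) := Atlas {
  chart : Type;
  dom : chart -> set P;
  co : chart -> P -> E;
  inv : chart -> E -> P;
  chart_at : P -> chart }.

Section Atlas.
Context (R : realType) (E : normedModType R) (P : Type) (A : atlas E P).

Definition trans (c d : chart A) : E -> E := co d \o inv c.

(* The coordinates of [x] in the preferred chart at [x]. *)
Definition co_at (x : P) : E := co (chart_at A x) x.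

(* A tangent vector at [x] is represented by its components (in [E]) in the
   preferred chart at [x]; [tcoord c x v] gives its components in the chart
   [c]. *)
Definition tcoord (c : chart A) (x : P) (v : E) : E :=
  'D_v (trans (chart_at A x) c) (co_at x).

(* [g] is an expression in the preferred chart at [x]. *)
Definition smooth_rep (W : normedModType R) (x : P) (g : E -> W) : Prop :=
  exists O : set E, [/\ open O, O (co_at x),
    O `<=` co (chart_at A x) @` dom (chart_at A x) & smooth_on O g].

Definition smooth_near (W : normedModType R) (f : P -> W) (x : P) : Prop :=
  smooth_rep x (f \o inv (chart_at A x)).

(* The derivative of [f] along the tangent vector [v] at [x]. *)
Definition dirder (W : normedModType R) (f : P -> W) (x : P) (v : E) : W :=
  'D_v (f \o inv (chart_at A x)) (co_at x).

(* Components in the chart [c] of a vector field, as a function of the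
   coordinates. *)
Definition vrep (c : chart A) (X : P -> E) : E -> E :=
  fun a => tcoord c (inv c a) (X (inv c a)).

Definition smooth_vf (X : P -> E) (x : P) : Prop :=
  smooth_rep x (vrep (chart_at A x) X).

(* [X, Y]^i = X^j d_j Y^i - Y^j d_j X^i *)
Definition bracket (X Y : P -> E) : P -> E := fun x =>
  let c := chart_at A x in
  'D_(X x) (vrep c Y) (co_at x) - 'D_(Y x) (vrep c X) (co_at x).

End Atlas.

(* The tangent map of [f] at [x]. *)
Definition tangent_map (R : realType) (E F : normedModType R) (P Q : Type)
    (A : atlas E P) (B : atlas F Q) (f : P -> Q) (x : P) : E -> F :=
  dirder A (co (chart_at B (f x)) \o f) x.

Definition smooth_manifold (R : realType) (n : nat) (M : topologicalType)
    (A : atlas 'rV[R]_n M) : Prop :=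
  [/\ hausdorff_space M, @second_countable M,
      forall x, dom (chart_at A x) x,
      forall c : chart A,
        [/\ open (dom c), open (co c @` dom c),
            {in dom c, cancel (co c) (inv c)},
            {within dom c, continuous (co c)} &
            {within co c @` dom c, continuous (inv c)}] &
      forall c d : chart A, smooth_on (co c @` (dom c `&` dom d)) (trans c d)].

(** * The pullback formalism on the slit tangent bundle *)

Section Pullback.
Context (R : realType) (n : nat) (M : Type).
Local Notation E := 'rV[R]_n.
Context (A : atlas E M).

(* A tangent vector of [M] is a pair [(x, y)], with [y] the components in the
   preferred chart at [x]. *)
Definition TM : Type := (M * E)%type.

Definition slit (u : TM) : Prop := u.2 != 0.

(* The induced atlas of the slit tangent bundle, of model space [E * E]; the
   points of the zero section belong to no chart domain. *)
Definition slit_atlas : atlas (E * E)%type TM := {|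
  dom := fun c : chart A => [set u : TM | dom c u.1 /\ slit u];
  co := fun c u => (co c u.1, tcoord c u.1 u.2);
  inv := fun c b => (inv c b.1, 'D_(b.2) (trans c (chart_at A (inv c b.1))) b.1);
  chart_at := fun u => chart_at A u.1 |}.
Local Notation S := slit_atlas.

(* Functions, vector fields and pi-vector fields on the slit tangent bundle.
   The value of a pi-vector field at [u] is a tangent vector at [u.1]. Fields
   are total functions; only their behaviour near the point under consideration
   is ever constrained, so they stand for locally defined fields. Since all the
   operators below are local, this is the same as using global smooth fields. *)
Definition func : Type := TM -> R.
Definition vf : Type := TM -> E * E.
Definition pvf : Type := TM -> E.

Definition prep (c : chart A) (Y : pvf) : E * E -> E :=
  fun b => tcoord c (inv c b.1) (Y (inv (a := S) c b)).

Definition smooth_pvf (Y : pvf) (u : TM) : Prop :=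
  smooth_rep S u (prep (chart_at A u.1) Y).

Definition smooth_func (f : func) : Prop :=
  forall u, slit u -> smooth_near S (f : TM -> R^o) u.

Definition dfun (f : func) (u : TM) (w : E * E) : R :=
  dirder S (f : TM -> R^o) u w.

Definition eta : pvf := fun u => u.2.

Definition rho (u : TM) : E * E -> E := tangent_map S A fst u.

(* The velocity at [t = 0] of the curve [t |-> u + t v] in the fibre. *)
Definition gamma (u : TM) (v : E) : E * E :=
  derive1 (fun t : R => co (a := S) (chart_at A u.1) (u.1, u.2 + t *: v)) 0.

Definition rhof (X : vf) : pvf := fun u => rho u (X u).
Definition gammaf (X : pvf) : vf := fun u => gamma u (X u).

(** ** Connections on the pullback bundle *)

(* [D u w Y] is the covariant derivative of [Y] at [u] along [w]. *)
Definition operator : Type := TM -> E * E -> pvf -> E.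
Implicit Type D : operator.

Definition cov D (X : vf) (Y : pvf) : pvf := fun u => D u (X u) Y.

(* The Koszul axioms. As [f] ranges over functions smooth near [u], the Leibniz
   rule makes [D u w Y] depend only on the germ of [Y] at [u]. *)
Definition connection D : Prop :=
  forall u, slit u ->
  [/\ forall Y, smooth_pvf Y u -> forall (a : R) w z,
        D u (a *: w + z) Y = a *: D u w Y + D u z Y,
      forall Y Z, smooth_pvf Y u -> smooth_pvf Z u -> forall w,
        D u w (fun t => Y t + Z t) = D u w Y + D u w Z,
      forall (f : func) Y, smooth_near S (f : TM -> R^o) u -> smooth_pvf Y u ->
        forall w, D u w (fun t => f t *: Y t)
                  = dfun f u w *: Y u + f u *: D u w Y &
      forall X Y, smooth_vf S X u -> smooth_pvf Y u ->
        smooth_pvf (cov D X Y) u].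

Definition vertical (u : TM) : set (E * E) := [set w | rho u w = 0].
Definition horizontal D (u : TM) : set (E * E) := [set w | D u w eta = 0].

Definition regular D : Prop := forall u, slit u ->
  (forall w, exists v h, [/\ vertical u v, horizontal D u h & w = v + h]) /\
  (forall w, vertical u w -> horizontal D u w -> w = 0).

(* The horizontal map: the inverse of the restriction of [rho u] to the
   horizontal space. *)
Definition beta D (u : TM) (x : E) : E * E :=
  get [set w | horizontal D u w /\ rho u w = x].
Definition betaf D (X : pvf) : vf := fun u => beta D u (X u).

Definition hproj D (u : TM) (w : E * E) : E * E := beta D u (rho u w).

Definition torsion D (X Y : vf) : pvf := fun u =>
  cov D X (rhof Y) u - cov D Y (rhof X) u - rhof (bracket S X Y) u.

Definition curvature D (X Y : vf) (Z : pvf) : pvf := fun u =>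
  - cov D X (cov D Y Z) u + cov D Y (cov D X Z) u + cov D (bracket S X Y) Z u.

Definition hcurv D (X Y Z : pvf) : pvf := curvature D (betaf D X) (betaf D Y) Z.
Definition vh_torsion D (X Y : pvf) : pvf := hcurv D X Y eta.
Definition vhv_torsion D (X Y : pvf) : pvf :=
  curvature D (betaf D X) (gammaf Y) eta.
Definition deviation D (X : pvf) : pvf := vh_torsion D eta X.

(* The vertical covariant derivative of a function and of a pi-form. *)
Definition vder0 (f : func) (X : pvf) : func := fun u => dfun f u (gammaf X u).
Definition vder1 D (w : pvf -> func) (X Y : pvf) : func := fun u =>
  dfun (w Y) u (gammaf X u) - w (cov D (gammaf X) Y) u.

(** ** Finsler metrics *)

Definition metric (L : func) (u : TM) (v w : E) : R :=
  2^-1 * 'D_v ('D_w (fun y : E => (L (u.1, y)) ^+ 2 : R^o)) u.2.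

Definition finsler (L : func) : Prop :=
  [/\ smooth_func L,
      forall u, slit u -> 0 < L u,
      forall (x : M) (y : E) (t : R), 0 < t -> L (x, t *: y) = t * L (x, y) &
      forall u, slit u -> forall v, v != 0 -> 0 < metric L u v v].

Definition berwald (L : func) D : Prop :=
  [/\ connection D, regular D,
      forall X Y u, slit u -> smooth_vf S X u -> smooth_vf S Y u ->
        torsion D X Y u = 0,
      forall X Y u, slit u -> smooth_pvf X u -> smooth_pvf Y u ->
        vhv_torsion D X Y u = 0 &
      forall u, slit u -> forall w, dfun L u (hproj D u w) = 0].

Definition gf (L : func) (X Y : pvf) : func := fun u => metric L u (X u) (Y u).

Definition ell (L : func) (X : pvf) : func := fun u => (L u)^-1 * gf L eta X u.

Definition phi (L : func) (X : pvf) : pvf := fun u =>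
  X u - ((L u)^-1 * ell L X u) *: eta u.

Definition hbar (L : func) (X Y : pvf) : func := fun u =>
  gf L X Y u - ell L X u * ell L Y u.

(* The projection operator, on tensors of types (0,2) and (0,4). *)
Definition proj2 (L : func) (w : pvf -> pvf -> func) (X Y : pvf) : func :=
  w (phi L X) (phi L Y).
Definition proj4 (L : func) (w : pvf -> pvf -> pvf -> pvf -> func)
    (X Y Z W : pvf) : func :=
  w (phi L X) (phi L Y) (phi L Z) (phi L W).

Definition hcurv4 (L : func) D (X Y Z W : pvf) : func := gf L (hcurv D X Y Z) W.

Definition antisym (w : pvf -> pvf -> func) (X Y : pvf) : func := fun u =>
  w X Y u - w Y X u.

Definition Cform (L k : func) (X : pvf) : func := fun u => L u * vder0 k X u.

Definition Bform (L : func) D (k : func) (X Y : pvf) : func := fun u =>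
  L u * proj2 L (vder1 D (Cform L k)) X Y u.

Definition Fform (L : func) D (k : func) (X Y : pvf) : func := fun u =>
  3^-1 * (Bform L D k X Y u + 2 * Cform L k X u * ell L Y u).

(** ** Scalar and constant curvature *)

Definition homogeneous0 (f : func) : Prop :=
  forall (u : TM) (t : R), slit u -> 0 < t -> f (u.1, t *: u.2) = f u.

Definition is_constant (f : func) : Prop :=
  exists a : R, forall u, slit u -> f u = a.

Definition scalar_curvature (L : func) D (k : func) : Prop :=
  [/\ (3 <= n)%N, smooth_func k, homogeneous0 k &
      forall X u, slit u -> smooth_pvf X u ->
        deviation D X u = (k u * L u ^+ 2) *: phi L X u].

Definition constant_curvature (L : func) D (k : func) : Prop :=
  scalar_curvature L D k /\ is_constant k.

Definition Hp_scalar_curvature (L : func) D (eps : func) : Prop :=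
  [/\ (4 <= n)%N, smooth_func eps, homogeneous0 eps &
      forall X Y Z W u, slit u ->
        smooth_pvf X u -> smooth_pvf Y u -> smooth_pvf Z u -> smooth_pvf W u ->
        proj4 L (hcurv4 L D) X Y Z W u
        = eps u * antisym (fun X' Y' t => hbar L X' Z t * hbar L Y' W t) X Y u].

Definition Hp_constant_curvature (L : func) D (eps : func) : Prop :=
  Hp_scalar_curvature L D eps /\ is_constant eps.

End Pullback.

(* Main.v *)
Require Import Defs.
From HB Require Import structures.
From mathcomp Require Import all_boot all_order all_algebra.
From mathcomp Require Import all_classical all_reals all_analysis.
From mathcomp Require Import ring lra.
Set Implicit Arguments.
Unset Strict Implicit.
Unset Printing Implicit Defensive.
Import Order.TTheory GRing.Theory Num.Theory.
Import numFieldNormedType.Exports.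
Local Open Scope classical_set_scope.
Local Open Scope ring_scope.

(** Everything is read off in a chart of the slit tangent bundle, where points are pairs (x, y) of
coordinates, [L] is a function on an open set [O] that is a product of an open set with the nonzero
vectors, and the fundamental field is [y].

In a chart a torsion-free regular connection has the form D_w Y = dY(w) + F(dx(w), Y), with [F]
bilinear and symmetric ([gamma_form], [chart_form_sym]).  Write N(a) = F(a, y).  The horizontal lift
of [a] is then (a, - N(a)), and the vanishing of the (v)hv-torsion says that F(a, b) is the vertical
derivative of N(a) along [b] ([vder_ncon]).  It follows that the (v)h-torsion is the curvature of the
nonlinear connection [N], that the h-curvature is its vertical derivative ([vder_Rhat]), and, by the
first Bianchi identity, that the (v)h-torsion is a third of the antisymmetrised vertical derivative
of the deviation tensor.  If the deviation tensor is k L^2 phi, the whole h-curvature is therefore an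
explicit expression in [k] and its first two vertical derivatives ([Rhat3], [Rcurv_perp]).

Inserting that expression in the definition of H_p-scalar curvature, and testing on a vector that is
orthogonal to [y] and to one more vector, leaves a single equation ([hess_perp]): on the vectors
orthogonal to [y],
<<
    L^2 (vertical Hessian of k) = 3 (eps - k) g,      that is,   P.F = (eps - k) hbar.
>>
This gives at once the equivalence of (a) and (d), and eps = k whenever [k] is constant.

In the other direction, suppose that eps = k or that eps is constant.  The equation is differentiated
once more in a vertical direction and antisymmetrised.  Third derivatives of [k] and of L^2 are
symmetric and drop out, and what remains says that the vertical derivative of [k] vanishes
([kdot_zero]).  Then C^k, B^k and F vanish, which is (d).  Moreover the (v)h-torsion becomes
k (theta(a) b - theta(b) a) with [k] a function of [x], the second Bianchi identity reduces to
Schur's identity ([schur_identity]), and [k] is locally constant; as [M] is connected, it is constant.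

The passage from the intrinsic definitions to a chart needs the transition maps of the slit tangent
bundle, the invariance of the Lie bracket under changes of chart ([bracketP], by the symmetry of second
derivatives) and the locality of connections ([D_local], [D_chart]). *)

(** * Directional derivatives and product rules *)

Section DirectionalDerivatives.
Context (R : realType).
Implicit Types V W F G : normedModType R.

(** Both sides are limits of the same difference quotients, so [h] may be arbitrary. *)
Lemma derive_affine V W F (i : F -> V) (di : F -> V) (h : V -> W) y w :
  (forall t : R, i (t *: w + y) = t *: di w + i y) ->
  'D_w (h \o i) y = 'D_(di w) h (i y).
Proof. move=> E; rewrite /derive; set g1 := fun h0 => _; set g2 := fun h0 => _.
by suff -> : g1 = g2 by []; apply/funext => t; rewrite /g1 /g2 /= E. Qed.

Lemma derivable_affine V W F (i : F -> V) (di : F -> V) (h : V -> W) y w :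
  (forall t : R, i (t *: w + y) = t *: di w + i y) ->
  derivable h (i y) (di w) -> derivable (h \o i) y w.
Proof.
move=> E; rewrite /derivable.
set g1 := fun h0 => _; set g2 := fun h0 => _.
by suff -> : g1 = g2 by []; apply/funext => t; rewrite /g1 /g2 /= E.
Qed.

Lemma near_eq_differentiable V W (f g : V -> W) a :
  (\forall x \near a, f x = g x) -> differentiable f a -> differentiable g a.
Proof.
move=> fg df.
pose h x := g x - f x.
have h0 : \forall x \near a, h x = 0.
  by apply: filterS fg => x E; rewrite /h E subrr.
pose z : {linear V -> W} := \0.
have cz : continuous z by exact: cst_continuous.
have hz : h \o shift a = cst (h a) + z +o_ 0 id.
  apply/eqaddoP => _/posnumP[e].
  have : \forall x \near 0, h (x + a) = 0.
    by move: h0; rewrite (near_shift 0)/= subr0; apply: filterS.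
  apply: filterS => x /= hx.
  rewrite !fctE /= hx (nbhs_singleton h0) /z/= addr0 subrr normr0.
  by rewrite mulr_ge0.
have dh : differentiable h a.
  by apply/diff_locallyP; rewrite (diff_unique cz hz).
have -> : g = f + h by apply/funext => x; rewrite fctE/h addrC subrK.
exact: differentiableD.
Qed.

Lemma scale_bilin_subproof W :
  bilinear_for (GRing.Scale.Law.clone _ _ *:%R _) (GRing.Scale.Law.clone _ _ *:%R _)
    (@GRing.scale R W : R^o -> W -> W).
Proof.
split=> [u'|u] a x y /=.
- by rewrite scalerDl scalerA.
- by rewrite scalerDr !scalerA mulrC.
Qed.

Lemma diff_scale_fun V W (f : V -> R) (g : V -> W) a :
  differentiable (f : V -> R^o) a -> differentiable g a ->
  differentiable (fun x => f x *: g x) a /\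
  forall v, 'D_v (fun x => f x *: g x) a = 'D_v (f : V -> R^o) a *: g a + f a *: 'D_v g a.
Proof.
move=> df dg.
pose B := bilinear_isBilinear.Build R R^o W W _ _ (@GRing.scale R W : R^o -> W -> W)
  (@scale_bilin_subproof W).
pose b : {bilinear R^o -> W -> W} := HB.pack (@GRing.scale R W : R^o -> W -> W) B.
have cb : continuous (fun p : R^o * W => b p.1 p.2) by exact: scale_continuous.
have dp : differentiable (fun x => (f x : R^o, g x)) a by exact: differentiable_pair.
have db := @differentiable_bilin R R^o W W b (f a, g a) cb.
have -> : (fun x => f x *: g x) = (fun p : R^o * W => b p.1 p.2) \o (fun x => (f x : R^o, g x)) by [].
have dc : differentiable ((fun p : R^o * W => b p.1 p.2) \o (fun x => (f x : R^o, g x))) a.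
  exact: differentiable_comp.
have Eb q : 'd (fun p : R^o * W => b p.1 p.2) (f a : R^o, g a) q = f a *: q.2 + (q.1 : R) *: g a.
  by have -> := @diff_bilin R R^o W W b (f a, g a) cb.
split=> // v; rewrite deriveE// diff_comp//= Eb diff_pair//=.
by rewrite !deriveE// addrC.
Qed.

Lemma derive_linear V W (f : V -> W) a k v w : differentiable f a ->
  'D_(k *: v + w) f a = k *: 'D_v f a + 'D_w f a.
Proof. by move=> df; rewrite !deriveE// linearP. Qed.

Lemma deriveDf V W (f g : V -> W) a v : differentiable f a -> differentiable g a ->
  'D_v (fun x => f x + g x) a = 'D_v f a + 'D_v g a.
Proof. by move=> df dg; rewrite -(deriveD (f := f))//; exact: diff_derivable. Qed.

Lemma deriveNf V W (f : V -> W) a v : differentiable f a ->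
  'D_v (fun x => - f x) a = - 'D_v f a.
Proof. by move=> df; rewrite -(deriveN (f := f))//; exact: diff_derivable. Qed.

Lemma deriveBf V W (f g : V -> W) a v : differentiable f a -> differentiable g a ->
  'D_v (fun x => f x - g x) a = 'D_v f a - 'D_v g a.
Proof. by move=> df dg; rewrite -(deriveB (f := f))//; exact: diff_derivable. Qed.

Lemma deriveSf V W (f : V -> R) (g : V -> W) a v :
  differentiable (f : V -> R^o) a -> differentiable g a ->
  'D_v (fun x => f x *: g x) a = 'D_v (f : V -> R^o) a *: g a + f a *: 'D_v g a.
Proof. by move=> df dg; have [_ ->] := diff_scale_fun df dg. Qed.

Lemma deriveZf V W (k : R) (g : V -> W) a v : differentiable g a ->
  'D_v (fun x => k *: g x) a = k *: 'D_v g a.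
Proof. by move=> dg; rewrite -(deriveZ (f := g))//; exact: diff_derivable. Qed.

Lemma derive_comp V W F (f : V -> W) (g : W -> F) a v :
  differentiable f a -> differentiable g (f a) ->
  'D_v (g \o f) a = 'D_('D_v f a) g (f a).
Proof.
move=> df dg; have dgf := differentiable_comp df dg.
by rewrite (deriveE _ dgf) (deriveE _ df) (deriveE _ dg) diff_comp.
Qed.

Lemma differentiable_suml V W m (f : 'I_m -> V -> W) a :
  (forall i, differentiable (f i) a) -> differentiable (fun x => \sum_i f i x) a.
Proof.
move=> df; rewrite (_ : (fun x => _) = \sum_i f i); last first.
  by apply/funext => x; rewrite fct_sumE.
exact: differentiable_sum.
Qed.

Lemma derive_suml V W m (f : 'I_m -> V -> W) a v :
  (forall i, differentiable (f i) a) ->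
  'D_v (fun x => \sum_i f i x) a = \sum_i 'D_v (f i) a.
Proof.
move=> df; rewrite (_ : (fun x => _) = \sum_i f i); last first.
  by apply/funext => x; rewrite fct_sumE.
by rewrite derive_sum// => i; exact: diff_derivable.
Qed.

(** Continuous linear maps, as a predicate on bare functions. *)
Definition clin V W (l : V -> W) :=
  (forall (k : R) u v, l (k *: u + v) = k *: l u + l v) /\ continuous l.

Lemma clin_diff V W (l : V -> W) a : clin l ->
  differentiable l a /\ forall v, 'D_v l a = l v.
Proof.
move=> [lin ct].
pose lM := GRing.isLinear.Build _ _ _ _ l lin.
pose l' : {linear V -> W} := HB.pack l lM.
have dl : differentiable (l' : V -> W) a by exact: linear_differentiable.
by split=> // v; rewrite deriveE// (diff_lin (f := l')).
Qed.

Lemma clin_comp V W F (l : W -> F) (f : V -> W) a : clin l -> differentiable f a ->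
  differentiable (l \o f) a /\ forall v, 'D_v (l \o f) a = l ('D_v f a).
Proof.
move=> cl df; have [dl Dl] := clin_diff (f a) cl.
split=> [|v]; first exact: differentiable_comp.
by rewrite derive_comp// Dl.
Qed.

(** A basis is given by its vectors [e i] and its continuous coordinate forms [l i]. *)
Definition findim F := exists (m : nat) (e : 'I_m -> F) (l : 'I_m -> F -> R^o),
  (forall i, clin (l i)) /\ forall v, v = \sum_i (l i v : R) *: e i.

Lemma findim_rV n : findim 'rV[R]_n.
Proof.
exists n, (fun i => delta_mx 0 i), (fun i (v : 'rV[R]_n) => v 0 i); split.
  move=> i; split=> [k u v|]; first by rewrite !mxE.
  exact: coord_continuous.
by move=> v; rewrite -row_sum_delta.
Qed.

Lemma findim_prod F G : findim F -> findim G -> findim (F * G)%type.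
Proof.
move=> [m [e [l [cl El]]]] [p [e' [l' [cl' El']]]].
exists (m + p)%N, (fun i => match fintype.split i with inl j => (e j, 0) | inr j => (0, e' j) end),
  (fun i v => match fintype.split i with inl j => l j v.1 | inr j => l' j v.2 end).
split.
  move=> i; case: fintype.split => j; split.
  - by move=> k u v /=; case: (cl j) => -> _.
  - move=> x; apply: (@continuous_comp _ _ _ fst (l j)); first exact: cvg_fst.
    by case: (cl j) => _; exact.
  - by move=> k u v /=; case: (cl' j) => -> _.
  - move=> x; apply: (@continuous_comp _ _ _ snd (l' j)); first exact: cvg_snd.
    by case: (cl' j) => _; exact.
move=> [v w]; rewrite big_split_ord/=.
under eq_bigr do rewrite (unsplitK (inl _)).
under [X in _ + X]eq_bigr do rewrite (unsplitK (inr _)).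
rewrite [in LHS](El v) [in LHS](El' w).
have pair_sum q (a : 'I_q -> F) (b : 'I_q -> G) : \sum_i (a i, b i) = (\sum_i a i, \sum_i b i).
  by elim/big_ind3 : _ => // x1 x2 x3 y1 y2 y3 -> ->.
have sl (k : R) (x : F) : k *: ((x, 0) : F * G) = (k *: x, 0).
  by apply: injective_projections => //=; rewrite scaler0.
have sr (k : R) (x : G) : k *: ((0, x) : F * G) = (0, k *: x).
  by apply: injective_projections => //=; rewrite scaler0.
under eq_bigr do rewrite sl.
under [X in _ + X]eq_bigr do rewrite sr.
by rewrite !pair_sum !big1_eq; apply: injective_projections; rewrite /= ?addr0 ?add0r.
Qed.

Lemma findim_R : findim R^o.
Proof.
exists 1%N, (fun=> 1), (fun=> id); split=> [i|v]; first by split=> // x.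
by rewrite big_ord1; rewrite [RHS]mulr1.
Qed.

Lemma linear_fun0 F G (T : F -> G) :
  (forall (k : R) u w, T (k *: u + w) = k *: T u + T w) -> T 0 = 0.
Proof.
move=> lT; have := lT 1 0 0; rewrite !scale1r addr0.
by move/eqP; rewrite -subr_eq subrr => /eqP.
Qed.

Lemma linear_fun_sum F G (T : F -> G) :
  (forall (k : R) u w, T (k *: u + w) = k *: T u + T w) ->
  forall m (Y : 'I_m -> F), T (\sum_i Y i) = \sum_i T (Y i).
Proof.
move=> lT; elim=> [|m IH] Y; first by rewrite !big_ord0 linear_fun0.
by rewrite !big_ord_recl -IH -[Y ord0 in LHS]scale1r lT scale1r.
Qed.

Lemma linear_expand F G (m : nat) (e : 'I_m -> F) (l : 'I_m -> F -> R^o) (T : F -> G) :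
  (forall v, v = \sum_i (l i v : R) *: e i) ->
  (forall (k : R) u w, T (k *: u + w) = k *: T u + T w) ->
  forall u, T u = \sum_i (l i u : R) *: T (e i).
Proof.
move=> El lT u; rewrite {1}(El u) (linear_fun_sum lT); apply: eq_bigr => i _.
by rewrite -[_ *: e i]addr0 lT (linear_fun0 lT) addr0.
Qed.

(** The product rule for the pairing of a vector with a family of linear maps.  Most
    derivatives below are of this kind: the chain rule, derivatives along a vector field, and the
    evaluation of a connection form on moving vectors. *)
Lemma derive_moving V F G (O : set V) (T : V -> F -> G) (Y : V -> F) a :
  findim F -> open O -> O a ->
  (forall q, O q -> forall (k : R) u w, T q (k *: u + w) = k *: T q u + T q w) ->
  (forall u, differentiable (T ^~ u) a) -> differentiable Y a ->
  differentiable (fun q => T q (Y q)) a /\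
  forall v, 'D_v (fun q => T q (Y q)) a = 'D_v (T ^~ (Y a)) a + T a ('D_v Y a).
Proof.
move=> [m [e [l [cl El]]]] oO Oa lT dT dY.
have TE q u : O q -> T q u = \sum_i (l i u : R) *: T q (e i).
  by move=> Oq; exact: (linear_expand El (lT q Oq)).
have near_O (f g : V -> G) : (forall q, O q -> f q = g q) -> \near a, f a = g a.
  by move=> fg; near=> q; apply: fg; near: q; exact: open_nbhs_nbhs.
(* On [O] this is [T q (Y q)], as a finite sum of products. *)
pose f q := \sum_i (l i (Y q) : R) *: T q (e i).
have dli i : differentiable ((fun q => (l i (Y q) : R)) : V -> R^o) a.
  by case: (clin_comp (cl i) dY).
have dt i : differentiable (fun q => (l i (Y q) : R) *: T q (e i)) a.
  by case: (diff_scale_fun (dli i) (dT (e i))).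
have df : differentiable f a by exact: differentiable_suml.
have Df v : 'D_v f a = 'D_v (T ^~ (Y a)) a + T a ('D_v Y a).
  rewrite derive_suml//.
  rewrite (@near_eq_derive _ _ _ (T^~ (Y a)) (fun q => \sum_i (l i (Y a) : R) *: T q (e i))); last first.
    exact: (near_O _ _ (fun q Oq => TE q (Y a) Oq)).
  rewrite (derive_suml (f := fun i q => (l i (Y a) : R) *: T q (e i))); last first.
    by move=> i; apply: differentiableZ.
  rewrite (TE a)// -big_split/=; apply: eq_bigr => i _.
  rewrite deriveSf// deriveZf// addrC; congr (_ + _).
  by have [_ <-] := clin_comp (cl i) dY.
have E : \near a, f a = (fun q => T q (Y q)) a by apply: (near_O f (fun q => T q (Y q))) => q Oq; rewrite TE.
split=> [|v]; first exact: near_eq_differentiable E df.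
by rewrite -Df; apply/esym/near_eq_derive.
Unshelve. all: by end_near. Qed.

End DirectionalDerivatives.

(** * Functions of class C^r *)

Section Smoothness.
Context (R : realType).
Implicit Types V W F G : normedModType R.

Lemma Ck_sub V W (O O' : set V) r (f : V -> W) : O' `<=` O -> Ck r O f -> Ck r O' f.
Proof.
elim: r f => [|r IH] f s /=; first by move=> cf a /s; exact: cf.
by move=> [df Df]; split=> [a /s|v]; [exact: df | exact: IH].
Qed.

Lemma Ck_local V W (O : set V) r (f : V -> W) :
  (forall a, O a -> exists O', O' a /\ Ck r O' f) -> Ck r O f.
Proof.
elim: r f => [|r IH] f H /=; first by move=> a /H [ O' [ O'a h]]; exact: h.
split=> [a /H [ O' [ O'a [df _]]]|v]; first exact: df.
by apply: IH => a /H [ O' [ O'a [_ Df]]]; exists O'; split => //; exact: Df.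
Qed.

Lemma Ck_eq V W (O : set V) r (f g : V -> W) : open O ->
  (forall a, O a -> f a = g a) -> Ck r O f -> Ck r O g.
Proof.
move=> oO; have nO a : O a -> \forall x \near a, O x.
  by move=> Oa; apply: open_nbhs_nbhs.
elim: r f g => [|r IH] f g E /=.
  move=> cf a Oa; have := cf a Oa; rewrite /prop_for /continuous_at -(E a Oa).
  move=> h; apply: cvg_trans h; apply: near_eq_cvg.
  by apply: filterS (nO a Oa) => x; exact: E.
move=> [df Df]; split=> [a Oa|v].
  apply: near_eq_differentiable (df a Oa).
  by apply: filterS (nO a Oa) => x; exact: E.
apply: (IH _ _ _ (Df v)) => a Oa; apply: near_eq_derive.
by apply: filterS (nO a Oa) => x; exact: E.
Qed.

Lemma CkW V W (O : set V) r (f : V -> W) : Ck r.+1 O f -> Ck r O f.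
Proof.
elim: r f => [|r IH] f [df Df]; first by move=> a Oa; apply/differentiable_continuous/df.
by split=> // v; exact: IH.
Qed.

Lemma Ck_cst V W (O : set V) r (c : W) : Ck r O (fun _ : V => c).
Proof.
elim: r c => [|r IH] c /=; first by move=> a _; exact: cst_continuous.
split=> // v; rewrite (_ : 'D_v _ = fun=> 0)//.
by apply/funext => x; rewrite derive_cst.
Qed.

Lemma Ck_clin V W (O : set V) r (l : V -> W) : clin l -> Ck r O l.
Proof.
move=> cl; case: r => [|r] /=; first by case: (cl) => _ cont a _; exact: cont.
split=> [a _|v]; first by case: (clin_diff a cl).
rewrite (_ : 'D_v l = fun=> l v); first exact: Ck_cst.
by apply/funext => x; have [_ ->] := clin_diff x cl.
Qed.

Lemma CkD V W (O : set V) r (f g : V -> W) : open O ->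
  Ck r O f -> Ck r O g -> Ck r O (fun x => f x + g x).
Proof.
move=> oO; elim: r f g => [|r IH] f g /=.
  by move=> cf cg a Oa; apply: (@continuousD _ _ _ f g); [exact: cf|exact: cg].
move=> [df Df] [dg Dg]; split=> [a Oa|v].
  by apply: (@differentiableD _ _ _ f g); [exact: df|exact: dg].
apply: (Ck_eq oO _ (IH _ _ (Df v) (Dg v))) => a Oa.
by rewrite deriveDf; [|exact: df|exact: dg].
Qed.

Lemma CkS V W (O : set V) r (f : V -> R) (g : V -> W) : open O ->
  Ck r O (f : V -> R^o) -> Ck r O g -> Ck r O (fun x => f x *: g x).
Proof.
move=> oO; elim: r f g => [|r IH] f g.
  by move=> cf cg a Oa; apply: cvgZ; [exact: cf|exact: cg].
move=> cf cg; have [df Df] := cf; have [dg Dg] := cg; split=> [a Oa|v].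
  by case: (diff_scale_fun (df a Oa) (dg a Oa)).
apply: (Ck_eq oO _ (CkD oO (IH _ _ (Df v) (CkW cg)) (IH _ _ (CkW cf) (Dg v)))) => a Oa.
by rewrite deriveSf//; [exact: df|exact: dg].
Qed.

Lemma Ck_clin_comp V W F (O : set V) r (l : W -> F) (f : V -> W) : open O -> clin l ->
  Ck r O f -> Ck r O (l \o f).
Proof.
move=> oO cl; elim: r f => [|r IH] f /=.
  move=> cf a Oa; apply: continuous_comp; first exact: cf.
  by case: cl => _; exact.
move=> [df Df]; split=> [a Oa|v]; first by case: (clin_comp cl (df a Oa)).
apply: (Ck_eq oO _ (IH _ (Df v))) => a Oa.
by have [_ ->] := clin_comp cl (df a Oa).
Qed.

Lemma Ck_sum V W (O : set V) r m (f : 'I_m -> V -> W) : open O ->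
  (forall i, Ck r O (f i)) -> Ck r O (fun x => \sum_i f i x).
Proof.
move=> oO; elim: m f => [|m IH] f cf.
  rewrite (_ : (fun x => _) = fun=> 0); first exact: Ck_cst.
  by apply/funext => x; rewrite big_ord0.
rewrite (_ : (fun x => _) = fun x => f ord0 x + \sum_i f (lift ord0 i) x).
  by apply: CkD => //; exact: IH.
by apply/funext => x; rewrite big_ord_recl.
Qed.

Lemma Ck_moving V F G (O : set V) r (T : V -> F -> G) (Y : V -> F) :
  findim F -> open O ->
  (forall q, O q -> forall (k : R) u w, T q (k *: u + w) = k *: T q u + T q w) ->
  (forall u, Ck r O (T ^~ u)) -> Ck r O Y -> Ck r O (fun q => T q (Y q)).
Proof.
move=> [m [e [l [cl El]]]] oO lT sT sY.
suff : Ck r O (fun q => \sum_i (l i (Y q) : R) *: T q (e i)).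
  by apply: Ck_eq => // q Oq; rewrite -(linear_expand El (lT q Oq)).
apply: Ck_sum => // i; apply: CkS => //.
exact: (Ck_clin_comp oO (cl i) sY).
Qed.

(** By induction, since the derivative of [g \o f] along [v] is the derivative of [g] along the
    moving vector ['D_v f]. *)
Lemma Ck_comp V W F (O : set V) (O' : set W) r (f : V -> W) (g : W -> F) :
  findim W -> open O -> (forall a, O a -> O' (f a)) ->
  Ck r O f -> Ck r O' g -> Ck r O (g \o f).
Proof.
move=> fW oO fO; elim: r f g fO => [|r IH] f g fO.
  by move=> cf cg a Oa; apply: continuous_comp; [exact: cf|apply: cg; exact: fO].
move=> cf cg; have [df Df] := cf; have [dg Dg] := cg.
split=> [a Oa|v].
  by apply: differentiable_comp; [exact: df|apply: dg; exact: fO].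
apply: (@Ck_eq _ _ _ _ (fun q => 'D_('D_v f q) g (f q))) => // [a Oa|].
  by rewrite derive_comp//; [exact: df|apply: dg; exact: fO].
apply: (@Ck_moving _ _ _ O r (fun q u => 'D_u g (f q)) ('D_v f)) => //.
  by move=> q Oq k u w; apply: derive_linear; apply: dg; exact: fO.
  by move=> u; apply: (IH f ('D_u g)) => //; [exact: (CkW cf)|exact: (Dg u)].
exact: Df.
Qed.

Lemma clin_inl W F : clin (fun v : W => (v, 0 : F)).
Proof.
split=> [k u v|]; first by apply: injective_projections => //=; rewrite scaler0 addr0.
by move=> x; apply: cvg_pair => /=; [exact: cvg_id|exact: cvg_cst].
Qed.

Lemma clin_inr W F : clin (fun v : F => (0 : W, v)).
Proof.
split=> [k u v|]; first by apply: injective_projections => //=; rewrite scaler0 addr0.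
by move=> x; apply: cvg_pair => /=; [exact: cvg_cst|exact: cvg_id].
Qed.

Lemma Ck_pair V W F (O : set V) r (f : V -> W) (g : V -> F) : open O ->
  Ck r O f -> Ck r O g -> Ck r O (fun x => (f x, g x)).
Proof.
move=> oO sf sg.
have := CkD oO (Ck_clin_comp oO (@clin_inl W F) sf) (Ck_clin_comp oO (@clin_inr W F) sg).
by apply: Ck_eq => // a _; apply: injective_projections; rewrite /= ?addr0 ?add0r.
Qed.

Lemma CkV V (O : set V) r (f : V -> R) : open O -> (forall a, O a -> f a != 0) ->
  Ck r O (f : V -> R^o) -> Ck r O ((fun x => (f x)^-1) : V -> R^o).
Proof.
move=> oO f0; elim: r => [|r IH].
  by move=> cf a Oa; apply: (@continuousV _ _ f); [exact: f0|exact: cf].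
move=> cf; have [df Df] := cf; split=> [a Oa|v].
  by apply: differentiableV; [exact: df|exact: f0].
have I := IH (CkW cf).
have := CkS oO (@Ck_cst _ R^o O r (-1 : R)) (CkS oO (CkS oO I I) (Df v)).
apply: Ck_eq => // a Oa.
rewrite (@deriveV _ _ f)//; [|exact: f0|exact/diff_derivable/df].
by rewrite scaleN1r -scaleNr -exprVn expr2.
Qed.

End Smoothness.

(** * Symmetry of second derivatives *)

Section SecondDerivatives.
Context (R : realType).
Implicit Types V W F G : normedModType R.

Lemma mvt_dir V (f : V -> R^o) a v (t : R) : 0 < t ->
  (forall s, 0 <= s <= t -> differentiable f (s *: v + a)) ->
  exists s, 0 < s < t /\ f (t *: v + a) - f a = t * 'D_v f (s *: v + a).
Proof.
move=> t0 df.
have E s : 'D_1 (fun s : R => f (s *: v + a)) s = 'D_v f (s *: v + a) /\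
    (derivable f (s *: v + a) v -> derivable (fun s : R => f (s *: v + a)) s 1).
  have A (r : R) : (r *: (1 : R^o) + s) *: v + a = r *: v + (s *: v + a).
    have -> : r *: (1 : R^o) = r by exact: mulr1.
    by rewrite scalerDl addrA.
  split.
    exact: (@derive_affine R V R^o R^o (fun s : R => s *: v + a) (fun=> v) f s 1).
  exact: (@derivable_affine R V R^o R^o (fun s : R => s *: v + a) (fun=> v) f s 1).
have der s : 0 <= s <= t -> is_derive s 1 (fun s : R => f (s *: v + a)) ('D_v f (s *: v + a)).
  move=> st; have [E1 E2] := E s; split=> //.
  exact/E2/diff_derivable/df.
have [||s] := @MVT R (fun s : R => f (s *: v + a)) (fun s => 'D_v f (s *: v + a)) 0 t t0.
- by move=> s; rewrite in_itv/= => /andP[s0 st]; apply: der; rewrite !ltW.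
- apply: continuous_in_subspaceT => s; rewrite inE/= in_itv/= => st.
  by apply/differentiable_continuous/derivable1_diffP; have [] := der s st.
rewrite in_itv/= scale0r add0r subr0 mulrC => st E'.
by exists s.
Qed.

(** Two applications of the mean value theorem, first along [v] and then along [w]. *)
Lemma second_difference V (f : V -> R^o) (O : set V) a v w (t : R) :
  smooth_on O f -> 0 < t ->
  (forall s s', 0 <= s <= t -> 0 <= s' <= t -> O (s' *: w + (s *: v + a))) ->
  exists s s', [/\ 0 < s < t, 0 < s' < t &
    f (t *: w + (t *: v + a)) - f (t *: v + a) - (f (t *: w + a) - f a)
    = t * (t * 'D_w ('D_v f) (s' *: w + (s *: v + a)))].
Proof.
move=> sf t0 inO.
have [df Df] := sf 1%N; have D2f := sf 2%N; case: D2f => _ /(_ v) [dDf _].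
have O0 s : 0 <= s <= t -> O (s *: v + a).
  by move=> st; have := inO s 0 st; rewrite scale0r add0r; apply; rewrite lexx ltW.
have Ot s : 0 <= s <= t -> O (t *: w + (s *: v + a)).
  by move=> st; apply: inO => //; rewrite lexx ltW.
(* The first mean value theorem applies to the increment of [f] along [w]. *)
pose phi z : R^o := f (t *: w + z) - f z.
have dsh z : O (t *: w + z) -> differentiable (fun z => f (t *: w + z)) z.
  move=> Oz; apply: (@differentiable_comp _ _ _ _ (fun z => t *: w + z) f); last exact: df.
  exact: (@differentiableD _ _ _ (fun=> t *: w) id).
have Dsh z : 'D_v (fun z => f (t *: w + z)) z = 'D_v f (t *: w + z).
  apply: (@derive_affine R V R^o V (fun z => t *: w + z) id) => r.
  by rewrite addrCA.
have [s [st E]] : exists s, 0 < s < t /\ phi (t *: v + a) - phi a = t * 'D_v phi (s *: v + a).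
  apply: mvt_dir => // s st.
  by apply: differentiableB; [exact/dsh/Ot|exact/df/O0].
have sc : 0 <= s <= t by case/andP: st => ? ?; rewrite !ltW.
have [s' [st' E']] : exists s', 0 < s' < t /\
  'D_v f (t *: w + (s *: v + a)) - 'D_v f (s *: v + a) = t * 'D_w ('D_v f) (s' *: w + (s *: v + a)).
  by apply: (@mvt_dir V ('D_v f) (s *: v + a) w t t0) => s' st'; exact: (dDf _ (inO _ _ sc st')).
exists s, s'; split=> //.
rewrite -E' -Dsh -deriveBf; [exact: E|exact/dsh/Ot|exact/df/O0].
Qed.

Lemma dist_lt_half (e x y z : R) :
  `|x - z| < e / 2 -> `|y - z| < e / 2 -> `|x - y| <= e.
Proof.
rewrite (distrC y) => h1 h2; rewrite -[x](subrK z) -addrA (le_trans (ler_normD _ _))//.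
by rewrite (splitr e) lerD// ltW.
Qed.

(** The second difference of [second_difference] is symmetric in [v] and [w]; dividing it by
    [t ^ 2] gives one mixed derivative at a point near [a], and the other at another point near
    [a], and both are continuous. *)
Lemma schwarz_scalar V (f : V -> R^o) (O : set V) a v w :
  open O -> O a -> smooth_on O f -> 'D_v ('D_w f) a = 'D_w ('D_v f) a.
Proof.
move=> oO Oa sf.
have [_ Df] := sf 2%N.
have cA u u' : {for a, continuous ('D_u ('D_u' f))}.
  by have [_ /(_ u) c] := Df u'; exact: c.
apply/eqP; rewrite -subr_eq0 -normr_le0; apply/ler_addgt0Pr => e e0; rewrite add0r.
have e20 : 0 < e / 2 by rewrite divr_gt0.
have : \forall x \near a, [/\ O x,
    `|'D_v ('D_w f) a - 'D_v ('D_w f) x| < e / 2 &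
    `|'D_w ('D_v f) a - 'D_w ('D_v f) x| < e / 2].
  have H1 : \forall x \near a, O x by exact: open_nbhs_nbhs.
  have H2 : \forall x \near a, `|'D_v ('D_w f) a - 'D_v ('D_w f) x| < e / 2.
    by have /cvgrPdist_lt/(_ _ e20) := cA v w.
  have H3 : \forall x \near a, `|'D_w ('D_v f) a - 'D_w ('D_v f) x| < e / 2.
    by have /cvgrPdist_lt/(_ _ e20) := cA w v.
  apply: (filterS _ (filterI H1 (filterI H2 H3))) => x [h1 [h2 h3]].
  exact: (And3 h1 h2 h3).
move=> /nbhs_ballP[d d0 Hd].
pose N := `|v| + `|w| + 1.
have N0 : 0 < N by rewrite ltr_wpDl// addr_ge0.
(* With this step all the intermediate points stay in the ball of radius [d]. *)
pose t := d / 2 / N.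
have t0 : 0 < t by rewrite !divr_gt0.
have inB u u' s s' : `|u| + `|u'| + 1 = N -> 0 <= s <= t -> 0 <= s' <= t -> ball a d (s' *: u' + (s *: u + a)).
  move=> EN /andP[s0 st] /andP[s0' st']; rewrite -ball_normE/= addrA addrC.
  rewrite opprD addrA subrr sub0r normrN (le_lt_trans (ler_normD _ _))//.
  rewrite !normrZ (ger0_norm s0) (ger0_norm s0').
  apply: (@le_lt_trans _ _ (t * N)).
    rewrite -EN; have := normr_ge0 u; have := normr_ge0 u'.
    by have := ltW t0; nra.
  by rewrite /t divfK ?gt_eqF// ltr_pdivrMr// ltr_pMr// ltr1n.
have EN : `|w| + `|v| + 1 = N by rewrite /N [`|w| + _]addrC.
have [s [s' [st st' E]]] : exists s s', [/\ 0 < s < t, 0 < s' < t &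
    f (t *: w + (t *: v + a)) - f (t *: v + a) - (f (t *: w + a) - f a)
    = t * (t * 'D_w ('D_v f) (s' *: w + (s *: v + a)))].
  apply: second_difference => // s s' h h'.
  by have [] := Hd _ (inB v w s s' erefl h h').
have [r [r' [rt rt' E']]] : exists s s', [/\ 0 < s < t, 0 < s' < t &
    f (t *: v + (t *: w + a)) - f (t *: w + a) - (f (t *: v + a) - f a)
    = t * (t * 'D_v ('D_w f) (s' *: v + (s *: w + a)))].
  apply: second_difference => // s1 s2 h h'.
  by have [] := Hd _ (inB w v s1 s2 EN h h').
have cl x : 0 < x < t -> 0 <= x <= t by case/andP => ? ?; rewrite !ltW.
have [_ _ H1] := Hd _ (inB v w s s' erefl (cl _ st) (cl _ st')).
have [_ H2 _] := Hd _ (inB w v r r' EN (cl _ rt) (cl _ rt')).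
have key (p q u z X Y : R) : p - q - (u - z) = t * (t * Y) ->
    p - u - (q - z) = t * (t * X) -> X = Y.
  move=> h1 h2; apply: (mulfI (lt0r_neq0 t0)); apply: (mulfI (lt0r_neq0 t0)).
  by rewrite -h1 -h2; ring.
rewrite addrCA in E'; have Em := key _ _ _ _ _ _ E E'.
rewrite Em in H2.
exact: (dist_lt_half H2 H1).
Qed.

Lemma schwarz V W (f : V -> W) (O : set V) a v w : findim W ->
  open O -> O a -> smooth_on O f -> 'D_v ('D_w f) a = 'D_w ('D_v f) a.
Proof.
move=> [m [e [l [cl El]]]] oO Oa sf.
have nO : \forall x \near a, O x by exact: open_nbhs_nbhs.
have dD u b : O b -> differentiable ('D_u f) b.
  by move=> Ob; have [_ /(_ u) [d _]] := sf 2%N; exact: d.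
have df b : O b -> differentiable f b by have [d _] := sf 1%N; exact: d.
have H i u u' : 'D_u ('D_u' (l i \o f)) a = l i ('D_u ('D_u' f) a).
  have [_ <-] := clin_comp (cl i) (dD u' a Oa).
  apply: near_eq_derive; apply: filterS nO => b Ob.
  by have [_ ->] := clin_comp (cl i) (df b Ob).
have E i : l i ('D_v ('D_w f) a) = l i ('D_w ('D_v f) a).
  rewrite -H -H; apply: (schwarz_scalar v w oO Oa) => r.
  exact: (Ck_clin_comp oO (cl i) (sf r)).
rewrite (El ('D_v ('D_w f) a)) (El ('D_w ('D_v f) a)).
by apply: eq_bigr => i _; rewrite E.
Qed.

End SecondDerivatives.

(** * Smooth functions *)

Section SmoothOn.
Context (R : realType).
Implicit Types V W F G : normedModType R.

Lemma smooth_diff V W (O : set V) (f : V -> W) a : smooth_on O f -> O a -> differentiable f a.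
Proof. by move=> /(_ 1%N) [df _]; exact: df. Qed.

Lemma smooth_D V W (O : set V) (f : V -> W) v : smooth_on O f -> smooth_on O ('D_v f).
Proof. by move=> sf r; have [_] := sf r.+1; exact. Qed.

Lemma smooth_cst V W (O : set V) (c : W) : smooth_on O (fun _ : V => c).
Proof. by move=> r; exact: Ck_cst. Qed.

Lemma smoothD V W (O : set V) (f g : V -> W) : open O ->
  smooth_on O f -> smooth_on O g -> smooth_on O (fun x => f x + g x).
Proof. by move=> oO sf sg r; exact: CkD. Qed.

Lemma smoothS V W (O : set V) (f : V -> R) (g : V -> W) : open O ->
  smooth_on O (f : V -> R^o) -> smooth_on O g -> smooth_on O (fun x => f x *: g x).
Proof. by move=> oO sf sg r; exact: CkS. Qed.

Lemma smoothM V (O : set V) (f g : V -> R^o) : open O ->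
  smooth_on O f -> smooth_on O g -> smooth_on O (fun x => f x * g x : R^o).
Proof. by move=> oO sf sg; exact: (smoothS oO sf sg). Qed.

Lemma smoothZ V W (O : set V) (k : R) (g : V -> W) : open O ->
  smooth_on O g -> smooth_on O (fun x => k *: g x).
Proof. by move=> oO sg; apply: smoothS => //; exact: smooth_cst. Qed.

Lemma smoothN V W (O : set V) (g : V -> W) : open O ->
  smooth_on O g -> smooth_on O (fun x => - g x).
Proof.
move=> oO sg; have := smoothZ (-1) oO sg.
by rewrite (_ : (fun x => -1 *: g x) = fun x => - g x)//; apply/funext => x; rewrite scaleN1r.
Qed.

Lemma smoothB V W (O : set V) (f g : V -> W) : open O ->
  smooth_on O f -> smooth_on O g -> smooth_on O (fun x => f x - g x).
Proof. by move=> oO sf sg; apply: smoothD => //; exact: smoothN. Qed.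

Lemma smoothV V (O : set V) (f : V -> R) : open O -> (forall a, O a -> f a != 0) ->
  smooth_on O (f : V -> R^o) -> smooth_on O ((fun x => (f x)^-1) : V -> R^o).
Proof. by move=> oO f0 sf r; exact: CkV. Qed.

Lemma smooth_clin V W (O : set V) (l : V -> W) : clin l -> smooth_on O l.
Proof. by move=> cl r; exact: Ck_clin. Qed.

Lemma smooth_clin_comp V W F (O : set V) (l : W -> F) (f : V -> W) : open O -> clin l ->
  smooth_on O f -> smooth_on O (l \o f).
Proof. by move=> oO cl sf r; exact: Ck_clin_comp. Qed.

Lemma smooth_sum V W (O : set V) m (f : 'I_m -> V -> W) : open O ->
  (forall i, smooth_on O (f i)) -> smooth_on O (fun x => \sum_i f i x).
Proof. by move=> oO sf r; apply: Ck_sum => // i; exact: sf. Qed.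

Lemma smooth_pair V W F (O : set V) (f : V -> W) (g : V -> F) : open O ->
  smooth_on O f -> smooth_on O g -> smooth_on O (fun x => (f x, g x)).
Proof. by move=> oO sf sg r; exact: Ck_pair. Qed.

Lemma smooth_moving V F G (O : set V) (T : V -> F -> G) (Y : V -> F) :
  findim F -> open O ->
  (forall q, O q -> forall (k : R) u w, T q (k *: u + w) = k *: T q u + T q w) ->
  (forall u, smooth_on O (T ^~ u)) -> smooth_on O Y -> smooth_on O (fun q => T q (Y q)).
Proof. by move=> fF oO lT sT sY r; apply: Ck_moving => // u; exact: sT. Qed.

Lemma smooth_comp V W F (O : set V) (O' : set W) (f : V -> W) (g : W -> F) :
  findim W -> open O -> (forall a, O a -> O' (f a)) ->
  smooth_on O f -> smooth_on O' g -> smooth_on O (g \o f).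
Proof. by move=> fW oO fO sf sg r; exact: (Ck_comp fW oO fO (sf r) (sg r)). Qed.

Lemma smooth_eq V W (O : set V) (f g : V -> W) : open O ->
  (forall a, O a -> f a = g a) -> smooth_on O f -> smooth_on O g.
Proof. by move=> oO E sf r; exact: (Ck_eq oO E (sf r)). Qed.

Lemma smooth_sub V W (O O' : set V) (f : V -> W) : O' `<=` O ->
  smooth_on O f -> smooth_on O' f.
Proof. by move=> s sf r; exact: (Ck_sub s (sf r)). Qed.

Lemma smooth_local V W (O : set V) (f : V -> W) :
  (forall a, O a -> exists O', O' a /\ smooth_on O' f) -> smooth_on O f.
Proof. by move=> H r; apply: Ck_local => a /H [U [Ua sU]]; exists U. Qed.

Lemma derive_eq_on V W (O : set V) (f g : V -> W) a v : open O -> O a ->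
  (forall b, O b -> f b = g b) -> 'D_v f a = 'D_v g a.
Proof.
move=> oO Oa E; apply: near_eq_derive.
by apply: filterS (open_nbhs_nbhs (conj oO Oa)) => b; exact: E.
Qed.

End SmoothOn.

(** * Calculus with opaque derivatives *)

(** A locked copy of the directional derivative: unification never unfolds it to a limit when it
    compares two different derivatives. *)
HB.lock Definition der (R : realType) (V W : normedModType R) (v : V) (f : V -> W) (a : V) : W :=
  'D_v f a.

Section LockedDerivative.
Context (R : realType).
Implicit Types V W F G : normedModType R.

Lemma derE V W (v : V) (f : V -> W) : der v f = 'D_v f.
Proof. by rewrite der.unlock. Qed.

Lemma derEx V W (v : V) (f : V -> W) a : 'D_v f a = der v f a.
Proof. by rewrite derE. Qed.

Lemma der_linear V W (f : V -> W) a k v w : differentiable f a ->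
  der (k *: v + w) f a = k *: der v f a + der w f a.
Proof. by rewrite !derE; exact: derive_linear. Qed.

Lemma der0 V W (f : V -> W) a : der 0 f a = 0.
Proof. by rewrite derE derive0. Qed.

Lemma der_cst V W (c : W) (v a : V) : der v (fun=> c) a = 0.
Proof. by rewrite derE derive_cst. Qed.

Lemma derD V W (f g : V -> W) a v : differentiable f a -> differentiable g a ->
  der v (fun x => f x + g x) a = der v f a + der v g a.
Proof. by rewrite !derE; exact: deriveDf. Qed.

Lemma derN V W (f : V -> W) a v : differentiable f a ->
  der v (fun x => - f x) a = - der v f a.
Proof. by rewrite !derE; exact: deriveNf. Qed.

Lemma derB V W (f g : V -> W) a v : differentiable f a -> differentiable g a ->
  der v (fun x => f x - g x) a = der v f a - der v g a.
Proof. by rewrite !derE; exact: deriveBf. Qed.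

Lemma derS V W (f : V -> R) (g : V -> W) a v :
  differentiable (f : V -> R^o) a -> differentiable g a ->
  der v (fun x => f x *: g x) a = (der v (f : V -> R^o) a : R) *: g a + f a *: der v g a.
Proof. by rewrite !derE; exact: deriveSf. Qed.

Lemma der_comp V W F (f : V -> W) (g : W -> F) a v :
  differentiable f a -> differentiable g (f a) ->
  der v (g \o f) a = der (der v f a) g (f a).
Proof. by rewrite !derE; exact: derive_comp. Qed.

Lemma clin_der V W (l : V -> W) a : clin l ->
  differentiable l a /\ forall v, der v l a = l v.
Proof. by move=> /(clin_diff a)[dl Dl]; split=> // v; rewrite derE. Qed.

Lemma der_moving V F G (O : set V) (T : V -> F -> G) (Y : V -> F) a :
  findim F -> open O -> O a ->
  (forall q, O q -> forall (k : R) u w, T q (k *: u + w) = k *: T q u + T q w) ->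
  (forall u, differentiable (T ^~ u) a) -> differentiable Y a ->
  differentiable (fun q => T q (Y q)) a /\
  forall v, der v (fun q => T q (Y q)) a = der v (T ^~ (Y a)) a + T a (der v Y a).
Proof.
move=> fF oO Oa lT dT dY; have [d D] := derive_moving fF oO Oa lT dT dY.
by split=> // v; rewrite !derE D.
Qed.

Lemma der_eq_on V W (O : set V) (f g : V -> W) a v : open O -> O a ->
  (forall b, O b -> f b = g b) -> der v f a = der v g a.
Proof. by rewrite !derE; exact: derive_eq_on. Qed.

Lemma smooth_der V W (O : set V) (f : V -> W) v : smooth_on O f -> smooth_on O (der v f).
Proof. by rewrite derE; exact: smooth_D. Qed.

Lemma der_schwarz V W (f : V -> W) (O : set V) a v w : findim W ->
  open O -> O a -> smooth_on O f -> der v (der w f) a = der w (der v f) a.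
Proof. by rewrite !derE; exact: schwarz. Qed.

Lemma der_pair V W F (f : V -> W) (g : V -> F) v a :
  differentiable f a -> differentiable g a ->
  der v (fun q => (f q, g q)) a = (der v f a, der v g a).
Proof.
move=> df dg; have dp := differentiable_pair df dg.
by rewrite !derE (deriveE _ dp) (deriveE _ df) (deriveE _ dg) diff_pair.
Qed.

End LockedDerivative.

Section ScalarRules.
Context (R : realType) (V : normedModType R).
Implicit Types (f g : V -> R) (v w a : V) (O : set V).

(** Real-valued functions are kept at type [R], so that [ring] and [lra] apply to derivatives. *)
Definition derR v f : V -> R := der v (f : V -> R^o).
Definition smoothR O f : Prop := smooth_on O (f : V -> R^o).

Lemma sm_diff O f a : smoothR O f -> O a -> differentiable (f : V -> R^o) a.
Proof. exact: smooth_diff. Qed.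

Lemma sm_cst O (c : R) : smoothR O (fun=> c). Proof. exact: smooth_cst. Qed.
Lemma sm_add O f g : open O -> smoothR O f -> smoothR O g -> smoothR O (fun q => f q + g q).
Proof. exact: smoothD. Qed.
Lemma sm_sub O f g : open O -> smoothR O f -> smoothR O g -> smoothR O (fun q => f q - g q).
Proof. exact: smoothB. Qed.
Lemma sm_mul O f g : open O -> smoothR O f -> smoothR O g -> smoothR O (fun q => f q * g q).
Proof. exact: smoothM. Qed.
Lemma sm_derR O f v : smoothR O f -> smoothR O (derR v f). Proof. exact: smooth_der. Qed.

Lemma derR_cst (c : R) v a : derR v (fun=> c) a = 0.
Proof. exact: der_cst. Qed.

Lemma derRD O f g v a : smoothR O f -> smoothR O g -> O a ->
  derR v (fun q => f q + g q) a = derR v f a + derR v g a.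
Proof. by move=> sf sg Oa; apply: derD; [exact: sm_diff sf Oa|exact: sm_diff sg Oa]. Qed.

Lemma derRB O f g v a : smoothR O f -> smoothR O g -> O a ->
  derR v (fun q => f q - g q) a = derR v f a - derR v g a.
Proof. by move=> sf sg Oa; apply: derB; [exact: sm_diff sf Oa|exact: sm_diff sg Oa]. Qed.

Lemma derRM O f g v a : smoothR O f -> smoothR O g -> O a ->
  derR v (fun q => f q * g q) a = derR v f a * g a + f a * derR v g a.
Proof.
by move=> sf sg Oa; apply: (@derS R V R^o f g); [exact: sm_diff sf Oa|exact: sm_diff sg Oa].
Qed.

Lemma derRZ O (c : R) f v a : smoothR O f -> O a -> derR v (fun q => c * f q) a = c * derR v f a.
Proof. by move=> sf Oa; rewrite (derRM v (sm_cst O c) sf Oa) derR_cst mul0r add0r. Qed.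

Lemma derR_lin O f (k : R) v w a : smoothR O f -> O a -> derR (k *: v + w) f a = k * derR v f a + derR w f a.
Proof. by move=> sf Oa; apply: (der_linear k v w (sm_diff sf Oa)). Qed.

Lemma derR_eq O f g v a : open O -> O a -> (forall b, O b -> f b = g b) -> derR v f a = derR v g a.
Proof. by move=> oO Oa E; apply: (@der_eq_on R V R^o O). Qed.

Lemma derR_schwarz O f v w a : open O -> O a -> smoothR O f -> derR v (derR w f) a = derR w (derR v f) a.
Proof. by move=> oO Oa sf; apply: (@der_schwarz R V R^o f O) => //; exact: findim_R. Qed.

Lemma derR_moving O f (X : V -> V) v a : findim V -> open O -> O a -> smoothR O f ->
  differentiable X a ->
  derR v (fun q => derR (X q) f q) a = derR v (derR (X a) f) a + derR (der v X a) f a.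
Proof.
move=> fV oO Oa sf dX.
have [] := @der_moving R V V R^o O (fun q u => derR u f q) X a fV oO Oa _ _ dX.
- by move=> q Oq k u w; apply: derR_lin sf Oq.
- by move=> u; exact: sm_diff (sm_derR u sf) Oa.
by move=> _ /(_ v).
Qed.

Lemma sm_moving O f (X : V -> V) : findim V -> open O -> smoothR O f ->
  smooth_on O X -> smoothR O (fun q => derR (X q) f q).
Proof.
move=> fV oO sf sX.
apply: (@smooth_moving R V V R^o O (fun q u => derR u f q) X fV oO _ _ sX).
- by move=> q Oq k u w; apply: derR_lin sf Oq.
- by move=> u; exact: (sm_derR u sf).
Qed.

Lemma der_along_moving (W : normedModType R) O (f : V -> W) (X : V -> V) v a :
  findim V -> open O -> O a -> smooth_on O f -> differentiable X a ->
  der v (fun q => der (X q) f q) a = der v (der (X a) f) a + der (der v X a) f a.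
Proof.
move=> fV oO Oa sf dX.
have [] := @der_moving R V V W O (fun q u => der u f q) X a fV oO Oa _ _ dX.
- by move=> q Oq k u w; apply: der_linear; exact: smooth_diff sf Oq.
- by move=> u; exact: smooth_diff (smooth_der u sf) Oa.
by move=> _ ->.
Qed.

Lemma smooth_along_moving (W : normedModType R) O (f : V -> W) (X : V -> V) : findim V -> open O ->
  smooth_on O f -> smooth_on O X -> smooth_on O (fun q => der (X q) f q).
Proof.
move=> fV oO sf sX.
apply: (@smooth_moving R V V W O (fun q u => der u f q) X fV oO _ _ sX).
- by move=> q Oq k u w; apply: der_linear; exact: smooth_diff sf Oq.
- by move=> u; exact: (smooth_der u sf).
Qed.

Section Vectors.
Context (W : normedModType R).
Implicit Types (X Y : V -> W) (x : W).

Lemma der_sub_on O X Y v a : smooth_on O X -> smooth_on O Y -> O a ->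
  der v (fun q => X q - Y q) a = der v X a - der v Y a.
Proof. by move=> sf sg Oa; apply: derB; [exact: smooth_diff sf Oa|exact: smooth_diff sg Oa]. Qed.

Lemma der_add_on O X Y v a : smooth_on O X -> smooth_on O Y -> O a ->
  der v (fun q => X q + Y q) a = der v X a + der v Y a.
Proof. by move=> sf sg Oa; apply: derD; [exact: smooth_diff sf Oa|exact: smooth_diff sg Oa]. Qed.

Lemma der_scale_on O f X v a : smoothR O f -> smooth_on O X -> O a ->
  der v (fun q => f q *: X q) a = derR v f a *: X a + f a *: der v X a.
Proof. by move=> sf sg Oa; apply: derS; [exact: sm_diff sf Oa|exact: smooth_diff sg Oa]. Qed.

Lemma der_scale_vec O f x v a : smoothR O f -> O a -> der v (fun q => f q *: x) a = derR v f a *: x.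
Proof.
by move=> sf Oa; rewrite (der_scale_on v sf (smooth_cst O x) Oa) der_cst scaler0 addr0.
Qed.

End Vectors.

End ScalarRules.

(** * Torsion-free connections in coordinates *)

(** Supplies the auxiliary vectors that are used in place of traces: a tensor identity is tested
    on a vector on which all unwanted terms vanish. *)
Lemma common_kernel (R : realType) n (f h : 'rV[R]_n -> R) : (2 < n)%N ->
  (forall (k : R) u w, f (k *: u + w) = k * f u + f w) ->
  (forall (k : R) u w, h (k *: u + w) = k * h u + h w) ->
  exists c, [/\ c != 0, f c = 0 & h c = 0].
Proof.
move=> n2 lf lh.
pose B : 'M[R]_(n, 2) := \matrix_(i, j) (if j == 0 then f (delta_mx 0 i) else h (delta_mx 0 i)).
have : kermx B != 0.
  rewrite -mxrank_eq0 mxrank_ker subn_eq0 -ltnNge.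
  exact: leq_ltn_trans (rank_leq_col B) n2.
case/rowV0Pn => c /sub_kermxP cB c0; exists c.
have ex (q : 'rV[R]_n -> R) : (forall (k : R) u w, q (k *: u + w) = k * q u + q w) ->
    q c = \sum_i c 0 i * q (delta_mx 0 i).
  move=> lq.
  by rewrite (@linear_expand R _ R^o n (fun i => delta_mx 0 i) (fun i (v : 'rV[R]_n) => v 0 i) q
    (fun v => row_sum_delta v) lq c).
split=> //.
- have := congr1 (fun m : 'M[R]_(1, 2) => m 0 0) cB; rewrite !mxE => <-.
  by rewrite ex//; apply: eq_bigr => i _; rewrite mxE.
- have := congr1 (fun m : 'M[R]_(1, 2) => m 0 1) cB; rewrite !mxE => <-.
  by rewrite ex//; apply: eq_bigr => i _; rewrite mxE.
Qed.

(** The vertical lift. *)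
Definition vert (R : realType) (n : nat) (a : 'rV[R]_n) : 'rV[R]_n * 'rV[R]_n := (0, a).

(** The form [a |-> g(eta, a) = L ell(a)], written as a vertical derivative by Euler's theorem. *)
HB.lock Definition theta (R : realType) (n : nat) (L : 'rV[R]_n * 'rV[R]_n -> R) (a : 'rV[R]_n)
    (p : 'rV[R]_n * 'rV[R]_n) : R :=
  2^-1 * derR (vert a) (fun q => L q ^+ 2) p.
HB.lock Definition gmet (R : realType) (n : nat) (L : 'rV[R]_n * 'rV[R]_n -> R) (a b : 'rV[R]_n)
    (p : 'rV[R]_n * 'rV[R]_n) : R :=
  2^-1 * derR (vert a) (derR (vert b) (fun q => L q ^+ 2)) p.

Section LocalModel.
Context (R : realType) (n : nat).
Local Notation E := 'rV[R]_n.
Local Notation V := (E * E)%type.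
Implicit Types (p q : V) (a b c z w : E).

Lemma findimV : findim V.
Proof. by apply: findim_prod; exact: findim_rV. Qed.

Lemma clin_vert : clin (@vert R n).
Proof.
exact: (@clin_inr R E E).
Qed.

Lemma clin_fst : clin (fst : V -> E).
Proof. by split=> // x; exact: cvg_fst. Qed.

Lemma clin_snd : clin (snd : V -> E).
Proof. by split=> // x; exact: cvg_snd. Qed.

Definition bilinear_family (O : set V) (F : V -> E -> E -> E) : Prop :=
  [/\ forall p, O p -> forall b (k : R) u w, F p (k *: u + w) b = k *: F p u b + F p w b,
      forall p, O p -> forall a (k : R) u w, F p a (k *: u + w) = k *: F p a u + F p a w &
      forall a b, smooth_on O (fun q => F q a b)].

Section Bilinear.
Context (O : set V) (oO : open O) (F : V -> E -> E -> E) (BF : bilinear_family O F).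

Lemma bil_diff Y Z p : O p -> differentiable Y p -> differentiable Z p ->
  differentiable (fun q => F q (Y q) (Z q)) p /\ forall w : V,
  der w (fun q => F q (Y q) (Z q)) p = der w (fun q => F q (Y p) (Z p)) p
    + F p (Y p) (der w Z p) + F p (der w Y p) (Z p).
Proof.
move=> Op dY dZ; have [Fl Fr sF] := BF.
have H u : differentiable (fun q => F q u (Z q)) p /\ forall w : V,
    der w (fun q => F q u (Z q)) p = der w (fun q => F q u (Z p)) p + F p u (der w Z p).
  apply: (@der_moving R V E E O (fun q w => F q u w) Z p (@findim_rV R n) oO Op _ _ dZ).
    by move=> q Oq k u' w; exact: Fr.
  by move=> u'; exact: smooth_diff (sF u u') Op.
have [] := @der_moving R V E E O (fun q u => F q u (Z q)) Y p (@findim_rV R n) oO Op _ _ dY.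
- by move=> q Oq k u' w; exact: Fl.
- by move=> u; case: (H u).
by move=> d D; split=> // w; rewrite D; have [_ ->] := H (Y p).
Qed.

Lemma bil_smooth Y Z : smooth_on O Y -> smooth_on O Z ->
  smooth_on O (fun q => F q (Y q) (Z q)).
Proof.
move=> sY sZ; have [Fl Fr sF] := BF.
apply: (@smooth_moving R V E E O (fun q u => F q u (Z q)) Y (@findim_rV R n) oO _ _ sY).
  by move=> q Oq k u' w; exact: Fl.
move=> u; apply: (@smooth_moving R V E E O (fun q w => F q u w) Z (@findim_rV R n) oO _ _ sZ).
  by move=> q Oq k u' w; exact: Fr.
by move=> u'; exact: (sF u u').
Qed.

End Bilinear.

(** The horizontal lift, for the connection form [F]. *)
Definition hor (F : V -> E -> E -> E) p a : V := (a, - F p a p.2).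

(** The h-curvature of the connection with form [F], where K(X, Y) = - [D_X, D_Y] + D_[X, Y]. *)
Definition Rcurv (F : V -> E -> E -> E) p a b z : E :=
  - der (hor F p a) (fun q => F q b z) p + der (hor F p b) (fun q => F q a z) p
  - F p a (F p b z) + F p b (F p a z).

(** What a chart retains of a Finsler manifold with its Berwald connection; [lb_hv] is the
    vanishing of the (v)hv-torsion, and [lb_L] that of the horizontal derivative of [L]. *)
Record local_berwald (O : set V) (L : V -> R) (F : V -> E -> E -> E) : Prop := LocalBerwald {
  lb_open : open O;
  lb_cone : forall p z, O p -> (O (p.1, z) <-> z != 0);
  lb_smooth : smoothR O L;
  lb_pos : forall p, O p -> 0 < L p;
  lb_hom : forall x y (t : R), O (x, y) -> 0 < t -> L (x, t *: y) = t * L (x, y);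
  lb_gpos : forall p v, O p -> v != 0 -> 0 < gmet L v v p;
  lb_bil : bilinear_family O F;
  lb_sym : forall p a b, O p -> F p a b = F p b a;
  lb_hv : forall p a b, O p -> der (vert b) (fun q => F q a p.2) p = 0;
  lb_L : forall p a, O p -> derR (hor F p a) L p = 0 }.

Section Connection.
Context (O : set V) (L : V -> R) (F : V -> E -> E -> E) (lb : local_berwald O L F).
Let oO := lb_open lb.
Let BF := lb_bil lb.

(** The nonlinear connection. *)
Definition ncon a q : E := F q a q.2.

Lemma smooth_snd : smooth_on O (snd : V -> E).
Proof. exact: smooth_clin clin_snd. Qed.

Lemma FDr p a u w : O p -> F p a (u + w) = F p a u + F p a w.
Proof. by move=> Op; have [_ H _] := BF; have := H p Op a 1 u w; rewrite !scale1r. Qed.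
Lemma F0r p a : O p -> F p a 0 = 0.
Proof. by move=> Op; have := FDr a 0 0 Op; rewrite addr0 => /eqP; rewrite -subr_eq subrr => /eqP. Qed.
Lemma FZr p a (k : R) u : O p -> F p a (k *: u) = k *: F p a u.
Proof. by move=> Op; have [_ H _] := BF; have := H p Op a k u 0; rewrite F0r// !addr0. Qed.
Lemma FNr p a u : O p -> F p a (- u) = - F p a u.
Proof. by move=> Op; rewrite -scaleN1r FZr// scaleN1r. Qed.

Lemma smooth_ncon a : smooth_on O (ncon a).
Proof. exact: (bil_smooth oO BF (smooth_cst O a) smooth_snd). Qed.

Lemma der_ncon p a (w : V) : O p -> der w (ncon a) p = der w (fun q => F q a p.2) p + F p a w.2.
Proof.
move=> Op.
have [_ ->] := bil_diff oO BF Op (smooth_diff (smooth_cst O a) Op) (smooth_diff smooth_snd Op).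
have [_ ->] := clin_der p clin_snd.
rewrite der_cst; have [Fl _ _] := BF.
have := Fl p Op p.2 1 0 0; rewrite !scale1r addr0 => /eqP.
by rewrite -subr_eq subrr => /eqP <-; rewrite addr0.
Qed.

(** The (v)hv-torsion is the defect in this equation, by the product rule for [F q a q.2]. *)
Lemma vder_ncon p a b : O p -> der (vert b) (ncon a) p = F p a b.
Proof. by move=> Op; rewrite der_ncon// (lb_hv lb)// add0r. Qed.

Lemma smooth_hor a : smooth_on O (fun q => hor F q a).
Proof.
apply: (smooth_pair oO (smooth_cst O a)); apply: smoothN => //; exact: smooth_ncon.
Qed.

Lemma diff_hor a p : O p -> differentiable (fun q => hor F q a) p.
Proof. exact: smooth_diff (smooth_hor a). Qed.

Lemma der_hor p a (w : V) : O p -> der w (fun q => hor F q a) p = vert (- der w (ncon a) p).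
Proof.
move=> Op; rewrite (@der_pair R V E E (fun=> a) (fun q => - ncon a q)).
- by rewrite der_cst derN//; exact: smooth_diff (smooth_ncon a) Op.
- exact: smooth_diff (smooth_cst O a) Op.
- exact: smooth_diff (smoothN oO (smooth_ncon a)) Op.
Qed.

(** The (v)h-torsion, as the curvature of the nonlinear connection (see [RhatE]). *)
Definition Rhat a b p : E := der (hor F p b) (ncon a) p - der (hor F p a) (ncon b) p.

Lemma RhatE p a b : O p -> Rcurv F p a b p.2 = Rhat a b p.
Proof.
move=> Op; rewrite /Rhat !der_ncon//= !FNr//.
by rewrite /Rcurv /ncon; apply/rowP => i; rewrite !mxE; ring.
Qed.

Lemma smooth_dhor (W : normedModType R) (f : V -> W) a : smooth_on O f ->
  smooth_on O (fun q => der (hor F q a) f q).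
Proof. by move=> sf; apply: (smooth_along_moving findimV oO sf); exact: smooth_hor. Qed.

Lemma smooth_Rhat a b : smooth_on O (Rhat a b).
Proof. by apply: smoothB => //; apply: smooth_dhor; exact: smooth_ncon. Qed.

(** The horizontal lift of [a] varies with the base point; the second term is its derivative. *)
Lemma der_dhor (W : normedModType R) (f : V -> W) a (w : V) p : findim W -> O p -> smooth_on O f ->
  der w (fun q => der (hor F q a) f q) p
  = der (hor F p a) (der w f) p - der (vert (der w (ncon a) p)) f p.
Proof.
move=> fW Op sf; rewrite (der_along_moving w findimV oO Op sf (diff_hor a Op)) der_hor//.
rewrite (der_schwarz w _ fW oO Op sf); congr (_ + _).
have -> : vert (- der w (ncon a) p) = (-1) *: vert (der w (ncon a) p) + 0.
  by apply: injective_projections; rewrite /= ?scaler0 ?scaleN1r addr0.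
rewrite der_linear; last exact: smooth_diff sf Op.
by rewrite der0 addr0 scaleN1r.
Qed.

(** Vertical derivatives of [Rhat] are computed by [der_dhor], and vertical derivatives of the
    nonlinear connection are values of [F]. *)
Lemma vder_Rhat p a b z : O p -> der (vert z) (Rhat a b) p = Rcurv F p a b z.
Proof.
move=> Op.
have d x y : differentiable (fun q => der (hor F q x) (ncon y) q) p.
  exact: smooth_diff (smooth_dhor x (smooth_ncon y)) Op.
rewrite (derB _ (d b a) (d a b)).
rewrite (der_dhor b (vert z) (@findim_rV R n) Op (smooth_ncon a)).
rewrite (der_dhor a (vert z) (@findim_rV R n) Op (smooth_ncon b)).
rewrite !vder_ncon//.
have H x y : der (hor F p x) (der (vert z) (ncon y)) p = der (hor F p x) (fun q => F q y z) p.
  by apply: (der_eq_on _ oO Op) => q Oq; rewrite vder_ncon.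
by rewrite !H /Rcurv; apply/rowP => i; rewrite !mxE; ring.
Qed.

Lemma Rcurv_anti p a b z : Rcurv F p b a z = - Rcurv F p a b z.
Proof. by rewrite /Rcurv; apply/rowP => i; rewrite !mxE; ring. Qed.

(** Holds because [F] is symmetric. *)
Lemma first_bianchi p a b c : O p -> Rcurv F p a b c + Rcurv F p b c a + Rcurv F p c a b = 0.
Proof.
move=> Op.
have H x y z : der (hor F p x) (fun q => F q y z) p = der (hor F p x) (fun q => F q z y) p.
  by apply: (der_eq_on _ oO Op) => q Oq; rewrite (lb_sym lb).
rewrite /Rcurv (H a c b) (H b a c) (H c b a).
rewrite (lb_sym lb c b Op) (lb_sym lb a c Op) (lb_sym lb b a Op).
by apply/rowP => i; rewrite !mxE; ring.
Qed.

(** Horizontal lifts of constant vectors have a vertical bracket, namely the (v)h-torsion. *)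
Lemma hor_comm (W : normedModType R) (f : V -> W) a b p : findim W -> O p -> smooth_on O f ->
  der (hor F p a) (fun q => der (hor F q b) f q) p
  - der (hor F p b) (fun q => der (hor F q a) f q) p = der (vert (Rhat a b p)) f p.
Proof.
move=> fW Op sf; have df := smooth_diff sf Op.
rewrite (der_along_moving (hor F p a) findimV oO Op sf (diff_hor b Op)) (der_hor b _ Op).
rewrite (der_along_moving (hor F p b) findimV oO Op sf (diff_hor a Op)) (der_hor a _ Op).
rewrite (der_schwarz (hor F p b) (hor F p a) fW oO Op sf).
have -> : vert (Rhat a b p) = (-1) *: vert (- der (hor F p b) (ncon a) p) + vert (- der (hor F p a) (ncon b) p).
  by apply: injective_projections; rewrite /= ?scaler0 ?scaleN1r ?opprK ?addr0.
rewrite der_linear// scaleN1r.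
have regroup (x y z : W) : x + y - (x + z) = - z + y by rewrite opprD addrACA subrr add0r addrC.
exact: regroup.
Qed.

(** The Jacobi identity for three horizontal lifts, read on the nonlinear connection: each
    double horizontal derivative of [ncon] occurs twice, with opposite signs, by [hor_comm]. *)
Lemma second_bianchi p a b c : O p ->
  (der (hor F p a) (Rhat b c) p + F p a (Rhat b c p))
  + (der (hor F p b) (Rhat c a) p + F p b (Rhat c a p))
  + (der (hor F p c) (Rhat a b) p + F p c (Rhat a b p)) = 0.
Proof.
move=> Op.
have d x y : differentiable (fun q => der (hor F q x) (ncon y) q) p.
  exact: smooth_diff (smooth_dhor x (smooth_ncon y)) Op.
have DR x y (w : V) : der w (Rhat x y) p = der w (fun q => der (hor F q y) (ncon x) q) p
    - der w (fun q => der (hor F q x) (ncon y) q) p := derB w (d y x) (d x y).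
have H x y z : F p z (Rhat x y p) = der (hor F p x) (fun q => der (hor F q y) (ncon z) q) p
    - der (hor F p y) (fun q => der (hor F q x) (ncon z) q) p.
  by rewrite (hor_comm x y (@findim_rV R n) Op (smooth_ncon z)) vder_ncon.
rewrite !DR !H.
have regroup (x1 x2 x3 x4 x5 x6 : E) :
  (x1 - x2 + (x3 - x4)) + (x5 - x3 + (x6 - x1)) + (x4 - x6 + (x2 - x5)) = 0.
  by apply/rowP => i; rewrite !mxE; ring.
exact: regroup.
Qed.

End Connection.
End LocalModel.

(** * The Finsler metric in coordinates *)

Section LocalFinsler.
Context (R : realType) (n : nat).
Local Notation E := 'rV[R]_n.
Local Notation V := (E * E)%type.
Implicit Types (p q : V) (a b c z w : E).

Lemma vertP (k : R) a b : vert (k *: a + b) = k *: vert a + vert b.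
Proof. by apply: injective_projections => //=; rewrite scaler0 addr0. Qed.

(** Euler's theorem in degrees zero and one, where the function is affine along a ray. *)
Lemma euler (f : V -> R) p (d : R) :
  (forall t : R, 0 < t -> f (p.1, t *: p.2) = f p + (t - 1) * d) -> derR (vert p.2) f p = d.
Proof.
move=> H; rewrite /derR derE /derive.
apply: (@lim_near_cst R^o); first exact: norm_hausdorff.
near=> h => /=.
have h0 : h != 0 by near: h; exact: nbhs_dnbhs_neq.
have h1 : 0 < 1 + h.
  have : `|h| < 1.
    near: h; exact: dnbhs0_lt.
  by rewrite ltr_norml => /andP[h1 _]; rewrite -ltrBlDl sub0r.
have -> : h *: vert p.2 + p = (p.1, (1 + h) *: p.2).
  by apply: injective_projections; rewrite /= ?scaler0 ?add0r// scalerDl scale1r addrC.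
rewrite H// [_ *: _](_ : _ = h^-1 * (f p + (1 + h - 1) * d - f p))//.
by rewrite [1 + h]addrC addrK [f p + _]addrC addrK mulKf.
Unshelve. all: by end_near. Qed.

Section Metric.
Context (O : set V) (L : V -> R) (F : V -> E -> E -> E) (lb : local_berwald O L F).
Let oO := lb_open lb.
Local Notation L2 := (fun q => L q ^+ 2).

Lemma sm_L2 : smoothR O L2.
Proof. exact: (sm_mul oO (lb_smooth lb) (lb_smooth lb)). Qed.

Lemma sm_theta a : smoothR O (theta L a).
Proof.
rewrite (_ : theta L a = fun p => 2^-1 * derR (vert a) L2 p); last by apply/funext => p; rewrite theta.unlock.
by apply: sm_mul => //; [exact: sm_cst|exact: sm_derR sm_L2].
Qed.

Lemma sm_gmet a b : smoothR O (gmet L a b).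
Proof.
rewrite (_ : gmet L a b = fun p => 2^-1 * derR (vert a) (derR (vert b) L2) p); last first.
  by apply/funext => p; rewrite gmet.unlock.
by apply: sm_mul => //; [exact: sm_cst|exact: sm_derR (sm_derR _ sm_L2)].
Qed.

Lemma derR_L2 a p : derR (vert a) (fun q => L q ^+ 2) p = 2 * theta L a p.
Proof. by rewrite theta.unlock mulVKf// pnatr_eq0. Qed.

Lemma derR_theta a b p : O p -> derR (vert b) (theta L a) p = gmet L b a p.
Proof.
move=> Op; rewrite gmet.unlock -(derRZ _ _ (sm_derR (vert a) sm_L2) Op).
by congr (derR _ _ _); apply/funext => q; rewrite theta.unlock.
Qed.

Lemma theta_lin p : O p -> forall (k : R) a b, theta L (k *: a + b) p = k * theta L a p + theta L b p.
Proof. by move=> Op k a b; rewrite theta.unlock vertP (derR_lin _ _ _ sm_L2 Op); ring. Qed.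

Lemma gmet_sym p a b : O p -> gmet L a b p = gmet L b a p.
Proof. by move=> Op; rewrite gmet.unlock (derR_schwarz _ _ oO Op sm_L2). Qed.

Lemma gmet_linl p b : O p -> forall (k : R) a c, gmet L (k *: a + c) b p = k * gmet L a b p + gmet L c b p.
Proof. by move=> Op k a c; rewrite gmet.unlock vertP (derR_lin _ _ _ (sm_derR _ sm_L2) Op); ring. Qed.

Lemma gmet_linr p b : O p -> forall (k : R) a c, gmet L b (k *: a + c) p = k * gmet L b a p + gmet L b c p.
Proof. by move=> Op k a c; rewrite !(gmet_sym b)// gmet_linl. Qed.

(** Third vertical derivatives of [L ^ 2] are symmetric. *)
Lemma derR_gmet a b c p : O p -> derR (vert c) (gmet L a b) p = derR (vert b) (gmet L a c) p.
Proof.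
move=> Op.
have H x y z : derR (vert z) (gmet L x y) p = 2^-1 * derR (vert z) (derR (vert x) (derR (vert y) L2)) p.
  rewrite -(derRZ _ _ (sm_derR _ (sm_derR _ sm_L2)) Op).
  by congr (derR _ _ _); apply/funext => q; rewrite gmet.unlock.
rewrite !H (derR_schwarz (vert c) (vert a) oO Op (sm_derR _ sm_L2)).
rewrite (derR_schwarz (vert b) (vert a) oO Op (sm_derR _ sm_L2)).
congr (_ * _); apply: (derR_eq _ oO Op) => q Oq.
exact: derR_schwarz oO Oq sm_L2.
Qed.

Lemma derR_L2_eta p : O p -> derR (vert p.2) L2 p = 2 * L2 p.
Proof.
move=> Op; have E : derR (vert p.2) L p = L p.
  apply: euler => t t0; rewrite (lb_hom lb)//; last by case: p Op.
  by case: p Op => x y Op /=; ring.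
have := derRM (vert p.2) (lb_smooth lb) (lb_smooth lb) Op.
by rewrite E => ->; ring.
Qed.

Lemma theta_eta p : O p -> theta L p.2 p = L p ^+ 2.
Proof. by move=> Op; rewrite theta.unlock derR_L2_eta// mulKf// pnatr_eq0. Qed.

Lemma der_snd (v : V) p : der v (snd : V -> E) p = v.2.
Proof. by have [_ ->] := clin_der p (@clin_snd R n). Qed.

Definition vsnd q : V := vert q.2.
Lemma smooth_vsnd : smooth_on O vsnd.
Proof. exact: smooth_pair oO (smooth_cst O 0) (smooth_snd O). Qed.

(** Differentiates Euler's equation along [a]; the second term on the left comes from the
    derivative of the direction [q.2] itself. *)
Lemma derR_euler (f h : V -> R) p a : O p -> smoothR O f ->
  (forall q, O q -> derR (vert q.2) f q = h q) ->
  derR (vert p.2) (derR (vert a) f) p + derR (vert a) f p = derR (vert a) h p.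
Proof.
move=> Op sf H.
rewrite -(derR_eq (vert a) oO Op H).
rewrite (derR_moving (X := vsnd) _ (findimV R n) oO Op sf); last exact: smooth_diff smooth_vsnd Op.
rewrite (derR_schwarz _ _ oO Op sf); congr (_ + derR _ _ _).
rewrite (@der_pair R V E E (fun=> 0) snd).
- by rewrite der_cst der_snd.
- exact: smooth_diff (smooth_cst O 0) Op.
- exact: smooth_diff (smooth_snd O) Op.
Qed.

Lemma gmet_eta a p : O p -> gmet L a p.2 p = theta L a p.
Proof.
move=> Op; have H q : O q -> derR (vert q.2) L2 q = 2 * L2 q by exact: derR_L2_eta.
have := derR_euler a Op sm_L2 H; rewrite (derRZ _ _ sm_L2 Op) -/L2.
rewrite gmet_sym// gmet.unlock theta.unlock -/L2 => E.
by apply: (mulfI (_ : 2 != 0 :> R)); rewrite ?pnatr_eq0// !mulVKf ?pnatr_eq0//; lra.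
Qed.

Lemma dhor_L2 a p : O p -> derR (hor F p a) L2 p = 0.
Proof.
move=> Op; have := derRM (hor F p a) (lb_smooth lb) (lb_smooth lb) Op.
by rewrite (lb_L lb)// mul0r mulr0 addr0.
Qed.

Lemma derR_dhor (f : V -> R) a (w : V) p : O p -> smoothR O f ->
  derR w (fun q => derR (hor F q a) f q) p
  = derR (hor F p a) (derR w f) p - derR (vert (der w (ncon F a) p)) f p.
Proof. exact: (der_dhor lb a w (@findim_R R)). Qed.

(** The form theta is horizontally parallel: [L] is, and vertical and horizontal derivatives
    commute up to [F]. *)
Lemma dhor_theta a b p : O p -> derR (hor F p a) (theta L b) p = theta L (F p a b) p.
Proof.
move=> Op.
have E : derR (vert b) (fun q => derR (hor F q a) L2 q) p = 0.
  by rewrite -(derR_cst (0 : R) (vert b) p); apply: (derR_eq _ oO Op) => q Oq; rewrite dhor_L2.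
rewrite (derR_dhor a (vert b) Op sm_L2) (vder_ncon lb)// in E.
rewrite {2}theta.unlock -(subr0_eq E) -(derRZ _ _ (sm_derR (vert b) sm_L2) Op).
by congr (derR _ _ _); apply/funext => q; rewrite theta.unlock.
Qed.

End Metric.
End LocalFinsler.

(** * Scalar curvature in coordinates *)

Section LocalScalarCurvature.
Context (R : realType) (n : nat).
Local Notation E := 'rV[R]_n.
Local Notation V := (E * E)%type.
Implicit Types (p q : V) (a b c z w : E).
Context (O : set V) (L : V -> R) (F : V -> E -> E -> E) (lb : local_berwald O L F).
Let oO := lb_open lb.
Context (k : V -> R) (smk : smoothR O k)
  (hom0k : forall x y (t : R), O (x, y) -> 0 < t -> k (x, t *: y) = k (x, y)).

(** H(X) = k L^2 phi(X), with L^2 phi(a) = L^2 a - theta(a) eta. *)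
Definition local_scalar : Prop := forall p a, O p ->
  Rcurv F p p.2 a p.2 = (k p * L p ^+ 2) *: a - (k p * theta L a p) *: p.2.

(** The vertical derivative of [k], so that C^k = L kdot. *)
Definition kdot a q := derR (vert a) k q.

Lemma sm_kdot a : smoothR O (kdot a). Proof. exact: sm_derR. Qed.

Lemma kdot_lin p (r : R) a b : O p -> kdot (r *: a + b) p = r * kdot a p + kdot b p.
Proof. by move=> Op; rewrite /kdot vertP (derR_lin _ _ _ smk Op). Qed.

Lemma kdot_eta p : O p -> kdot p.2 p = 0.
Proof.
move=> Op; apply: euler => t t0; rewrite mulr0 addr0.
by case: p Op => x y Op; exact: hom0k.
Qed.

Lemma derR_kdot_eta p a : O p -> derR (vert p.2) (kdot a) p = - kdot a p.
Proof.
move=> Op; have := derR_euler lb a Op smk kdot_eta.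
by rewrite derR_cst => /eqP; rewrite addr_eq0 => /eqP.
Qed.

Lemma derR_kdot_sym p a b : O p -> derR (vert a) (kdot b) p = derR (vert b) (kdot a) p.
Proof. by move=> Op; apply: derR_schwarz oO Op smk. Qed.

Context (hsc : local_scalar).

Lemma ncon_lin (r : R) a b q : O q -> ncon F (r *: a + b) q = r *: ncon F a q + ncon F b q.
Proof. by move=> Oq; have [Fl _ _] := lb_bil lb; exact: Fl. Qed.

Lemma Rhat_linl p a : O p -> forall (r : R) u w, Rhat F (r *: u + w) a p = r *: Rhat F u a p + Rhat F w a p.
Proof.
move=> Op r u w; rewrite /Rhat.
have dN x : differentiable (ncon F x) p := smooth_diff (smooth_ncon lb x) Op.
have -> : hor F p (r *: u + w) = r *: hor F p u + hor F p w.
  apply: injective_projections => //=.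
  by rewrite -/(ncon F _ p) ncon_lin// opprD scalerN.
rewrite der_linear//.
rewrite (@der_eq_on R V E O _ (fun q => r *: ncon F u q + ncon F w q) _ _ oO Op); last first.
  by move=> q Oq; rewrite ncon_lin.
have sZ : smooth_on O (fun q => r *: ncon F u q) by apply: smoothZ => //; exact: (smooth_ncon lb u).
rewrite (der_add_on _ sZ (smooth_ncon lb w) Op) (der_scale_on _ (sm_cst O r) (smooth_ncon lb u) Op) derR_cst scale0r add0r.
by apply/rowP => i; rewrite !mxE; ring.
Qed.

Lemma Rhat_anti p a b : Rhat F b a p = - Rhat F a b p.
Proof. by rewrite /Rhat opprB. Qed.

(** The deviation tensor of a manifold of scalar curvature [k]. *)
Definition Hdev a q := (k q * L q ^+ 2) *: a - (k q * theta L a q) *: q.2.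

Lemma Hdev_Rhat p a : O p -> Rhat F p.2 a p = Hdev a p.
Proof. by move=> Op; rewrite -(RhatE lb)// hsc. Qed.

(** Product rule for the two occurrences of [y] in Rhat(y, a). *)
Lemma der_Hdev p a b : O p -> der (vert b) (Hdev a) p = Rcurv F p p.2 a b + Rhat F b a p.
Proof.
move=> Op.
rewrite (@der_eq_on R V E O (Hdev a) (fun q => Rhat F q.2 a q) _ _ oO Op); last first.
  by move=> q Oq; rewrite Hdev_Rhat.
have [] := @der_moving R V E E O (fun q u => Rhat F u a q) snd p (@findim_rV R n) oO Op _ _
  (smooth_diff (smooth_snd O) Op).
- by move=> q Oq r u w; exact: Rhat_linl.
- by move=> u; exact: smooth_diff (smooth_Rhat lb u a) Op.
by move=> _ ->; rewrite (vder_Rhat lb)// der_snd.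
Qed.

Let smL2 := sm_L2 lb.
Let smkL2 : smoothR O (fun q => k q * L q ^+ 2) := sm_mul oO smk smL2.
Let smkth a : smoothR O (fun q => k q * theta L a q) := sm_mul oO smk (sm_theta lb a).

Lemma der_HdevE p a b : O p -> der (vert b) (Hdev a) p
  = (kdot b p * L p ^+ 2 + k p * (2 * theta L b p)) *: a
    - (kdot b p * theta L a p + k p * gmet L b a p) *: p.2 - (k p * theta L a p) *: b.
Proof.
move=> Op.
have s1 : smooth_on O (fun q => (k q * L q ^+ 2) *: a).
  exact: smoothS oO smkL2 (smooth_cst O a).
have s2 : smooth_on O (fun q => (k q * theta L a q) *: q.2).
  exact: smoothS oO (smkth a) (smooth_snd O).
rewrite (der_sub_on _ s1 s2 Op) (der_scale_vec _ _ smkL2 Op) (der_scale_on _ (smkth a) (smooth_snd O) Op).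
rewrite (derRM _ smk smL2 Op) (derRM _ smk (sm_theta lb a) Op) derR_L2 (derR_theta lb)// der_snd/=.
by rewrite opprD addrA.
Qed.

(** The vertical derivative of the deviation tensor, antisymmetrised, is three times the
    (v)h-torsion: one copy from each of the two terms of [der_Hdev], and one more from the first
    Bianchi identity. *)
Lemma Rhat3 p a b : O p -> 3 *: Rhat F a b p
  = kdot a p *: (L p ^+ 2 *: b - theta L b p *: p.2) - kdot b p *: (L p ^+ 2 *: a - theta L a p *: p.2)
    + (3 * k p) *: (theta L a p *: b - theta L b p *: a).
Proof.
move=> Op.
have Ha := der_Hdev a b Op; have Hb := der_Hdev b a Op.
rewrite der_HdevE// in Ha; rewrite der_HdevE// in Hb.
have C := first_bianchi lb p.2 a b Op; rewrite (RhatE lb)// in C.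
rewrite (Rcurv_anti F p p.2 b) in C.
have {}C : Rhat F a b p = Rcurv F p p.2 b a - Rcurv F p p.2 a b.
  by apply/eqP; rewrite -subr_eq0 -[X in _ == X]C; apply/eqP/rowP => i; rewrite !mxE; ring.
rewrite Rhat_anti in Ha.
have -> : 3 *: Rhat F a b p = (Rcurv F p p.2 b a + Rhat F a b p) - (Rcurv F p p.2 a b - Rhat F a b p).
  have regroup (x y z : E) : x = y - z -> 3 *: x = y + x - (z - x).
    by move=> ->; apply/rowP => i; rewrite !mxE; ring.
  exact: regroup.
rewrite -Ha -Hb (gmet_sym lb a b Op).
by apply/rowP => i; rewrite !mxE; ring.
Qed.

(** The vertical derivative of [Rhat3], projected: all terms that contain theta or [y] vanish. *)
Lemma Rcurv_perp p a b z w : O p -> theta L a p = 0 -> theta L b p = 0 -> theta L z p = 0 -> theta L w p = 0 ->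
  3 * gmet L (Rcurv F p a b z) w p
  = L p ^+ 2 * (derR (vert z) (kdot a) p * gmet L b w p - derR (vert z) (kdot b) p * gmet L a w p)
    + 3 * k p * (gmet L z a p * gmet L b w p - gmet L z b p * gmet L a w p).
Proof.
move=> Op ta tb tz tw.
have sL2 x : smooth_on O (fun q => L q ^+ 2 *: x : E) by exact: smoothS oO smL2 (smooth_cst O x).
have sty x : smooth_on O (fun q => theta L x q *: q.2) by exact: smoothS oO (sm_theta lb x) (smooth_snd O).
have stc x y : smooth_on O (fun q => theta L x q *: y : E) by exact: smoothS oO (sm_theta lb x) (smooth_cst O y).
have sA x : smooth_on O (fun q => L q ^+ 2 *: x - theta L x q *: q.2).
  exact: smoothB oO (sL2 x) (sty x).
have sB x y : smooth_on O (fun q => kdot x q *: (L q ^+ 2 *: y - theta L y q *: q.2)).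
  exact: smoothS oO (sm_kdot x) (sA y).
have sC : smooth_on O (fun q => theta L a q *: b - theta L b q *: a).
  exact: smoothB oO (stc a b) (stc b a).
have sk3 : smoothR O (fun q => 3 * k q) by exact: sm_mul oO (sm_cst O 3) smk.
have E1 : 3 *: Rcurv F p a b z =
    (derR (vert z) (kdot a) p * L p ^+ 2) *: b - (kdot a p * gmet L z b p) *: p.2
    - ((derR (vert z) (kdot b) p * L p ^+ 2) *: a - (kdot b p * gmet L z a p) *: p.2)
    + (3 * k p) *: (gmet L z a p *: b - gmet L z b p *: a).
  rewrite -(vder_Rhat lb)//.
  have sR := smooth_Rhat lb a b.
  have := der_scale_on (vert z) (sm_cst O 3) sR Op; rewrite derR_cst scale0r add0r => <-.
  rewrite (@der_eq_on R V E O _ _ _ _ oO Op (fun q Oq => Rhat3 a b Oq)).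
  rewrite (der_add_on _ (smoothB oO (sB a b) (sB b a)) (smoothS oO sk3 sC) Op).
  rewrite (der_sub_on _ (sB a b) (sB b a) Op) !(der_scale_on _ (sm_kdot _) (sA _) Op).
  rewrite (der_scale_on _ sk3 sC Op) (der_sub_on _ (stc a b) (stc b a) Op) !(der_scale_vec _ _ (sm_theta lb _) Op).
  rewrite !(der_sub_on _ (sL2 _) (sty _) Op) !(der_scale_vec _ _ smL2 Op) !(der_scale_on _ (sm_theta lb _) (smooth_snd O) Op).
  rewrite !(derR_theta lb)// derR_L2 der_snd ta tb tz/=.
  by apply/rowP => i; rewrite !mxE; ring.
have lin (r : R) u v : gmet L (r *: u + v) w p = r * gmet L u w p + gmet L v w p by exact: (gmet_linl lb w Op).
have g0 : gmet L 0 w p = 0 by have := lin 1 0 0; rewrite scale1r addr0; lra.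
have gZ (r : R) u : gmet L (r *: u) w p = r * gmet L u w p by rewrite -[_ *: _]addr0 lin g0 addr0.
have gD u v : gmet L (u + v) w p = gmet L u w p + gmet L v w p by have := lin 1 u v; rewrite scale1r mul1r.
have gN u : gmet L (- u) w p = - gmet L u w p by rewrite -scaleN1r gZ mulN1r.
have gy : gmet L p.2 w p = 0 by rewrite (gmet_sym lb)// (gmet_eta lb).
rewrite -gZ E1 !(gD, gN, gZ) gy; ring.
Qed.

Context (n3 : (2 < n)%N).

Lemma gmet0 p w : O p -> gmet L 0 w p = 0.
Proof. by move=> Op; have := gmet_linl lb w Op 1 0 0; rewrite scale1r addr0; lra. Qed.

(** Two linear conditions on [c], in dimension at least three, and a positive definite metric. *)
Lemma perp_vector p b : O p -> exists c, [/\ theta L c p = 0, gmet L b c p = 0 & 0 < gmet L c c p].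
Proof.
move=> Op.
have [c [c0 tc gc]] := common_kernel n3 (theta_lin lb Op) (fun r => gmet_linr lb b Op r).
by exists c; split=> //; exact: (lb_gpos lb).
Qed.

Section Schur.
Context (kdot0 : forall p a, O p -> kdot a p = 0).

Lemma Rhat_isotropic p a b : O p -> Rhat F a b p = k p *: (theta L a p *: b - theta L b p *: a).
Proof.
move=> Op; have n30 : 3 != 0 :> R by rewrite pnatr_eq0.
apply: (scalerI n30).
by rewrite Rhat3// !kdot0// !scale0r subrr add0r scalerA.
Qed.

Definition hvec a : V := (a, 0).

Lemma derR_split p (w : V) : O p -> derR w k p = derR (hvec w.1) k p.
Proof.
move=> Op; have {1}-> : w = 1 *: hvec w.1 + vert w.2.
  by apply: injective_projections; rewrite /= ?scaler0 ?scale1r ?addr0 ?add0r.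
by rewrite (derR_lin _ _ _ smk Op) mul1r -/(kdot w.2 p) kdot0// addr0.
Qed.

(** Only [k] contributes a new term, because theta is horizontally parallel up to [F]. *)
Lemma der_Rhat_isotropic p a b c : O p ->
  der (hor F p a) (Rhat F b c) p + F p a (Rhat F b c p)
  = derR (hvec a) k p *: (theta L b p *: c - theta L c p *: b)
    + k p *: ((theta L (F p a b) p *: c + theta L b p *: F p a c)
              - (theta L (F p a c) p *: b + theta L c p *: F p a b)).
Proof.
move=> Op.
have stc x y : smooth_on O (fun q => theta L x q *: y : E) by exact: smoothS oO (sm_theta lb x) (smooth_cst O y).
rewrite (@der_eq_on R V E O _ _ _ _ oO Op (fun q Oq => Rhat_isotropic b c Oq)).
rewrite (der_scale_on _ smk (smoothB oO (stc b c) (stc c b)) Op) derR_split//.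
rewrite (der_sub_on _ (stc b c) (stc c b) Op) !(der_scale_vec _ _ (sm_theta lb _) Op) !(dhor_theta lb)//.
rewrite Rhat_isotropic// (FZr lb)// (FDr lb)// (FNr lb)// !(FZr lb)//.
by apply/rowP => i; rewrite !mxE; ring.
Qed.

(** The terms with [F] cancel in the second Bianchi identity for [a], [y] and [c].  Taking the
    inner product with a vector [c] orthogonal to [y] and to [a] isolates the two terms below. *)
Lemma schur_identity p a : O p ->
  derR (hvec a) k p * L p ^+ 2 = derR (hvec p.2) k p * theta L a p.
Proof.
move=> Op; have [c [tc ac cc]] := perp_vector a Op.
have := second_bianchi lb a p.2 c Op; rewrite !der_Rhat_isotropic//.
rewrite (lb_sym lb c a Op) (lb_sym lb c p.2 Op) (lb_sym lb p.2 a Op) tc (theta_eta lb)// => S.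
have {}S : derR (hvec a) k p *: (L p ^+ 2 *: c) + (- (derR (hvec p.2) k p * theta L a p)) *: c
    + derR (hvec c) k p *: (theta L a p *: p.2 - L p ^+ 2 *: a) = 0.
  by rewrite -[RHS]S; apply/rowP => i; rewrite !mxE; ring.
have lin (r : R) u v : gmet L (r *: u + v) c p = r * gmet L u c p + gmet L v c p by exact: (gmet_linl lb c Op).
have := congr1 (fun u => gmet L u c p) S.
have gZ (r : R) u : gmet L (r *: u) c p = r * gmet L u c p by rewrite -[_ *: _]addr0 lin gmet0// addr0.
have gD u v : gmet L (u + v) c p = gmet L u c p + gmet L v c p by have := lin 1 u v; rewrite scale1r mul1r.
have gN u : gmet L (- u) c p = - gmet L u c p by rewrite -scaleN1r gZ mulN1r.
have gy : gmet L p.2 c p = 0 by rewrite (gmet_sym lb)// (gmet_eta lb).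
rewrite !(gD, gN, gZ) gy ac gmet0// => H.
by apply: (mulIf (lt0r_neq0 cc)); lra.
Qed.

(** The identity [schur_identity] says that the horizontal derivative of [k] is a multiple of theta.
    That derivative is independent of [y], whereas theta is not: its vertical derivative is
    the metric. *)
Lemma schur p (w : V) : O p -> derR w k p = 0.
Proof.
have smX a : smoothR O (derR (hvec a) k) := sm_derR (hvec a) smk.
have sY : smooth_on O (fun q : V => hvec q.2) := smooth_pair oO (smooth_snd O) (smooth_cst O 0).
have smY : smoothR O (fun q => derR (hvec q.2) k q) := sm_moving (findimV R n) oO smk sY.
have Xy q : O q -> derR (hvec q.2) k q = 0.
  move=> Oq; have [a [ta _ aa]] := perp_vector 0 Oq.
  have := derR_eq (vert a) oO Oq (fun q Oq => schur_identity a Oq).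
  rewrite (derRM _ (smX a) smL2 Oq) (derRM _ smY (sm_theta lb a) Oq) derR_L2 (derR_theta lb)// ta.
  rewrite (derR_schwarz (vert a) (hvec a) oO Oq smk).
  have -> : derR (hvec a) (derR (vert a) k) q = 0.
    by rewrite -(derR_cst (0 : R) (hvec a) q); apply: (derR_eq _ oO Oq) => q' Oq'; exact: kdot0.
  rewrite mul0r !mulr0 !add0r => /esym/eqP.
  by rewrite mulf_eq0 (gt_eqF aa) orbF => /eqP.
move=> Op; rewrite derR_split//.
have := schur_identity w.1 Op; rewrite Xy// mul0r => /eqP.
by rewrite mulf_eq0 (gt_eqF (exprn_gt0 2 (lb_pos lb Op))) orbF => /eqP.
Qed.

End Schur.

Context (eps : V -> R) (sme : smoothR O eps).

(** H_p-scalar curvature; the projector P restricts the identity to vectors orthogonal to [y]. *)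
Definition local_Hp : Prop := forall p a b z w, O p ->
  theta L a p = 0 -> theta L b p = 0 -> theta L z p = 0 -> theta L w p = 0 ->
  gmet L (Rcurv F p a b z) w p = eps p * (gmet L a z p * gmet L b w p - gmet L b z p * gmet L a w p).

Context (hHp : local_Hp).

(** Compares [Rcurv_perp] with the definition of H_p-scalar curvature; with [b] and [w] equal to a
    vector orthogonal to [a], only one term survives on each side. *)
Lemma hess_perp p a z : O p -> theta L a p = 0 -> theta L z p = 0 ->
  L p ^+ 2 * derR (vert z) (kdot a) p = 3 * (eps p - k p) * gmet L a z p.
Proof.
move=> Op ta tz; have [c [tc ac cc]] := perp_vector a Op.
have := Rcurv_perp Op ta tc tz tc; rewrite hHp// ac (gmet_sym lb z a Op) !mulr0 !subr0 => H.
by apply: (mulIf (lt0r_neq0 cc)); lra.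
Qed.

(** The equation of [hess_perp], with all vectors replaced by their projections and cleared of
    denominators: only an identity between fixed vectors can be differentiated. *)
Definition hess_eq p a b : Prop :=
  L p ^+ 2 * (L p ^+ 2 * derR (vert b) (kdot a) p + theta L a p * kdot b p + theta L b p * kdot a p)
  = 3 * (eps p - k p) * (L p ^+ 2 * gmet L a b p - theta L a p * theta L b p).

Lemma hess_full p a b : O p -> hess_eq p a b.
Proof.
move=> Op; rewrite /hess_eq.
have L0 := lb_pos lb Op; have L20 : L p ^+ 2 != 0 by rewrite expf_neq0// gt_eqF.
(* [ph] is the projection along [p.2] onto the kernel of theta. *)
pose ph (x : E) : E := (- (theta L x p / L p ^+ 2)) *: p.2 + x.
have tph x : theta L (ph x) p = 0 by rewrite (theta_lin lb)// (theta_eta lb)// mulNr divfK// addNr.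
have := hess_perp Op (tph a) (tph b).
have D2 x y : derR (vert (ph x)) (kdot y) p = theta L x p / L p ^+ 2 * kdot y p + derR (vert x) (kdot y) p.
  by rewrite vertP (derR_lin _ _ _ (sm_kdot y) Op) derR_kdot_eta//; ring.
have K x : kdot (ph x) p = kdot x p by rewrite kdot_lin// kdot_eta// mulr0 add0r.
have G x y : gmet L (ph x) y p = - (theta L x p / L p ^+ 2) * theta L y p + gmet L x y p.
  by rewrite (gmet_linl lb)// (gmet_sym lb p.2)// (gmet_eta lb).
rewrite D2 derR_kdot_sym// D2 K G (gmet_sym lb a (ph b) Op) G tph mulr0 add0r.
rewrite (derR_kdot_sym b a Op) (gmet_sym lb a b Op).
set d := derR _ _ _; set x := theta L a p; set y := theta L b p; set l := L p ^+ 2 in L20 *.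
set u := kdot a p; set v := kdot b p; set g := gmet L b a p; set e := eps p - k p => H.
have -> : l * d + x * v + y * u = l * (x / l * v + (y / l * u + d)) by field.
have -> : l * g - x * y = l * (- (y / l) * x + g) by field.
by rewrite [RHS]mulrCA -H; ring.
Qed.

(** The vertical derivative of [hess_eq] on three vectors orthogonal to [y], antisymmetrised in the
    last two, reads (1 - 3 m) (kdot b g(a, c) - kdot c g(a, b)) = 0.  The case m = 0 is eps = k, and
    m = 1 is eps constant. *)
Lemma kdot_zero (m : R) : 3 * m != 1 ->
  (forall p a, O p -> derR (vert a) (fun q => eps q - k q) p = - m * kdot a p) ->
  forall p a, O p -> kdot a p = 0.
Proof.
move=> m1 Hm.
have main p a b c : O p -> theta L a p = 0 -> theta L b p = 0 -> theta L c p = 0 ->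
    L p ^+ 2 * derR (vert c) (derR (vert b) (kdot a)) p + gmet L c a p * kdot b p + gmet L c b p * kdot a p
    = - 3 * m * kdot c p * gmet L a b p + 3 * (eps p - k p) * derR (vert c) (gmet L a b) p.
  move=> Op ta tb tc.
  have L0 := lb_pos lb Op; have L20 : L p ^+ 2 != 0 by rewrite expf_neq0// gt_eqF.
  have := derR_eq (vert c) oO Op (fun q Oq => hess_full a b Oq).
  have s1 : smoothR O (fun q => L q ^+ 2 * derR (vert b) (kdot a) q) by exact: sm_mul oO smL2 (sm_derR _ (sm_kdot a)).
  have s2 x y : smoothR O (fun q => theta L x q * kdot y q) by exact: sm_mul oO (sm_theta lb x) (sm_kdot y).
  have se : smoothR O (fun q => eps q - k q) by exact: sm_sub oO sme smk.
  have s3 : smoothR O (fun q => 3 * (eps q - k q)) by exact: sm_mul oO (sm_cst O 3) se.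
  have s4 : smoothR O (fun q => L q ^+ 2 * gmet L a b q) by exact: sm_mul oO smL2 (sm_gmet lb a b).
  have s5 : smoothR O (fun q => theta L a q * theta L b q) by exact: sm_mul oO (sm_theta lb a) (sm_theta lb b).
  have s6 := sm_add oO s1 (s2 a b).
  rewrite (derRM _ smL2 (sm_add oO s6 (s2 b a)) Op) (derRD _ s6 (s2 b a) Op) (derRD _ s1 (s2 a b) Op).
  rewrite (derRM _ smL2 (sm_derR _ (sm_kdot a)) Op) !(derRM _ (sm_theta lb _) (sm_kdot _) Op).
  rewrite (derRM _ s3 (sm_sub oO s4 s5) Op) (derRB _ s4 s5 Op) (derRM _ (sm_cst O 3) se Op).
  rewrite (derRM _ smL2 (sm_gmet lb a b) Op) (derRM _ (sm_theta lb a) (sm_theta lb b) Op).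
  rewrite derR_cst Hm// derR_L2 !(derR_theta lb)// ta tb tc => H.
  by apply: (mulfI L20); lra.
have perp p b : O p -> theta L b p = 0 -> kdot b p = 0.
  move=> Op tb; have [c [tc bc cc]] := perp_vector b Op.
  have := main p c b c Op tc tb tc; have := main p c c b Op tc tc tb.
  rewrite (derR_schwarz (vert c) (vert b) oO Op (sm_kdot c)) (derR_gmet lb c b c Op).
  rewrite bc (gmet_sym lb c b Op) bc => H1 H2.
  have : (1 - 3 * m) * (gmet L c c p * kdot b p) = 0 by lra.
  move/eqP; rewrite mulf_eq0 subr_eq0 eq_sym (negbTE m1)/= mulf_eq0 (gt_eqF cc)/=.
  by move/eqP.
move=> p a Op.
have L0 := lb_pos lb Op; have L20 : L p ^+ 2 != 0 by rewrite expf_neq0// gt_eqF.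
have := perp p ((- (theta L a p / L p ^+ 2)) *: p.2 + a) Op.
rewrite (theta_lin lb)// (theta_eta lb)// mulNr divfK// addNr kdot_lin// kdot_eta// mulr0 add0r.
exact.
Qed.

Lemma eps_eq_k p : O p -> (forall a b, L p ^+ 2 * derR (vert b) (kdot a) p + theta L a p * kdot b p
  + theta L b p * kdot a p = 0) -> eps p = k p.
Proof.
move=> Op H; have [c [tc _ cc]] := perp_vector 0 Op.
have := hess_full c c Op; rewrite /hess_eq H mulr0 tc mul0r subr0.
have L0 := lb_pos lb Op; have L20 : L p ^+ 2 != 0 by rewrite expf_neq0// gt_eqF.
move/esym/eqP; rewrite mulf_eq0 (mulf_eq0 (L p ^+ 2)) (negbTE L20) (gt_eqF cc)/= orbF.
by rewrite mulf_eq0 pnatr_eq0/= subr_eq0 => /eqP.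
Qed.

End LocalScalarCurvature.

(** * Changes of chart *)

Local Notation inv := Defs.inv.
Section GoodAtlas.
Context (R : realType) (V : normedModType R) (Q : Type).

(** What changes of chart require of an atlas.  Points outside all chart domains are allowed, as
    the slit atlas has some. *)
Record good_atlas (B : atlas V Q) : Prop := GoodAtlas {
  ga_at : forall (c : chart B) x, dom c x -> dom (chart_at B x) x;
  ga_inv : forall (c : chart B) x, dom c x -> inv c (co c x) = x;
  ga_open : forall c d : chart B, open (co c @` (dom c `&` dom d));
  ga_smooth : forall c d : chart B, smooth_on (co c @` (dom c `&` dom d)) (trans c d) }.

Context (fV : findim V) (B : atlas V Q) (gB : good_atlas B).
Implicit Types (c d e : chart B) (x : Q) (b v w : V).

Definition overlap c d : set V := co c @` (dom c `&` dom d).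

(** The differential of a transition map. *)
Definition jac c d b v : V := der v (trans c d) b.

Lemma overlap_co c d x : dom c x -> dom d x -> overlap c d (co c x).
Proof. by move=> cx dx; exists x. Qed.

Lemma trans_co c d x : dom c x -> trans c d (co c x) = co d x.
Proof. by move=> cx; rewrite /trans/= (ga_inv gB). Qed.

Lemma diff_trans c d b : overlap c d b -> differentiable (trans c d) b.
Proof. exact: smooth_diff (ga_smooth gB c d). Qed.

Lemma jac_lin c d b : overlap c d b ->
  forall (k : R) v w, jac c d b (k *: v + w) = k *: jac c d b v + jac c d b w.
Proof. by move=> /diff_trans db k v w; exact: der_linear. Qed.

Lemma jac0 c d b : jac c d b 0 = 0. Proof. exact: der0. Qed.

Lemma jac_id c x v : dom c x -> jac c c (co c x) v = v.
Proof.
move=> cx; rewrite /jac (@der_eq_on R V V (overlap c c) _ id).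
- have cid : clin (id : V -> V) by split=> // y; exact: cvg_id.
  by have [_ ->] := clin_der (co c x) cid.
- exact: (ga_open gB).

- exact: overlap_co.
- by move=> _ [y [cy _] <-]; rewrite trans_co.
Qed.

Lemma trans_cocycle c d e b : overlap c d b -> trans c e b = trans d e (trans c d b).
Proof. by move=> [x [cx dx] <-]; rewrite !trans_co. Qed.

Lemma jac_cocycle c d e x v : dom c x -> dom d x -> dom e x ->
  jac d e (co d x) (jac c d (co c x) v) = jac c e (co c x) v.
Proof.
move=> cx dx ex; rewrite /jac -{1}(trans_co d cx) -der_comp.
- apply: (@der_eq_on R V V (overlap c d)) => [||b ob].
  + exact: (ga_open gB c d).
  + exact: overlap_co.
  + by rewrite /= -trans_cocycle.
- exact/diff_trans/overlap_co.
- by rewrite trans_co//; exact/diff_trans/overlap_co.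
Qed.

Lemma tcoordE c x v : tcoord c x v = jac (chart_at B x) c (co_at B x) v.
Proof. by rewrite /jac derE. Qed.

(** The inverse of [tcoord]. *)
Definition tback c x v : V := jac c (chart_at B x) (co c x) v.

Lemma tcoordK c x : dom c x -> cancel (tcoord c x) (tback c x).
Proof.
move=> cx v; have ex := ga_at gB cx.
by rewrite tcoordE /tback/co_at jac_cocycle// jac_id.
Qed.

Lemma tbackK c x : dom c x -> cancel (tback c x) (tcoord c x).
Proof.
move=> cx v; have ex := ga_at gB cx.
by rewrite tcoordE /tback/co_at jac_cocycle// jac_id.
Qed.

Lemma tcoord_lin c x : dom c x ->
  forall (k : R) v w, tcoord c x (k *: v + w) = k *: tcoord c x v + tcoord c x w.
Proof. by move=> cx k v w; rewrite !tcoordE jac_lin//; exact: overlap_co (ga_at gB cx) cx. Qed.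

Lemma tcoordB c x : dom c x -> forall v w, tcoord c x (v - w) = tcoord c x v - tcoord c x w.
Proof. by move=> cx v w; rewrite addrC -scaleN1r tcoord_lin// scaleN1r addrC. Qed.

Lemma tback_lin c x : dom c x ->
  forall (k : R) v w, tback c x (k *: v + w) = k *: tback c x v + tback c x w.
Proof. by move=> cx k v w; rewrite /tback jac_lin//; exact: overlap_co cx (ga_at gB cx). Qed.

Lemma tcoord_id x v : dom (chart_at B x) x -> tcoord (chart_at B x) x v = v.
Proof. by move=> cx; rewrite tcoordE jac_id. Qed.

Lemma tcoord_jac c d x v : dom c x -> dom d x -> tcoord d x v = jac c d (co c x) (tcoord c x v).
Proof. by move=> cx dx; rewrite !tcoordE jac_cocycle//; exact: (ga_at gB cx). Qed.

Definition smooth_at (W : normedModType R) (g : V -> W) b : Prop :=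
  exists O, [/\ open O, O b & smooth_on O g].

Lemma open_preim (W : topologicalType) (U : set V) (f : V -> W) (O : set W) : open U ->
  (forall a, U a -> {for a, continuous f}) -> open O -> open [set a | U a /\ O (f a)].
Proof.
move=> oU cf oO; rewrite openE => a [Ua Ofa].
apply: filterI; first exact: open_nbhs_nbhs.
by apply: (cf a Ua); exact: open_nbhs_nbhs.
Qed.

Lemma smooth_repP (W : normedModType R) x (g : V -> W) : dom (chart_at B x) x ->
  smooth_rep B x g <-> smooth_at g (co_at B x).
Proof.
move=> cx; split=> [[ O [ oO Ox _ sg]]|[ O [ oO Ox sg]]]; first by exists O.
have oC := ga_open gB (chart_at B x) (chart_at B x).
exists (O `&` overlap (chart_at B x) (chart_at B x)); split.
- exact: openI.
- by split=> //; exact: overlap_co.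
- by move=> a [_ [y [cy _] <-]]; exists y.
- by apply: smooth_sub sg => a [].
Qed.

Lemma smooth_at_trans (W : normedModType R) c d x (g h : V -> W) : dom c x -> dom d x ->
  (forall b, overlap d c b -> h b = g (trans d c b)) ->
  smooth_at g (co c x) -> smooth_at h (co d x).
Proof.
move=> cx dx E [ O [ oO Ox sg]].
have sT := ga_smooth gB d c.
pose U := [set b | overlap d c b /\ O (trans d c b)].
have oU : open U.
  apply: open_preim => //; first exact: (ga_open gB d c).
  by move=> a oa; exact/differentiable_continuous/diff_trans.
exists U; split=> //; first by split; [exact: overlap_co|rewrite trans_co].
apply: (smooth_eq oU (f := g \o trans d c)) => [b [ob _]|]; first by rewrite E.
apply: (smooth_comp (O' := O) fV oU) => //; first by move=> a [].
by apply: smooth_sub sT => a [].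
Qed.

Lemma smooth_nearP (W : normedModType R) c x (f : Q -> W) : dom c x ->
  smooth_near B f x <-> smooth_at (f \o inv c) (co c x).
Proof.
move=> cx; have ex := ga_at gB cx; rewrite /smooth_near smooth_repP//.
split; apply: smooth_at_trans => //.
- by move=> _ [y [cy ey] <-]; rewrite /= trans_co// !(ga_inv gB).
- by move=> _ [y [cy ey] <-]; rewrite /= trans_co// !(ga_inv gB).
Qed.

Lemma smooth_at_diff (W : normedModType R) (g : V -> W) b : smooth_at g b -> differentiable g b.
Proof. by move=> [ O [ _ Ob sg]]; exact: smooth_diff sg Ob. Qed.

Lemma dirderP (W : normedModType R) c x (f : Q -> W) v : dom c x ->
  differentiable (f \o inv c) (co c x) ->
  dirder B f x v = der (tcoord c x v) (f \o inv c) (co c x).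
Proof.
move=> cx df; have ex := ga_at gB cx.
rewrite /dirder derEx tcoordE /jac/co_at.
rewrite -(trans_co c ex) -der_comp.
- apply: (@der_eq_on R V W (overlap (chart_at B x) c)).
  + exact: ga_open.
  + exact: overlap_co.
  + by move=> _ [y [ey cy] <-]; rewrite /= trans_co// !(ga_inv gB).
- exact/diff_trans/overlap_co.
- by rewrite trans_co.
Qed.

Lemma vrep_trans c d X b : overlap d c b ->
  vrep d X b = jac c d (trans d c b) (vrep c X (trans d c b)).
Proof.
move=> [y [dy cy] <-]; rewrite /vrep trans_co// !(ga_inv gB)//.
exact: tcoord_jac.
Qed.

Lemma smooth_at_jac c d x (g h : V -> V) : dom c x -> dom d x ->
  (forall b, overlap d c b -> h b = jac c d (trans d c b) (g (trans d c b))) ->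
  smooth_at g (co c x) -> smooth_at h (co d x).
Proof.
move=> cx dx E sg; apply: (smooth_at_trans cx dx (g := fun b => jac c d b (g b))) => //.
case: sg => O [oO Ox sg]; have oC := ga_open gB c d.
exists (O `&` overlap c d); have oI := openI oO oC; split=> //.
  by split=> //; exact: overlap_co.
apply: (smooth_moving fV oI (T := jac c d)).
- by move=> q [_ oq]; exact: jac_lin.
- by move=> u; apply: smooth_sub (smooth_der u (ga_smooth gB c d)) => q [].
- by apply: smooth_sub sg => q [].
Qed.

Lemma smooth_vfP c X x : dom c x -> smooth_vf B X x <-> smooth_at (vrep c X) (co c x).
Proof.
move=> cx; have ex := ga_at gB cx; rewrite /smooth_vf smooth_repP//.
by split; apply: smooth_at_jac => // b ob; exact: vrep_trans.
Qed.

(** Two vector fields change chart by the differential of the transition map; its second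
    derivative contributes to both terms of the bracket, and cancels by symmetry. *)
Lemma bracketP c X Y x : dom c x -> smooth_vf B X x -> smooth_vf B Y x ->
  tcoord c x (bracket B X Y x) = der (vrep c X (co c x)) (vrep c Y) (co c x)
    - der (vrep c Y (co c x)) (vrep c X) (co c x).
Proof.
move=> cx sX sY; have ex := ga_at gB cx; set e := chart_at B x in ex.
have oec : overlap e c (co e x) by exact: overlap_co.
have oO := ga_open gB e c.
have key Z : smooth_vf B Z x -> forall w,
    der (jac e c (co e x) w) (vrep c Z) (co c x)
    = der w (jac e c ^~ (Z x)) (co e x) + jac e c (co e x) (der w (vrep e Z) (co e x)).
  move=> sZ w.
  have dZ : differentiable (vrep c Z) (co c x) by apply/smooth_at_diff/smooth_vfP.
  have dZe : differentiable (vrep e Z) (co e x) by apply/smooth_at_diff/smooth_vfP.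
  rewrite -(trans_co c ex) -der_comp; [|exact: diff_trans|by rewrite trans_co].
  rewrite (@der_eq_on R V V (overlap e c) _ (fun q => jac e c q (vrep e Z q)))//; last first.
    move=> b ob /=; rewrite [in LHS]/vrep.
    move: ob => [y [ey cy] <-]; rewrite trans_co// !(ga_inv gB)//.
    by rewrite (tcoord_jac _ ey cy) /vrep (ga_inv gB).
  have [] := @der_moving R V V V (overlap e c) (jac e c) (vrep e Z) (co e x) fV oO oec _ _ dZe.
  - by move=> q oq; exact: jac_lin.
  - by move=> u; exact: smooth_diff (smooth_der u (ga_smooth gB e c)) oec.
  move=> _ ->; congr (der _ (jac e c ^~ _) _ + _).
  by rewrite /vrep (ga_inv gB)// tcoord_id.
have V0 Z : vrep c Z (co c x) = jac e c (co e x) (Z x).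
  by rewrite /vrep (ga_inv gB)// tcoordE.
rewrite {1}V0 (key Y sY) {1}V0 (key X sX).
have -> : der (X x) (jac e c ^~ (Y x)) (co e x) = der (Y x) (jac e c ^~ (X x)) (co e x).
  exact: (der_schwarz (X x) (Y x) fV oO oec (ga_smooth gB e c)).
rewrite opprD addrACA subrr add0r.
by rewrite /bracket !derEx (tcoordB cx) !tcoordE.
Qed.

End GoodAtlas.

(** * The atlas of the slit tangent bundle *)

Section Manifold.
Context (R : realType) (n : nat) (M : topologicalType).
Local Notation E := 'rV[R]_n.
Local Notation V := (E * E)%type.
Context (A : atlas E M) (hM : smooth_manifold A).

Lemma manifold_good : good_atlas A.
Proof.
case: hM => _ _ hat hc hs.
have hinv (c : chart A) x : dom c x -> inv c (co c x) = x.
  by move=> cx; have [_ _ H _ _] := hc c; apply: H; exact: mem_set.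
split; [by move=> c x _; exact: hat|exact: hinv| |exact: hs].
move=> c d; have [oc oi H _ ci] := hc c; have [od _ _ _ _] := hc d.
have -> : co c @` (dom c `&` dom d) = [set b | (co c @` dom c) b /\ dom d (inv c b)].
  apply/seteqP; split=> [_ [x [cx dx] <-]|_ [[x cx <-]] /=].
    by split; [exists x|rewrite hinv].
  by rewrite hinv// => dx; exists x.
apply: open_preim => //.
move=> b ob; move: ci; rewrite continuous_open_subspace// => /(_ b); apply.
exact: mem_set.
Qed.

Let gA := manifold_good.
Let fE := @findim_rV R n.
Local Notation S := (slit_atlas A).

Lemma slit_inv (c : chart A) (u : TM R n M) : dom (a := S) c u -> inv (a := S) c (co (a := S) c u) = u.
Proof.
move=> [cu _]; case: u cu => x y /= cx; rewrite (ga_inv gA cx); congr (_, _).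
by rewrite -[RHS](tcoordK gA cx y) derEx.
Qed.

Lemma slit_co (c : chart A) (b : V) : (co c @` dom c) b.1 -> b.2 != 0 ->
  dom (a := S) c (inv (a := S) c b) /\ co (a := S) c (inv (a := S) c b) = b.
Proof.
case: b => b1 b2 /= [x cx <-] b20.
have E : 'D_b2 (trans c (chart_at A (inv c (co c x)))) (co c x) = tback c x b2.
  by rewrite (ga_inv gA cx) derEx.
rewrite /= E (ga_inv gA cx); split.
  split=> //=; apply/eqP => /= b0; move/eqP: b20; apply.
  by rewrite -(tbackK gA cx b2) b0 tcoordE jac0.
by rewrite (tbackK gA cx).
Qed.

Lemma slit_overlap (c d : chart A) :
  overlap (B := S) c d = [set b | overlap (B := A) c d b.1 /\ b.2 != 0].
Proof.
apply/seteqP; split=> [_ [[x y] [[/= cx y0] [/= dx _]] <-]|b [[x [cx dx] xb] b20]] /=.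
  split; first exact: overlap_co.
  apply/eqP => E; move: y0; rewrite /slit/= => /eqP; apply.
  by rewrite -(tcoordK gA cx y) E /tback jac0.
have cb : (co c @` dom c) b.1 by exists x.
have [h1 h2] := slit_co cb b20; exists (inv (a := S) c b) => //; split=> //.
by case: h1 => _ h1; split=> //=; rewrite -xb (ga_inv gA cx).
Qed.

Lemma slit_trans (c d : chart A) (b : V) : overlap (B := A) c d b.1 ->
  trans (A := S) c d b = (trans c d b.1, jac c d b.1 b.2).
Proof.
case: b => b1 b2 /= [x [cx dx] <-]; rewrite /trans/=; congr (_, _).
have -> : 'D_b2 (trans c (chart_at A (inv c (co c x)))) (co c x) = tback c x b2.
  by rewrite (ga_inv gA cx) derEx.
by rewrite (ga_inv gA cx) (tcoord_jac gA _ cx dx) (tbackK gA cx).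
Qed.

Lemma open_fst (U : set E) : open U -> open [set b : V | U b.1 /\ b.2 != 0].
Proof.
move=> oU; apply: (@openI _ (fst @^-1` U) (snd @^-1` [set y : E | y != 0])).
  by apply: open_comp => // x _; exact: cvg_fst.
apply: open_comp => [x _|]; first exact: cvg_snd.
rewrite (_ : [set y : E | y != 0] = ~` [set 0]); last by apply/seteqP; split=> x /= /eqP.
rewrite openC; apply: accessible_closed_set1; exact: hausdorff_accessible.
Qed.

Lemma jac_fst_smooth (c d : chart A) u :
  smooth_on [set b | overlap (B := A) c d b.1 /\ b.2 != 0] (fun b : V => jac c d b.1 u).
Proof.
apply: (smooth_comp (O' := overlap (B := A) c d) fE (open_fst (ga_open gA c d)) (f := fst)
  (g := fun q => jac c d q u)) => [a []//||].
  exact: smooth_clin (@clin_fst R n).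
exact: (smooth_der u (ga_smooth gA c d)).
Qed.

Lemma slit_good : good_atlas S.
Proof.
split.
- by move=> c u [cu u0]; split=> //; exact: (ga_at gA cu).
- by move=> c u; exact: slit_inv.
- by move=> c d; rewrite -/(overlap (B := S) c d) slit_overlap; exact: open_fst (ga_open gA c d).
move=> c d; rewrite -/(overlap (B := S) c d) slit_overlap; change (chart A) in c, d.
have oO := open_fst (ga_open gA c d).
apply: (@smooth_eq R V V _ (fun b => (trans c d b.1, jac c d b.1 b.2)) _ oO) => [b [ob _]|].
  by rewrite slit_trans.
apply: (smooth_pair oO).
  apply: (smooth_comp (O' := overlap (B := A) c d) fE oO (f := fst) (g := trans c d)) => [a []//||].
    exact: smooth_clin (@clin_fst R n).
  exact: ga_smooth gA c d.
apply: (smooth_moving fE oO (T := fun b u => jac c d b.1 u) (Y := snd)).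
- by move=> q [oq _]; exact: jac_lin.
- by move=> u; exact: jac_fst_smooth.
- exact: smooth_snd.
Qed.

(** The second component of the differential also has a term with second derivatives of the
    transition map; it vanishes on vertical vectors. *)
Lemma slit_jac (c d : chart A) (b v : V) : overlap (B := S) c d b ->
  (jac (B := S) c d b v).1 = jac c d b.1 v.1 /\
  (v.1 = 0 -> jac (B := S) c d b v = (0, jac c d b.1 v.2)).
Proof.
move=> ob; have := ob; rewrite slit_overlap => -[ob1 b20].
have oO := open_fst (ga_open gA c d).
have Ob : [set b | overlap (B := A) c d b.1 /\ b.2 != 0] b by [].
have d1 : differentiable (trans c d \o fst : V -> E) b.
  apply: differentiable_comp; first by have [] := clin_der b (@clin_fst R n).
  exact: diff_trans gA _ _ _ ob1.
have [d2 D2] := @der_moving R V E E _ (fun b u => jac c d b.1 u) snd b fE oO Ob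
  (fun q oq => jac_lin gA oq.1) (fun u => smooth_diff (jac_fst_smooth c d u) Ob)
  (smooth_diff (smooth_snd _) Ob).
have E0 : jac (B := S) c d b v = (jac c d b.1 v.1, der v (fun b : V => jac c d b.1 b.2) b).
  rewrite /jac (@der_eq_on R V V _ _ (fun b => ((trans c d \o fst) b, jac c d b.1 b.2)) b v oO Ob).
    rewrite der_pair// der_comp//; last exact: diff_trans gA _ _ _ ob1.
      by have [_ ->] := clin_der b (@clin_fst R n).
    by have [] := clin_der b (@clin_fst R n).
  by move=> a [oa _]; rewrite slit_trans.
rewrite E0; split=> // v0; rewrite v0 jac0 D2 der_snd; congr (_, _).
rewrite [X in X + _](_ : _ = 0) ?add0r//.
rewrite (der_comp (f := fst) (g := fun q => jac c d q b.2)).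
- by have [_ ->] := clin_der b (@clin_fst R n); rewrite v0 der0.
- by have [] := clin_der b (@clin_fst R n).
- exact: smooth_diff (smooth_der _ (ga_smooth gA c d)) ob1.
Qed.

End Manifold.

(** * Fields and connections in a chart *)

Section ChartModel.
Context (R : realType) (n : nat) (M : topologicalType).
Local Notation E := 'rV[R]_n.
Local Notation V := (E * E)%type.
Context (A : atlas E M) (hM : smooth_manifold A).
Local Notation S := (slit_atlas A).
Let gA := manifold_good hM.
Let gS := slit_good hM.
Let fE := @findim_rV R n.
Let fV := @findimV R n.

Section Chart.
Context (c : chart A).

(** The image of a chart, as an overlap of the chart with itself. *)
Definition chart_dom : set V := overlap (B := S) c c.
(** The point with given coordinates. *)
Definition chart_pt (b : V) : TM R n M := inv (a := S) c b.
Definition chart_co (u : TM R n M) : V := co (a := S) c u.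

Lemma open_chart_dom : open chart_dom. Proof. exact: (ga_open gS c c). Qed.

Lemma chart_domP b : chart_dom b <-> (co c @` dom c) b.1 /\ b.2 != 0.
Proof. by rewrite /chart_dom slit_overlap// /overlap setIid. Qed.

Lemma chart_dom_pt b : chart_dom b -> dom (a := S) c (chart_pt b) /\ chart_co (chart_pt b) = b.
Proof. by move=> /chart_domP[h1 h2]; exact: slit_co. Qed.

Lemma chart_coK u : dom (a := S) c u -> chart_pt (chart_co u) = u.
Proof. exact: slit_inv. Qed.

Lemma chart_dom_co u : dom (a := S) c u -> chart_dom (chart_co u).
Proof. by move=> cu; exact: overlap_co. Qed.

Lemma chart_ptE b : (co c @` dom c) b.1 -> chart_pt b = (inv c b.1, tback c (inv c b.1) b.2).
Proof.
case: b => b1 b2 [x /= cx <-]; rewrite /chart_pt/= (ga_inv gA cx); congr (_, _).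
by rewrite derEx.
Qed.

Lemma dom_slit u : dom (a := S) c u -> slit u. Proof. by case. Qed.

Lemma prepE Y u : dom (a := S) c u -> prep c Y (chart_co u) = tcoord c u.1 (Y u).
Proof.
move=> cu; rewrite /prep -/(chart_pt (chart_co u)) (chart_coK cu).
by rewrite -[X in _ = tcoord c X.1 _](chart_coK cu).
Qed.

Lemma prep_pt Y b : prep c Y b = tcoord c (chart_pt b).1 (Y (chart_pt b)).
Proof. by []. Qed.

(** The pi-vector field with given components in the chart. *)
Definition liftp (Y : V -> E) : pvf R n M := fun u => tback c u.1 (Y (chart_co u)).
Definition liftv (X : V -> V) : vf R n M := fun u => tback (B := S) c u (X (chart_co u)).

Lemma prep_lift Y b : chart_dom b -> prep c (liftp Y) b = Y b.
Proof.
by move=> /chart_dom_pt[[cb _] E]; rewrite prep_pt /liftp E (tbackK gA).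
Qed.

Lemma vrep_lift X b : chart_dom b -> vrep (A := S) c (liftv X) b = X b.
Proof. by move=> /chart_dom_pt[cb E]; rewrite /vrep -/(chart_pt b) /liftv E (tbackK gS). Qed.

End Chart.

Lemma prep_trans (c d : chart A) Y (b : V) : overlap (B := S) d c b ->
  prep d Y b = jac (B := A) c d (trans (A := S) d c b).1 (prep c Y (trans (A := S) d c b)).
Proof.
move=> [u [du cu] <-]; rewrite (trans_co gS)// -/(chart_co c u) -/(chart_co d u) !prepE//.
by apply: tcoord_jac => //; [case: cu|case: du].
Qed.

Lemma smooth_pvfP (c : chart A) Y u : dom (a := S) c u ->
  smooth_pvf A Y u <-> smooth_at (prep c Y) (chart_co c u).
Proof.
move=> cu; have eu := ga_at gS cu; rewrite /smooth_pvf (smooth_repP gS _ eu).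
have H (d e : chart A) : dom (a := S) d u -> dom (a := S) e u ->
    smooth_at (prep d Y) (chart_co d u) -> smooth_at (prep e Y) (chart_co e u).
  move=> du eu' [ O [ oO Ou sO]].
  apply: (smooth_at_trans fV gS du eu' (g := fun b => jac (B := A) d e b.1 (prep d Y b))).
    by move=> b ob; exact: prep_trans.
  have oI : open (O `&` overlap (B := S) d e) := openI oO (ga_open gS d e).
  exists (O `&` overlap (B := S) d e); split=> //.
    by split=> //; exact: overlap_co.
  apply: (smooth_moving fE oI (T := fun b v => jac (B := A) d e b.1 v)).
  - by move=> q [_]; rewrite slit_overlap// => -[oq _]; exact: (jac_lin gA oq).
  - move=> v; apply: smooth_sub (jac_fst_smooth hM d e v).
    by move=> q [_]; rewrite slit_overlap.
  - by apply: smooth_sub sO => q [].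
by split; exact: H.
Qed.

Section Chart2.
Context (c : chart A).
Local Notation chart_dom := (chart_dom c).
Local Notation chart_pt := (chart_pt c).
Local Notation chart_co := (chart_co c).
Local Notation liftp := (liftp c).
Local Notation liftv := (liftv c).
Let oO : open chart_dom := @open_chart_dom c.

Lemma smooth_on_at (W : normedModType R) (f g : V -> W) b : chart_dom b -> smooth_on chart_dom f ->
  (forall q, chart_dom q -> g q = f q) -> smooth_at g b.
Proof. by move=> ob sf E; exists chart_dom; split=> //; apply: (smooth_eq oO _ sf) => q /E ->. Qed.

Lemma smooth_lift Y u : dom (a := S) c u -> smooth_on chart_dom Y -> smooth_pvf A (liftp Y) u.
Proof.
move=> cu sY; apply/(smooth_pvfP _ cu); apply: smooth_on_at (chart_dom_co cu) sY _.
by move=> q; exact: prep_lift.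
Qed.

Lemma smooth_on_pvf Y b : chart_dom b -> smooth_on chart_dom (prep c Y) -> smooth_pvf A Y (chart_pt b).
Proof.
move=> ob sY; have [cb E] := chart_dom_pt ob; apply/(smooth_pvfP _ cb); rewrite E.
exact: smooth_on_at ob sY _.
Qed.

Lemma smooth_on_vf X b : chart_dom b -> smooth_on chart_dom (vrep (A := S) c X) -> smooth_vf S X (chart_pt b).
Proof.
move=> ob sX; have [cb E] := chart_dom_pt ob.
apply/(smooth_vfP fV gS _ cb); rewrite -/(chart_co _) E.
exact: smooth_on_at ob sX _.
Qed.

Lemma smooth_on_prep Y : (forall b, chart_dom b -> smooth_pvf A Y (chart_pt b)) -> smooth_on chart_dom (prep c Y).
Proof.
move=> sY; apply: smooth_local => b ob; have [cb E] := chart_dom_pt ob.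
have := sY b ob; move/(smooth_pvfP _ cb); rewrite E => -[ O [ oO' Ob sO]].
by exists O.
Qed.

Lemma smooth_on_func (f : func R n M) : smooth_func A f -> smoothR chart_dom (f \o chart_pt).
Proof.
move=> sf; apply: smooth_local => b ob; have [cb E] := chart_dom_pt ob.
have := sf _ (dom_slit cb); move/(smooth_nearP fV gS _ cb); rewrite -/(chart_co _) E => -[ O [ oO' Ob sO]].
by exists O.
Qed.

Lemma dfunP (f : func R n M) b w : chart_dom b -> differentiable (f \o chart_pt : V -> R^o) b ->
  dfun A f (chart_pt b) w = derR (tcoord (A := S) c (chart_pt b) w) (f \o chart_pt) b.
Proof.
move=> ob df; have [cb E] := chart_dom_pt ob.
rewrite /dfun (dirderP gS _ cb)//; first by rewrite -/(chart_co _) E.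
by rewrite -/(chart_co _) E.
Qed.

Lemma rhoE u w : slit u -> rho A u w = w.1.
Proof.
move=> su; set e := chart_at A u.1.
have eu : dom (a := S) e u.
  by split=> //; case: hM => _ _ hat _ _; exact: hat.
rewrite /rho /tangent_map /dirder derEx.
rewrite (@der_eq_on R V E (overlap (B := S) e e) _ (fst : V -> E) _ _ (@open_chart_dom e)).
- by have [_ ->] := clin_der (co_at S u) (@clin_fst R n).
- exact: (chart_dom_co eu).
- move=> b ob; have [[cb _] _] := chart_dom_pt ob; move/chart_domP : ob => [[x /= cx <-] _] /=.
  by rewrite (ga_inv gA cx).
Qed.

Lemma gammaE u v : slit u -> gamma A u v = (0, v).
Proof.
move=> su; have hat : dom (chart_at A u.1) u.1 by case: hM.
rewrite /gamma derive1E derEx.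
rewrite (_ : (fun t => _) = (fun t : R => (co (chart_at A u.1) u.1, u.2 + t *: v))); last first.
  by apply/funext => t /=; rewrite (tcoord_id gA).
have sm1 : smooth_on setT (fun t : R^o => u.2 + t *: v).
  apply: smoothD; [exact: openT|exact: smooth_cst|].
  apply: (smoothS (f := id) openT); last exact: smooth_cst.
  by apply: smooth_clin; split=> // x; exact: cvg_id.
have sid : smoothR setT (id : R^o -> R).
  by apply: smooth_clin; split=> // x; exact: cvg_id.
rewrite (@der_pair R R^o E E (fun=> co (chart_at A u.1) u.1) (fun t => u.2 + t *: v)).
- rewrite der_cst (der_add_on _ (smooth_cst setT u.2)); [|by apply: (smoothS openT sid); exact: smooth_cst|by []].
  rewrite der_cst add0r (der_scale_vec _ _ sid)//; congr (_, _).
  have cid : clin (id : R^o -> R^o) by split=> // x; exact: cvg_id.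
  by rewrite /derR; have [_ ->] := clin_der (0 : R^o) cid; rewrite scale1r.
- by apply: (smooth_diff (smooth_cst setT _)).
- exact: (smooth_diff sm1).
Qed.

Lemma tcoordS u w : dom (a := S) c u ->
  (tcoord (A := S) c u w).1 = tcoord c u.1 w.1 /\
  (w.1 = 0 -> tcoord (A := S) c u w = vert (tcoord c u.1 w.2)).
Proof.
move=> cu; have eu := ga_at gS cu; rewrite !tcoordE.
exact: (slit_jac hM w (overlap_co eu cu)).
Qed.

Lemma tcoord_rho u w : dom (a := S) c u ->
  tcoord c u.1 (rho A u w) = (tcoord (A := S) c u w).1.
Proof. by move=> cu; rewrite (rhoE _ (dom_slit cu)); have [-> _] := tcoordS w cu. Qed.

Lemma tcoord_gamma u v : dom (a := S) c u ->
  tcoord (A := S) c u (gamma A u v) = vert (tcoord c u.1 v).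
Proof.
by move=> cu; rewrite (gammaE _ (dom_slit cu)); have [_ ->] := tcoordS (0, v) cu.
Qed.

Lemma prep_eta b : chart_dom b -> prep c (@Defs.eta R n M) b = b.2.
Proof. by move=> ob; have [_ E] := chart_dom_pt ob; rewrite -[in RHS]E. Qed.

Lemma prep_rhof X b : chart_dom b -> prep c (rhof A X) b = (vrep (A := S) c X b).1.
Proof. by move=> /chart_dom_pt[cb _]; rewrite prep_pt tcoord_rho. Qed.

Lemma vrep_gammaf Y b : chart_dom b -> vrep (A := S) c (gammaf A Y) b = vert (prep c Y b).
Proof. by move=> /chart_dom_pt[cb _]; rewrite /vrep -/(chart_pt b) tcoord_gamma. Qed.

Context (D : operator R n M) (hD : connection A D).

Lemma D_lin u Y : dom (a := S) c u -> smooth_pvf A Y u ->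
  forall (a : R) w z, D u (a *: w + z) Y = a *: D u w Y + D u z Y.
Proof. by move=> /dom_slit su sY; have [H _ _ _] := hD su; exact: H. Qed.

Lemma smooth_pvf0 u : dom (a := S) c u -> smooth_pvf A (fun=> 0) u.
Proof.
move=> cu; apply/(smooth_pvfP _ cu); apply: (smooth_on_at (chart_dom_co cu) (smooth_cst chart_dom (0 : E))).
by move=> q /chart_dom_pt[[cq _] _]; rewrite prep_pt tcoordE jac0.
Qed.

Lemma smooth_pvfD u Y Z : dom (a := S) c u -> smooth_pvf A Y u -> smooth_pvf A Z u ->
  smooth_pvf A (fun t => Y t + Z t) u.
Proof.
move=> cu /(smooth_pvfP _ cu)[ O [ oO1 O1 s1]] /(smooth_pvfP _ cu)[ O' [ oO2 O2 s2]].
apply/(smooth_pvfP _ cu); exists ((O `&` O') `&` chart_dom).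
have oI : open ((O `&` O') `&` chart_dom) by apply: openI => //; exact: openI.
split; [exact: oI|split; [exact: (conj O1 O2)|exact: (chart_dom_co cu)]|].
apply: (smooth_eq oI (f := fun q => prep c Y q + prep c Z q)) => [q [_ /chart_dom_pt[[cq _] _]]|].
  rewrite !prep_pt; have := tcoord_lin gA cq 1 (Y (chart_pt q)) (Z (chart_pt q)).
  by rewrite !scale1r.
by apply: (smoothD oI); [apply: smooth_sub s1|apply: smooth_sub s2] => q [[]].
Qed.

Lemma D_sum u w m (Y : 'I_m -> pvf R n M) : dom (a := S) c u ->
  (forall i, smooth_pvf A (Y i) u) ->
  smooth_pvf A (fun t => \sum_i Y i t) u /\
  D u w (fun t => \sum_i Y i t) = \sum_i D u w (Y i).
Proof.
move=> cu; have [_ DD _ _] := hD (dom_slit cu); elim: m Y => [|m IH] Y sY.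
  have -> : (fun t => \sum_(i < 0) Y i t) = (fun=> 0) by apply/funext => t; rewrite big_ord0.
  split; first exact: smooth_pvf0.
  rewrite big_ord0; have := DD _ _ (smooth_pvf0 cu) (smooth_pvf0 cu) w.
  have -> : (fun t : TM R n M => (0 : E) + 0) = (fun=> 0) by apply/funext => t; rewrite addr0.
  by move/eqP; rewrite -subr_eq subrr => /eqP.
have -> : (fun t => \sum_(i < m.+1) Y i t) = (fun t => Y ord0 t + \sum_(i < m) Y (lift ord0 i) t).
  by apply/funext => t; rewrite big_ord_recl.
have [s E] := IH (fun i => Y (lift ord0 i)) (fun i => sY _).
split; first exact: (smooth_pvfD cu (sY ord0) s).
by rewrite (DD _ _ (sY ord0) s) E big_ord_recl.
Qed.

(** The Leibniz rule for the indicator function of the chart domain, which is smooth there. *)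
Lemma D_local u w Y Z : dom (a := S) c u -> smooth_pvf A Y u -> smooth_pvf A Z u ->
  (forall t, dom (a := S) c t -> Y t = Z t) -> D u w Y = D u w Z.
Proof.
move=> cu sY sZ E; have [_ _ DL _] := hD (dom_slit cu).
pose f : func R n M := fun t => if pselect (dom (a := S) c t) then 1 else 0.
have sf : smooth_near S (f : TM R n M -> R^o) u.
  apply/(smooth_nearP fV gS _ cu); apply: (smooth_on_at (chart_dom_co cu) (smooth_cst chart_dom (1 : R^o))).
  by move=> q /chart_dom_pt[cq _]; rewrite /= /f; case: pselect.
have fu : f u = 1 by rewrite /f; case: pselect.
have fYZ : (fun t => f t *: Y t) = (fun t => f t *: Z t).
  apply/funext => t; rewrite /f; case: pselect => ct; last by rewrite !scale0r.
  by rewrite (E t ct).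
have := DL f Y sf sY w; rewrite fYZ (DL f Z sf sZ w) (E u cu) fu !scale1r.
by move/addrI => ->.
Qed.

Definition frame i : pvf R n M := liftp (fun=> delta_mx 0 i).

Fact chart_gamma_key : unit. Proof. exact: tt. Qed.
(** The Christoffel symbols of the connection, applied to a tangent vector of the slit bundle and to
    the components of a pi-vector; locked for the same reason as [der]. *)
Definition chart_gamma b (w : V) (z : E) : E := locked_with chart_gamma_key
  (\sum_i z 0 i *: tcoord c (chart_pt b).1 (D (chart_pt b) (tback (B := S) c (chart_pt b) w) (frame i))).

Lemma chart_gammaE b w z : chart_gamma b w z = \sum_i z 0 i *: tcoord c (chart_pt b).1
  (D (chart_pt b) (tback (B := S) c (chart_pt b) w) (frame i)).
Proof. by rewrite /chart_gamma unlock. Qed.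

Lemma smooth_frame i u : dom (a := S) c u -> smooth_pvf A (frame i) u.
Proof. by move=> cu; apply: smooth_lift cu _; exact: smooth_cst. Qed.

Lemma tcoordZ x (k : R) v : dom c x -> tcoord c x (k *: v) = k *: tcoord c x v.
Proof.
move=> cx; have := tcoord_lin gA cx k v 0.
by rewrite [tcoord c x 0]tcoordE jac0 !addr0.
Qed.

(** Expand the field on the coordinate frame, use locality to discard what happens outside the
    chart, and apply the Leibniz rule to each component. *)
Lemma D_chart b w Y : chart_dom b -> smooth_pvf A Y (chart_pt b) ->
  tcoord c (chart_pt b).1 (D (chart_pt b) w Y)
  = der (tcoord (A := S) c (chart_pt b) w) (prep c Y) b
    + chart_gamma b (tcoord (A := S) c (chart_pt b) w) (prep c Y b).
Proof.
move=> ob sY; have [cb Eb] := chart_dom_pt ob; have [cb1 _] := cb.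
have [_ _ DL _] := hD (dom_slit cb).
pose f i : func R n M := fun t => tcoord c t.1 (Y t) 0 i.
have sP : smooth_at (prep c Y) b by move/(smooth_pvfP _ cb): sY; rewrite Eb.
have ccoord i : clin (fun v : E => v 0 i : R^o).
  by split=> [k u v|]; [rewrite !mxE|exact: coord_continuous].
have sfi i : smooth_at ((f i \o chart_pt) : V -> R^o) b.
  case: sP => O [oO1 O1 s1]; exists O; split=> //.
  exact: (smooth_clin_comp oO1 (ccoord i) s1).
have sf i : smooth_near S (f i : TM R n M -> R^o) (chart_pt b).
  by apply/(smooth_nearP fV gS _ cb); rewrite -/(chart_co _) Eb; exact: sfi.
have sfY i : smooth_pvf A (fun t => f i t *: frame i t) (chart_pt b).
  apply/(smooth_pvfP _ cb); rewrite Eb; case: (sfi i) => O [oO1 O1 s1].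
  have oI := openI oO1 oO.
  exists (O `&` chart_dom); split=> //.
  apply: (smooth_eq oI (f := fun q => (f i (chart_pt q) : R) *: (delta_mx 0 i : E))) => [q [_ oq]|].
    have [[cq _] _] := chart_dom_pt oq.
    by rewrite [in RHS]prep_pt tcoordZ// -prep_pt prep_lift.
  by apply: smoothS => //; [apply: smooth_sub s1 => q []|exact: smooth_cst].
have [sS DS] := D_sum w cb sfY.
rewrite (D_local w cb sY sS); last first.
  move=> t [ct _]; rewrite -[LHS](tcoordK gA ct).
  rewrite {1}(row_sum_delta (tcoord c t.1 (Y t))).
  rewrite (@linear_fun_sum R E E _ (tback_lin gA ct)); apply: eq_bigr => i _.
  by rewrite -[_ *: _ in LHS]addr0 (tback_lin gA ct) {2}/tback jac0 addr0.
rewrite DS (@linear_fun_sum R E E _ (tcoord_lin gA cb1)).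
rewrite (row_sum_delta (der _ (prep c Y) b)) chart_gammaE -big_split/=; apply: eq_bigr => i _.
rewrite (DL _ _ (sf i) (smooth_frame i cb)).
rewrite (tcoord_lin gA cb1) (tcoordZ _ _ cb1) (tcoordK gS cb).
have E1 : tcoord c (chart_pt b).1 (frame i (chart_pt b)) = delta_mx 0 i by rewrite -prep_pt prep_lift.
have E2 : dfun A (f i) (chart_pt b) w = der (tcoord (A := S) c (chart_pt b) w) (prep c Y) b 0 i.
  rewrite (dfunP w ob (smooth_at_diff (sfi i))) /derR !derE.
  have [_ E2] := clin_comp (ccoord i) (smooth_at_diff sP); exact: E2.
rewrite E1 E2; exact: erefl.
Qed.

End Chart2.
End ChartModel.

(** * Curvature in a chart *)

Section FlatConnection.
Context (R : realType) (n : nat).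
Local Notation E := 'rV[R]_n.
Local Notation V := (E * E)%type.
Context (O : set V) (oO : open O) (F : V -> E -> E -> E) (BF : bilinear_family O F).
Implicit Types (X Y : V -> V) (Z : V -> E) (b : V).

(** The covariant derivative with connection form [F] applied to the horizontal part. *)
Definition nabla X Z q : E := der (X q) Z q + F q (X q).1 (Z q).

Lemma smooth_fst_comp X : smooth_on O X -> smooth_on O (fun q => (X q).1).
Proof. by move=> sX; exact: (smooth_clin_comp oO (@clin_fst R n) sX). Qed.

Lemma nabla2 X Y Z b : O b -> smooth_on O X -> smooth_on O Y -> smooth_on O Z ->
  nabla X (nabla Y Z) b
  = der (X b) (der (Y b) Z) b + der (der (X b) Y b) Z b
    + (der (X b) (fun q => F q (Y b).1 (Z b)) b + F b (Y b).1 (der (X b) Z b)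
       + F b (der (X b) Y b).1 (Z b))
    + F b (X b).1 (der (Y b) Z b + F b (Y b).1 (Z b)).
Proof.
move=> Ob sX sY sZ; rewrite {1}/nabla; congr (_ + _).
have s1 : smooth_on O (fun q => der (Y q) Z q).
  exact: (smooth_along_moving (findimV R n) oO sZ sY).
have s2 : smooth_on O (fun q => F q (Y q).1 (Z q)).
  exact: (bil_smooth oO BF (smooth_fst_comp sY) sZ).
have -> : der (X b) (nabla Y Z) b = der (X b) (fun q => der (Y q) Z q) b
    + der (X b) (fun q => F q (Y q).1 (Z q)) b by exact: (der_add_on _ s1 s2 Ob).
rewrite (der_along_moving (X b) (findimV R n) oO Ob sZ (smooth_diff sY Ob)).
have [_ Db] := bil_diff oO BF Ob (smooth_diff (smooth_fst_comp sY) Ob) (smooth_diff sZ Ob).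
rewrite (Db (X b)).
have -> // : der (X b) (fun q => (Y q).1) b = (der (X b) Y b).1.
rewrite (der_comp (f := Y) (g := fst)).
- by have [_ ->] := clin_der (Y b) (@clin_fst R n).
- exact: smooth_diff sY Ob.
- by have [] := clin_der (Y b) (@clin_fst R n).
Qed.

(** The second derivatives of [Z] cancel by symmetry, and the derivatives of [X] and [Y] cancel
    against the derivative along the bracket: the curvature is a tensor. *)
Lemma nabla_curvature X Y Z b (x y : V) (z : E) : O b ->
  smooth_on O X -> smooth_on O Y -> smooth_on O Z -> X b = x -> Y b = y -> Z b = z ->
  - nabla X (nabla Y Z) b + nabla Y (nabla X Z) b
    + (der (der x Y b - der y X b) Z b + F b (der x Y b - der y X b).1 z)
  = - der x (fun q => F q y.1 z) b + der y (fun q => F q x.1 z) b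
    - F b x.1 (F b y.1 z) + F b y.1 (F b x.1 z).
Proof.
move=> Ob sX sY sZ Ex Ey Ez.
rewrite (nabla2 Ob sX sY sZ) (nabla2 Ob sY sX sZ) Ex Ey Ez.
rewrite (der_schwarz y x (@findim_rV R n) oO Ob sZ).
set P := der x Y b; set Q := der y X b.
have -> : P - Q = (-1) *: Q + P by rewrite scaleN1r addrC.
rewrite (der_linear _ _ _ (smooth_diff sZ Ob)) /=.
have [Fl Fr _] := BF; rewrite Fl//.
have FD a v w : F b a (v + w) = F b a v + F b a w.
  by rewrite -[v in LHS]scale1r Fr// scale1r.
rewrite !FD; apply/rowP => i; rewrite !mxE; ring.
Qed.

End FlatConnection.

Section LocalConnection.
Context (R : realType) (n : nat) (M : topologicalType).
Local Notation E := 'rV[R]_n.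
Local Notation V := (E * E)%type.
Context (A : atlas E M) (hM : smooth_manifold A).
Local Notation S := (slit_atlas A).
Let gA := manifold_good hM.
Let gS := slit_good hM.
Let fV := @findimV R n.
Context (c : chart A) (D : operator R n M) (hD : connection A D).
Local Notation chart_dom := (chart_dom c).
Local Notation chart_pt := (chart_pt c).
Local Notation chart_co := (chart_co c).
Local Notation chart_gamma := (chart_gamma c D).
Let oO : open chart_dom := open_chart_dom hM (c := c).

Lemma chart_gamma_linl b z : chart_dom b -> forall (k : R) w w',
  chart_gamma b (k *: w + w') z = k *: chart_gamma b w z + chart_gamma b w' z.
Proof.
move=> ob k w w'; have [cb _] := chart_dom_pt hM ob; have [cb1 _] := cb.
rewrite !chart_gammaE scaler_sumr -big_split/=; apply: eq_bigr => i _.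
rewrite (tback_lin gS cb) (D_lin hD cb (smooth_frame hM i cb)) (tcoord_lin gA cb1).
by rewrite scalerDr !scalerA mulrC.
Qed.

Lemma chart_gamma_linr b w : forall (k : R) z z', chart_gamma b w (k *: z + z') = k *: chart_gamma b w z + chart_gamma b w z'.
Proof.
move=> k z z'; rewrite !chart_gammaE scaler_sumr -big_split/=; apply: eq_bigr => i _.
by rewrite !mxE scalerDl scalerA.
Qed.

Lemma smooth_on_cov X Y : smooth_on chart_dom (vrep (A := S) c X) -> smooth_on chart_dom (prep c Y) ->
  smooth_on chart_dom (prep c (cov D X Y)).
Proof.
move=> sX sY; apply: (smooth_on_prep hM) => b ob; have [cb _] := chart_dom_pt hM ob.
have [_ _ _ H] := hD (dom_slit cb).
by apply: H; [exact: (smooth_on_vf hM ob sX)|exact: (smooth_on_pvf hM ob sY)].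
Qed.

Lemma smooth_vrep_lift X : smooth_on chart_dom X -> smooth_on chart_dom (vrep (A := S) c (liftv c X)).
Proof. by apply: (smooth_eq oO) => q /(vrep_lift hM) ->. Qed.

Lemma smooth_prep_lift Y : smooth_on chart_dom Y -> smooth_on chart_dom (prep c (liftp (A := A) c Y)).
Proof. by apply: (smooth_eq oO) => q /(prep_lift hM) ->. Qed.

Lemma smooth_chart_gamma w z : smooth_on chart_dom (fun b => chart_gamma b w z).
Proof.
rewrite (_ : (fun b => _) = fun b => \sum_i z 0 i *: prep c (cov D (liftv (A := A) c (fun=> w)) (frame c i)) b).
  2: by apply/funext => b; exact: chart_gammaE.
apply: (smooth_sum oO) => i; apply: (smoothZ _ oO).
apply: (smooth_on_cov (X := liftv (A := A) c (fun=> w)) (Y := frame c i)).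
  by apply: smooth_vrep_lift; exact: smooth_cst.
by apply: smooth_prep_lift; exact: smooth_cst.
Qed.

Lemma prep_cov X Y b : chart_dom b -> smooth_pvf A Y (chart_pt b) ->
  prep c (cov D X Y) b = der (vrep (A := S) c X b) (prep c Y) b
    + chart_gamma b (vrep (A := S) c X b) (prep c Y b).
Proof. by move=> ob sY; exact: (D_chart hM hD (X (chart_pt b)) ob sY). Qed.

Lemma bracket_chart X Y b : chart_dom b -> smooth_on chart_dom (vrep (A := S) c X) ->
  smooth_on chart_dom (vrep (A := S) c Y) ->
  tcoord (A := S) c (chart_pt b) (bracket S X Y (chart_pt b))
  = der (vrep (A := S) c X b) (vrep (A := S) c Y) b
    - der (vrep (A := S) c Y b) (vrep (A := S) c X) b.
Proof.
move=> ob sX sY; have [cb Eb] := chart_dom_pt hM ob.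
rewrite (bracketP fV gS cb (smooth_on_vf hM ob sX) (smooth_on_vf hM ob sY)).
by rewrite -/(chart_co (chart_pt b)) Eb.
Qed.

Context (hT : forall X Y u, slit u -> smooth_vf S X u -> smooth_vf S Y u -> torsion A D X Y u = 0).

(** The torsion of two coordinate vector fields, whose bracket vanishes. *)
Lemma chart_gamma_sym b w w' : chart_dom b -> chart_gamma b w w'.1 = chart_gamma b w' w.1.
Proof.
move=> ob; have [cb Eb] := chart_dom_pt hM ob; have [cb1 _] := cb.
pose X (w : V) : vf R n M := liftv (A := A) c (fun=> w).
have sX v : smooth_on chart_dom (vrep (A := S) c (X v)) by apply: smooth_vrep_lift; exact: smooth_cst.
have vX v q : chart_dom q -> vrep (A := S) c (X v) q = v by move=> oq; rewrite vrep_lift.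
have pX v q : chart_dom q -> prep c (rhof A (X v)) q = v.1 by move=> oq; rewrite (prep_rhof hM)// vX.
have spX v : smooth_on chart_dom (prep c (rhof A (X v))).
  by apply: (smooth_eq oO _ (smooth_cst chart_dom v.1)) => q /pX ->.
have cX v v' : prep c (cov D (X v) (rhof A (X v'))) b = chart_gamma b v v'.1.
  rewrite (prep_cov _ ob (smooth_on_pvf hM ob (spX v'))) vX// pX//.
  rewrite (der_eq_on _ oO ob (fun q oq => pX v' q oq)) der_cst add0r.
  by [].
have := hT (dom_slit cb) (smooth_on_vf hM ob (sX w)) (smooth_on_vf hM ob (sX w')).
move=> T0.
have B3 x y z : tcoord c (chart_pt b).1 (x - y - z)
    = tcoord c (chart_pt b).1 x - tcoord c (chart_pt b).1 y - tcoord c (chart_pt b).1 z.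
  by rewrite (tcoordB gA cb1) (tcoordB gA cb1).
have : tcoord c (chart_pt b).1 (torsion A D (X w) (X w') (chart_pt b)) = chart_gamma b w w'.1 - chart_gamma b w' w.1
    - (tcoord (A := S) c (chart_pt b) (bracket S (X w) (X w') (chart_pt b))).1.
  rewrite -(cX w w') -(cX w' w) -(tcoord_rho hM _ cb); exact: B3.
rewrite T0 (bracket_chart ob (sX w) (sX w')).
rewrite (_ : tcoord c (chart_pt b).1 0 = 0); last by rewrite tcoordE jac0.
rewrite (vX w b ob) (vX w' b ob).
rewrite (der_eq_on _ oO ob (fun q oq => vX w' q oq)) (der_eq_on _ oO ob (fun q oq => vX w q oq)).
rewrite !der_cst (_ : (0 - 0 : V).1 = 0); last by rewrite subr0.
set g1 := chart_gamma b w _; set g2 := chart_gamma b w' _.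
by rewrite subr0 => /esym/eqP; rewrite subr_eq0 => /eqP.
Qed.

Definition chart_form b (a z : E) : E := chart_gamma b (a, 0) z.

Lemma chart_form_sym b a z : chart_dom b -> chart_form b a z = chart_form b z a.
Proof. by move=> ob; exact: (chart_gamma_sym (a, 0) (z, 0) ob). Qed.

(** Vertical vectors have no Christoffel symbols: exchange the arguments in [chart_gamma_sym]. *)
Lemma gamma_form b w z : chart_dom b -> chart_gamma b w z = chart_form b w.1 z.
Proof. by move=> ob; rewrite (chart_form_sym w.1 z ob); exact: (chart_gamma_sym w (z, 0) ob). Qed.

Lemma chart_form_bil : bilinear_family chart_dom chart_form.
Proof.
split=> [b ob z k u w|b ob a k u w|a b]; last exact: smooth_chart_gamma.
- have E : (k *: u + w, 0) = k *: ((u, 0) : V) + (w, 0).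
    by apply: injective_projections; rewrite //= scaler0 addr0.
  by rewrite /chart_form E; exact: (chart_gamma_linl z ob k (u, 0) (w, 0)).
- exact: (chart_gamma_linr b (a, 0) k u w).
Qed.

Lemma prep_covF X Y b : chart_dom b -> smooth_on chart_dom (prep c Y) ->
  prep c (cov D X Y) b = der (vrep (A := S) c X b) (prep c Y) b
    + chart_form b (vrep (A := S) c X b).1 (prep c Y b).
Proof. by move=> ob sY; rewrite (prep_cov _ ob (smooth_on_pvf hM ob sY)) gamma_form. Qed.

Lemma prep_eta_smooth : smooth_on chart_dom (prep c (@Defs.eta R n M)).
Proof. by apply: (smooth_eq oO _ (smooth_snd chart_dom)) => q /(prep_eta hM) ->. Qed.

Lemma horizontalP b w : chart_dom b -> horizontal D (chart_pt b) w <->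
  tcoord (A := S) c (chart_pt b) w = hor chart_form b (tcoord (A := S) c (chart_pt b) w).1.
Proof.
move=> ob; have [cb _] := chart_dom_pt hM ob; have [cb1 _] := cb.
have E1 : tcoord c (chart_pt b).1 (D (chart_pt b) w (@Defs.eta R n M))
    = (tcoord (A := S) c (chart_pt b) w).2 + chart_form b (tcoord (A := S) c (chart_pt b) w).1 b.2.
  rewrite (D_chart hM hD _ ob (smooth_on_pvf hM ob prep_eta_smooth)) (prep_eta hM ob) gamma_form//.
  by rewrite (der_eq_on _ oO ob (fun q oq => prep_eta hM oq)) der_snd.
rewrite /horizontal/=; split=> [E0|E0].
  move: E1; rewrite E0 [tcoord c _ 0]tcoordE jac0 => /esym/eqP; rewrite addr_eq0 => /eqP E2.
  by apply: injective_projections.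
rewrite -(tcoordK gA cb1 (D _ _ _)) E1 E0/= addNr.
exact: jac0.
Qed.

Lemma tcoord_beta b x : chart_dom b ->
  tcoord (A := S) c (chart_pt b) (beta A D (chart_pt b) x) = hor chart_form b (tcoord c (chart_pt b).1 x).
Proof.
move=> ob; have [cb _] := chart_dom_pt hM ob; have [cb1 _] := cb.
have : exists w, [set w | horizontal D (chart_pt b) w /\ rho A (chart_pt b) w = x] w.
  exists (tback (B := S) c (chart_pt b) (hor chart_form b (tcoord c (chart_pt b).1 x))); split.
    by apply/(horizontalP _ ob); rewrite (tbackK gS cb).
  apply: (can_inj (tcoordK gA cb1)).
  by rewrite (tcoord_rho hM _ cb) (tbackK gS cb).
move/getPex; rewrite -/(beta A D (chart_pt b) x) => -[/(horizontalP _ ob) -> E].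
by rewrite -(tcoord_rho hM _ cb) E.
Qed.

Lemma vrep_betaf X b : chart_dom b -> vrep (A := S) c (betaf A D X) b = hor chart_form b (prep c X b).
Proof. by move=> ob; exact: (tcoord_beta _ ob). Qed.

Lemma smooth_betaf X : smooth_on chart_dom (prep c X) -> smooth_on chart_dom (vrep (A := S) c (betaf A D X)).
Proof.
move=> sX; apply: (@smooth_eq R V V _ (fun q => (prep c X q, - chart_form q (prep c X q) q.2)) _ oO).
  by move=> q oq; rewrite vrep_betaf.
apply: (smooth_pair oO sX); apply: smoothN => //.
exact: (bil_smooth oO chart_form_bil sX (smooth_snd chart_dom)).
Qed.

Lemma curvature_chart X Y Z b : chart_dom b -> smooth_on chart_dom (vrep (A := S) c X) ->
  smooth_on chart_dom (vrep (A := S) c Y) -> smooth_on chart_dom (prep c Z) ->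
  forall x y z, vrep (A := S) c X b = x -> vrep (A := S) c Y b = y -> prep c Z b = z ->
  prep c (curvature A D X Y Z) b
  = - der x (fun q => chart_form q y.1 z) b + der y (fun q => chart_form q x.1 z) b
    - chart_form b x.1 (chart_form b y.1 z) + chart_form b y.1 (chart_form b x.1 z).
Proof.
move=> ob sX sY sZ x y z Ex Ey Ez.
have [cb Eb] := chart_dom_pt hM ob; have [cb1 _] := cb.
have key W W' : smooth_on chart_dom (vrep (A := S) c W) -> smooth_on chart_dom (vrep (A := S) c W') ->
    prep c (cov D W (cov D W' Z)) b
    = nabla chart_form (vrep (A := S) c W) (nabla chart_form (vrep (A := S) c W') (prep c Z)) b.
  move=> sW sW'; have E1 q : chart_dom q -> prep c (cov D W' Z) q
      = nabla chart_form (vrep (A := S) c W') (prep c Z) q by move=> oq; exact: prep_covF.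
  rewrite (prep_covF _ ob (smooth_on_cov sW' sZ)) (der_eq_on _ oO ob E1) (E1 b ob).
  exact: erefl.
rewrite prep_pt /curvature.
have tN v : tcoord c (chart_pt b).1 (- v) = - tcoord c (chart_pt b).1 v.
  by rewrite -[- v]add0r (tcoordB gA cb1) [tcoord c _ 0]tcoordE jac0 add0r.
have tD v w : tcoord c (chart_pt b).1 (v + w) = tcoord c (chart_pt b).1 v + tcoord c (chart_pt b).1 w.
  by rewrite -[v in LHS]scale1r (tcoord_lin gA cb1) scale1r.
have -> : tcoord c (chart_pt b).1 (- cov D X (cov D Y Z) (chart_pt b) + cov D Y (cov D X Z) (chart_pt b)
      + cov D (bracket S X Y) Z (chart_pt b))
    = - prep c (cov D X (cov D Y Z)) b + prep c (cov D Y (cov D X Z)) b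
      + prep c (cov D (bracket S X Y) Z) b.
  by rewrite tD tD tN.
rewrite (key _ _ sX sY) (key _ _ sY sX).
have -> : prep c (cov D (bracket S X Y) Z) b
    = der (der x (vrep (A := S) c Y) b - der y (vrep (A := S) c X) b) (prep c Z) b
      + chart_form b (der x (vrep (A := S) c Y) b - der y (vrep (A := S) c X) b).1 z.
  rewrite (prep_covF _ ob sZ) Ez.
  have -> : vrep (A := S) c (bracket S X Y) b = der x (vrep (A := S) c Y) b - der y (vrep (A := S) c X) b.
    by rewrite -Ex -Ey -bracket_chart.
  by [].
exact: (nabla_curvature oO chart_form_bil ob sX sY sZ Ex Ey Ez).
Qed.

Lemma hcurv_chart X Y Z b : chart_dom b -> smooth_on chart_dom (prep c X) ->
  smooth_on chart_dom (prep c Y) -> smooth_on chart_dom (prep c Z) ->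
  prep c (hcurv A D X Y Z) b = Rcurv chart_form b (prep c X b) (prep c Y b) (prep c Z b).
Proof.
move=> ob sX sY sZ.
exact: (curvature_chart ob (smooth_betaf sX) (smooth_betaf sY) sZ
  (vrep_betaf X ob) (vrep_betaf Y ob) erefl).
Qed.

Context (hP : forall X Y u, slit u -> smooth_pvf A X u -> smooth_pvf A Y u ->
  vhv_torsion A D X Y u = 0).

(** The (v)hv-torsion of two coordinate fields. *)
Lemma chart_form_hv p a b : chart_dom p -> der (vert b) (fun q => chart_form q a p.2) p = 0.
Proof.
move=> op; have [cb _] := chart_dom_pt hM op; have [cb1 _] := cb.
have sc x : smooth_on chart_dom (prep c (liftp (A := A) c (fun=> x))).
  by apply: smooth_prep_lift; exact: smooth_cst.
have vg : forall q, chart_dom q -> vrep (A := S) c (gammaf A (liftp (A := A) c (fun=> b))) q = vert b.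
  by move=> q oq; rewrite (vrep_gammaf hM)// (prep_lift hM).
have sg : smooth_on chart_dom (vrep (A := S) c (gammaf A (liftp (A := A) c (fun=> b)))).
  by apply: (smooth_eq oO _ (smooth_cst chart_dom (vert b))) => q /vg ->.
have := hP (dom_slit cb) (smooth_on_pvf hM op (sc a)) (smooth_on_pvf hM op (sc b)).
rewrite /vhv_torsion => /(congr1 (tcoord c (chart_pt p).1)).
rewrite (_ : tcoord c (chart_pt p).1 0 = 0); last by rewrite tcoordE jac0.
move=> H0; have := H0; rewrite -[X in X = _]/(prep c (curvature A D _ _ _) p).
rewrite (curvature_chart op (smooth_betaf (sc a)) sg prep_eta_smooth
  (vrep_betaf _ op) (vg p op) (prep_eta hM op)).
rewrite (prep_lift hM)//= => {H0} H0; move: H0.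
have [Fl Fr _] := chart_form_bil.
have F0 q z : chart_dom q -> chart_form q 0 z = 0.
  move=> oq; have := Fl q oq z 1 0 0; rewrite !scale1r addr0.
  by move/eqP; rewrite -subr_eq subrr => /eqP.
have F0r q z : chart_dom q -> chart_form q z 0 = 0 by move=> oq; rewrite chart_form_sym// F0.
rewrite !F0// F0r// (der_eq_on _ oO op (fun q oq => F0 q p.2 oq)) der_cst.
by rewrite oppr0 add0r !addr0.
Qed.

End LocalConnection.

(** * Berwald connections in a chart *)

Section FinslerChart.
Context (R : realType) (n : nat) (M : topologicalType).
Local Notation E := 'rV[R]_n.
Local Notation V := (E * E)%type.
Context (A : atlas E M) (hM : smooth_manifold A).
Local Notation S := (slit_atlas A).
Let gA := manifold_good hM.
Let gS := slit_good hM.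
Context (L : func R n M) (hL : finsler A L) (D : operator R n M) (hB : berwald A L D).
Context (c : chart A).
Local Notation chart_dom := (chart_dom c).
Local Notation chart_pt := (chart_pt c).
Local Notation chart_co := (chart_co c).
Let oO : open chart_dom := open_chart_dom hM (c := c).
Local Notation F := (chart_form c D).
Local Notation Lc := (L \o chart_pt).

Let hD : connection A D. Proof. by case: hB. Qed.
Let hT : forall X Y u, slit u -> smooth_vf S X u -> smooth_vf S Y u -> torsion A D X Y u = 0.
Proof. by case: hB. Qed.
Let hP : forall X Y u, slit u -> smooth_pvf A X u -> smooth_pvf A Y u -> vhv_torsion A D X Y u = 0.
Proof. by case: hB. Qed.

Lemma chart_pt_fibre b z : chart_dom b -> chart_pt (b.1, z) = ((chart_pt b).1, tback c (chart_pt b).1 z).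
Proof. by move=> /(chart_domP hM)[cb _]; rewrite (chart_ptE hM). Qed.

(** On the fibre the chart is a linear map, and directional derivatives commute with it. *)
Lemma metric_chart b v w : chart_dom b ->
  metric L (chart_pt b) v w = gmet Lc (tcoord c (chart_pt b).1 v) (tcoord c (chart_pt b).1 w) b.
Proof.
move=> ob; have [[cb _] Eb] := chart_dom_pt hM ob; rewrite gmet.unlock /metric; congr (_ * _).
pose G : V -> R^o := fun q => Lc q ^+ 2.
(* The chart restricted to the fibre. *)
pose i (y : E) : V := (b.1, tcoord c (chart_pt b).1 y).
have Ei (t : R) x y : i (t *: x + y) = t *: vert (tcoord c (chart_pt b).1 x) + i y.
  apply: injective_projections; first by rewrite /= scaler0 add0r.
  exact: (tcoord_lin gA cb).
have Eh : (fun y : E => L ((chart_pt b).1, y) ^+ 2 : R^o) = G \o i.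
  by apply/funext => y; rewrite /G/i/= chart_pt_fibre// (tcoordK gA cb).
have Ew : 'D_w (G \o i) = 'D_(vert (tcoord c (chart_pt b).1 w)) G \o i.
  apply/funext => y.
  exact: (@derive_affine R V R^o E i (fun x => vert (tcoord c (chart_pt b).1 x)) G y w (fun t => Ei t w y)).
rewrite Eh Ew (@derive_affine R V R^o E i (fun x => vert (tcoord c (chart_pt b).1 x)) _ _ v
  (fun t => Ei t v (chart_pt b).2)).
have -> : i (chart_pt b).2 = b.
  by apply: injective_projections; [exact: erefl|exact: (congr1 snd Eb)].
by rewrite /derR !derE; exact: erefl.
Qed.

Lemma chart_pt_scale x y (t : R) : chart_dom (x, y) -> chart_pt (x, t *: y) = ((chart_pt (x, y)).1, t *: (chart_pt (x, y)).2).
Proof.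
move=> ob; have [[cb _] _] := chart_dom_pt hM ob.
have E1 : chart_pt (x, t *: y) = ((chart_pt (x, y)).1, tback c (chart_pt (x, y)).1 (t *: y)) := chart_pt_fibre _ ob.
have E2 : (chart_pt (x, y)).2 = tback c (chart_pt (x, y)).1 y := congr1 snd (chart_pt_fibre y ob).
rewrite E1 E2; congr (_, _); rewrite -[t *: y]addr0 (tback_lin gA cb).
by rewrite [X in _ + X]/tback jac0 addr0.
Qed.

Lemma chart_berwald : local_berwald chart_dom Lc F.
Proof.
have [sL L0 Lh gL] := hL; split.
- exact: oO.
- move=> p z /(chart_domP hM)[op _]; split=> [/(chart_domP hM)[] //|z0].
  by apply/(chart_domP hM).
- exact: (smooth_on_func hM c sL).
- by move=> p op; apply: L0; have [cp _] := chart_dom_pt hM op; exact: dom_slit cp.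
- by move=> x y t oxy t0; rewrite /= chart_pt_scale// Lh// -surjective_pairing.
- move=> p v op v0; have [cp Ep] := chart_dom_pt hM op; have [cp1 _] := cp.
  rewrite -[v](tbackK gA cp1) -metric_chart//.
  apply: gL; first exact: dom_slit cp.
  by apply: contra_neq v0 => E; rewrite -[v](tbackK gA cp1) E tcoordE jac0.
- exact: chart_form_bil.
- by move=> p a b; exact: chart_form_sym.
- by move=> p a b; exact: chart_form_hv.
- move=> p a op; have [cp Ep] := chart_dom_pt hM op; have [cp1 _] := cp.
  have [_ _ _ _ H] := hB.
  have := H _ (dom_slit cp) (tback (B := S) c (chart_pt p) (a, 0)).
  rewrite (dfunP hM _ op (sm_diff (smooth_on_func hM c sL) op)) /hproj (tcoord_beta hM hD hT _ op).
  by rewrite (tcoord_rho hM _ cp) (tbackK gS cp).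
Qed.

Let lb := chart_berwald.

Lemma ell_chart X b : chart_dom b -> ell L X (chart_pt b) = (Lc b)^-1 * theta Lc (prep c X b) b.
Proof.
move=> ob; rewrite /ell /gf metric_chart//; congr (_ * _).
have -> : tcoord c (chart_pt b).1 (@Defs.eta R n M (chart_pt b)) = b.2 := prep_eta hM ob.
by rewrite (gmet_sym lb)// (gmet_eta lb).
Qed.

(** The projector phi on components. *)
Definition phiv b (a : E) : E := a - ((Lc b)^-1 * ((Lc b)^-1 * theta Lc a b)) *: b.2.

Lemma prep_phi X b : chart_dom b -> prep c (phi L X) b = phiv b (prep c X b).
Proof.
move=> ob; have [[cb _] _] := chart_dom_pt hM ob.
rewrite prep_pt /phi ell_chart// (tcoordB gA cb) (tcoordZ hM _ _ cb).
by have -> : tcoord c (chart_pt b).1 (@Defs.eta R n M (chart_pt b)) = b.2 := prep_eta hM ob.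
Qed.

Lemma theta_phiv b a : chart_dom b -> theta Lc (phiv b a) b = 0.
Proof.
move=> ob; have L0 := lb_pos lb ob.
rewrite /phiv addrC -scaleNr (theta_lin lb)// (theta_eta lb)//; field.
by rewrite gt_eqF.
Qed.

Lemma phiv_perp b a : theta Lc a b = 0 -> phiv b a = a.
Proof. by move=> ta; rewrite /phiv ta !mulr0 scale0r subr0. Qed.

Definition cst_pvf (a : E) : pvf R n M := liftp (A := A) c (fun=> a).

Lemma prep_cst_pvf a b : chart_dom b -> prep c (cst_pvf a) b = a.
Proof. exact: (prep_lift hM). Qed.

Lemma smooth_cst_pvf a : smooth_on chart_dom (prep c (cst_pvf a)).
Proof. by apply: (smooth_prep_lift hM); exact: smooth_cst. Qed.

Lemma smooth_phiv a : smooth_on chart_dom (fun q => phiv q a).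
Proof.
have sL := lb_smooth lb.
have sLV : smoothR chart_dom (fun q => (Lc q)^-1).
  by apply: (smoothV oO _ sL) => q oq; rewrite gt_eqF// (lb_pos lb).
apply: (smoothB oO (smooth_cst chart_dom a)); apply: (smoothS oO _ (smooth_snd chart_dom)).
exact: (sm_mul oO sLV (sm_mul oO sLV (sm_theta lb a))).
Qed.

Lemma smooth_phi_cst a : smooth_on chart_dom (prep c (phi L (cst_pvf a))).
Proof.
by apply: (smooth_eq oO _ (smooth_phiv a)) => q oq; rewrite prep_phi// prep_cst_pvf.
Qed.

Section Scalar.
Context (k : func R n M) (hk : scalar_curvature A L D k).

Lemma sm_k : smoothR chart_dom (k \o chart_pt).
Proof. by case: hk => _ s _ _; exact: (smooth_on_func hM c s). Qed.

Lemma hom_k x y (t : R) : chart_dom (x, y) -> 0 < t -> (k \o chart_pt) (x, t *: y) = (k \o chart_pt) (x, y).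
Proof.
move=> oxy t0; case: hk => _ _ h _; rewrite /= chart_pt_scale// h//.
by have [cp _] := chart_dom_pt hM oxy; exact: dom_slit cp.
Qed.

Lemma chart_scalar : local_scalar chart_dom Lc F (k \o chart_pt).
Proof.
move=> p a op; have [cp Ep] := chart_dom_pt hM op; have [cp1 _] := cp.
have [_ _ _ H] := hk.
have := H (cst_pvf a) _ (dom_slit cp) (smooth_on_pvf hM op (smooth_cst_pvf a)).
move/(congr1 (tcoord c (chart_pt p).1)).
rewrite (tcoordZ hM _ _ cp1) => E0.
have := hcurv_chart hM hD hT op (prep_eta_smooth hM c) (smooth_cst_pvf a) (prep_eta_smooth hM c).
rewrite (prep_eta hM op) prep_cst_pvf// => <-.
rewrite -[LHS]/(tcoord c (chart_pt p).1 (deviation A D (cst_pvf a) (chart_pt p))) E0.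
have -> : tcoord c (chart_pt p).1 (phi L (cst_pvf a) (chart_pt p)) = phiv p a.
  by have := prep_phi (cst_pvf a) op; rewrite prep_cst_pvf.
rewrite /phiv scalerBr scalerA; congr (_ - _ *: _) => /=.
by field; rewrite gt_eqF// (lb_pos lb op).
Qed.

End Scalar.

Section Hp.
Context (eps : func R n M) (heps : Hp_scalar_curvature A L D eps).

Lemma sm_eps : smoothR chart_dom (eps \o chart_pt).
Proof. by case: heps => _ s _ _; exact: (smooth_on_func hM c s). Qed.

Lemma chart_Hp : local_Hp chart_dom Lc F (eps \o chart_pt).
Proof.
move=> p a b z w op ta tb tz tw; have [cp Ep] := chart_dom_pt hM op.
have [_ _ _ H] := heps.
have sc x := smooth_on_pvf hM op (smooth_cst_pvf x).
have := H _ _ _ _ _ (dom_slit cp) (sc a) (sc b) (sc z) (sc w).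
rewrite /proj4 /hcurv4 /gf metric_chart//.
have P x : theta Lc x p = 0 -> prep c (phi L (cst_pvf x)) p = x.
  by move=> tx; rewrite prep_phi// prep_cst_pvf// phiv_perp.
have -> : tcoord c (chart_pt p).1 (hcurv A D (phi L (cst_pvf a)) (phi L (cst_pvf b)) (phi L (cst_pvf z)) (chart_pt p))
    = Rcurv F p a b z.
  apply: (etrans (hcurv_chart hM hD hT op (smooth_phi_cst a) (smooth_phi_cst b) (smooth_phi_cst z))).
  have cong x x' y y' v v' : x = x' -> y = y' -> v = v' -> Rcurv F p x y v = Rcurv F p x' y' v'.
    by move=> -> -> ->.
  exact: (cong _ _ _ _ _ _ (P a ta) (P b tb) (P z tz)).
rewrite (_ : tcoord c (chart_pt p).1 (phi L (cst_pvf w) (chart_pt p)) = w); last exact: (P w tw).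
move=> ->; rewrite /antisym.
have hb x y : theta Lc x p = 0 -> hbar L (cst_pvf x) (cst_pvf y) (chart_pt p) = gmet Lc x y p.
  move=> tx; rewrite /hbar /gf !ell_chart// metric_chart// prep_cst_pvf// tx mulr0 mul0r subr0.
  by congr (gmet _ _ _ _); exact: prep_cst_pvf.
by rewrite !hb.
Qed.

End Hp.
End FinslerChart.

(** * From locally constant to constant *)

Section Constancy.
Context (R : realType) (n : nat) (M : topologicalType).
Local Notation E := 'rV[R]_n.
Local Notation V := (E * E)%type.
Context (A : atlas E M) (hM : smooth_manifold A) (n3 : (2 < n)%N).
Let gA := manifold_good hM.
Local Notation S := (slit_atlas A).

Lemma derR0_segment (O : set V) (f : V -> R) p q : smoothR O f ->
  (forall p w, O p -> derR w f p = 0) ->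
  (forall s : R, 0 <= s <= 1 -> O (s *: (q - p) + p)) -> f q = f p.
Proof.
move=> sf f0 sO.
have [s [/andP[s0 s1] E0]] := @mvt_dir R V f p (q - p) 1 ltr01 (fun s h => sm_diff sf (sO s h)).
move: E0; rewrite scale1r subrK.
rewrite derEx -/(derR _ _ _) f0 ?mulr0; last by apply: sO; rewrite !ltW.
by move/eqP; rewrite subr_eq0 => /eqP.
Qed.

Context (k : func R n M) (smk : smooth_func A k)
  (k0 : forall (c : chart A) p w, chart_dom c p -> derR w (k \o chart_pt c) p = 0).

Lemma exists_nonzero_coord (y : E) : y != 0 -> exists i, y 0 i != 0.
Proof.
move=> y0; apply/existsP; apply: contra_neqT y0.
rewrite negb_exists => /forallP H; apply/rowP => i; rewrite mxE.
by apply/eqP; rewrite -[_ == _]negbK; exact: H.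
Qed.

Lemma segment_fibre x (y z : E) i : y 0 i != 0 -> z 0 i = 0 -> z != 0 -> k (x, y) = k (x, z).
Proof.
move=> yi zi z0; set c := chart_at A x.
have cx : dom c x by case: hM => _ _ hat _ _; exact: hat.
have tK (w : E) : chart_pt c (co c x, w) = (x, w).
  rewrite (chart_ptE hM)/=; last by exists x.
  by rewrite (ga_inv gA cx) -[w in LHS](tcoord_id gA w cx) (tcoordK gA cx).
rewrite -tK -(tK z); apply: esym.
apply: (derR0_segment (O := chart_dom c) (f := k \o chart_pt c) _ (k0 (c := c))).
  exact: (smooth_on_func hM c smk).
move=> s _; apply/(chart_domP hM) => /=; split.
  by rewrite subrr scaler0 add0r; exists x.
apply/eqP => /rowP E0; have := E0 i; rewrite !mxE zi => Ei.
have s1 : s = 1.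
  have : (1 - s) * y 0 i = 0 by rewrite -Ei; ring.
  by move/eqP; rewrite mulf_eq0 (negbTE yi) orbF subr_eq0 => /eqP.
by move/eqP: z0; apply; apply/rowP => j; have := E0 j; rewrite !mxE s1 mul1r subrK.
Qed.

(** The two vectors are joined through a third one, which has a zero coordinate where the first one
    has a nonzero coordinate, and likewise for the second: neither segment meets the origin. *)
Lemma constant_fibre x (y z : E) : y != 0 -> z != 0 -> k (x, y) = k (x, z).
Proof.
move=> /exists_nonzero_coord[i yi] /exists_nonzero_coord[j zj].
have lin (l : 'I_n) (r : R) (u w : E) : (r *: u + w) 0 l = r * u 0 l + w 0 l by rewrite !mxE.
have [e [e0 ei ej]] := common_kernel n3 (lin i) (lin j).
by rewrite (segment_fibre x yi ei e0) (segment_fibre x zj ej e0).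
Qed.

(** Move along a segment of base points with fixed fibre coordinates, then within the fibre. *)
Lemma locally_constant x : \forall x' \near x, forall y y' : E, y != 0 -> y' != 0 ->
  k (x', y') = k (x, y).
Proof.
set c := chart_at A x; have cx : dom c x by case: hM => _ _ hat _ _; exact: hat.
have [_ _ _ hc _] := hM; have [oc oi _ cc _] := hc c.
have : nbhs (co c x) (co c @` dom c) by apply: open_nbhs_nbhs; split=> //; exists x.
move=> /nbhs_ballP[r r0 Br].
have near1 : \forall x' \near x, ball (co c x) r (co c x').
  move: cc; rewrite continuous_open_subspace// => /(_ x (mem_set cx)); apply.
  exact: nbhsx_ballx.
have near2 : \forall x' \near x, dom c x' by apply: open_nbhs_nbhs.
apply: filterS2 near1 near2 => x' bx' cx' y y' y0 y'0.
pose e : E := tcoord c x y.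
have e0 : e != 0.
  by apply: contra_neq y0 => e0; rewrite -[y](tcoordK gA cx) -/e e0 /tback jac0.
have tK z w : dom c z -> chart_pt c (co c z, w) = (z, tback c z w).
  move=> cz; rewrite (chart_ptE hM)/=; last by exists z.
  by rewrite (ga_inv gA cz).
have t0 : tback c x' e != 0.
  by apply: contra_neq e0 => t0; rewrite -[e](tbackK gA cx') t0 tcoordE jac0.
rewrite (constant_fibre x' y'0 t0) -[y](tcoordK gA cx) -/e -!tK//.
apply: (derR0_segment (O := chart_dom c) (f := k \o chart_pt c) _ (k0 (c := c))).
  exact: (smooth_on_func hM c smk).
move=> s /andP[s0 s1]; apply/(chart_domP hM) => /=; split; last by rewrite subrr scaler0 add0r.
apply: Br; move: bx'; rewrite -!ball_normE/= => bx'.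
rewrite opprD addrCA subrr addr0 normrN normrZ (ger0_norm s0) distrC.
by rewrite (le_lt_trans _ bx')// ler_piMl.
Qed.

Lemma constant_of_locally : connected [set: M] -> is_constant k.
Proof.
move=> conn.
have [[[x0 y0] u0]|none] := pselect (exists u : TM R n M, slit u); last first.
  by exists 0 => u su; case: none; exists u.
have {}u0 : y0 != 0 by exact: u0.
exists (k (x0, y0)).
(* The level set is open and closed. *)
pose B : set M := [set x | k (x, y0) = k (x0, y0)].
have oB : open B.
  rewrite openE => x Bx; apply: filterS (locally_constant x) => x' H.
  by rewrite /B/= (H y0 y0 u0 u0).
have cB : closed B.
  rewrite -[B]setCK; apply: open_closedC; rewrite openE => x Bx.
  apply: filterS (locally_constant x) => x' H.
  by rewrite /B/= (H y0 y0 u0 u0).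
have BT : B = [set: M].
  apply: conn; first by exists x0.
    by exists B => //; rewrite setTI.
  by exists B => //; rewrite setTI.
move=> [x y] su; have yn : y != 0 by exact: su.
by rewrite (constant_fibre x yn u0); have : B x by rewrite BT.
Qed.

End Constancy.

(** * The four properties *)

Section Main.
Context (R : realType) (n : nat) (M : topologicalType).
Local Notation E := 'rV[R]_n.
Local Notation V := (E * E)%type.
Context (A : atlas E M) (hM : smooth_manifold A).
Local Notation S := (slit_atlas A).
Context (L : func R n M) (hL : finsler A L) (D : operator R n M) (hB : berwald A L D).
Context (k eps : func R n M) (hk : scalar_curvature A L D k) (heps : Hp_scalar_curvature A L D eps).

Let n3 : (2 < n)%N. Proof. by case: hk. Qed.

Lemma slit_chart u : slit u -> exists (c : chart A) b, chart_dom c b /\ chart_pt c b = u.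
Proof.
move=> su; exists (chart_at A u.1), (chart_co (chart_at A u.1) u).
have cu : dom (a := S) (chart_at A u.1) u by split=> //; case: hM => _ _ hat _ _; exact: hat.
by split; [exact: (chart_dom_co cu)|exact: (chart_coK hM cu)].
Qed.

Section InChart.
Context (c : chart A).
Let lb := chart_berwald hM hL hB c.
Let oO := lb_open lb.
Let smk := sm_k hM c hk.
Let sme := sm_eps hM c heps.
Let homk := @hom_k R n M A hM L D c k hk.
Let hsc := @chart_scalar R n M A hM L hL D hB c k hk.
Let hHp := @chart_Hp R n M A hM L hL D hB c eps heps.
Local Notation kc := (k \o chart_pt c).
Local Notation ec := (eps \o chart_pt c).

Lemma kdot_zero_of_eq p a : (forall u, slit u -> eps u = k u) -> chart_dom c p -> kdot kc a p = 0.
Proof.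
move=> ek; apply: (kdot_zero lb smk homk hsc n3 sme hHp (m := 0)).
  by rewrite mulr0 eq_sym oner_eq0.
move=> {}p {}a op; rewrite oppr0 mul0r -(derR_cst (0 : R) (vert a) p).
apply: (derR_eq _ oO op) => q oq; have [cq _] := chart_dom_pt hM oq.
by rewrite /= ek ?subrr//; exact: dom_slit cq.
Qed.

Lemma kdot_zero_of_cst p a : is_constant eps -> chart_dom c p -> kdot kc a p = 0.
Proof.
move=> [r er]; apply: (kdot_zero lb smk homk hsc n3 sme hHp (m := 1)).
  by rewrite mulr1 -subr_eq0 (_ : 3 - 1 = 2%:R) ?pnatr_eq0//; ring.
move=> {}p {}a op.
rewrite (derRB _ sme smk op) -/(kdot kc a p).
rewrite (_ : derR (vert a) ec p = 0) ?sub0r ?mulN1r//.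
rewrite -(derR_cst r (vert a) p); apply: (derR_eq _ oO op) => q oq; have [cq _] := chart_dom_pt hM oq.
by rewrite /= er//; exact: dom_slit cq.
Qed.

Lemma derR_zero_of_eq p w : (forall u, slit u -> eps u = k u) -> chart_dom c p -> derR w kc p = 0.
Proof.
move=> ek; apply: (schur lb smk hsc n3) => q a oq; exact: kdot_zero_of_eq.
Qed.

Lemma eq_of_constant p : is_constant k -> chart_dom c p -> eps (chart_pt c p) = k (chart_pt c p).
Proof.
move=> [r kr] op.
have k0 q : chart_dom c q -> kc q = r.
  by move=> oq; apply: kr; have [cq _] := chart_dom_pt hM oq; exact: dom_slit cq.
have K0 a q : chart_dom c q -> kdot kc a q = 0.
  by move=> oq; rewrite -(derR_cst r (vert a) q); exact: (derR_eq _ oO oq k0).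
apply: (eps_eq_k lb smk homk hsc n3 hHp op) => a b.
rewrite !K0// (_ : derR _ _ _ = 0) ?mulr0 ?addr0//.
by rewrite -(derR_cst (0 : R) (vert b) p); apply: (derR_eq _ oO op) => q oq; exact: K0.
Qed.

Lemma Cform_chart X p : chart_dom c p ->
  Cform A L k X (chart_pt c p) = L (chart_pt c p) * kdot kc (prep c X p) p.
Proof.
move=> op; have [cp _] := chart_dom_pt hM op.
rewrite /Cform /vder0 (dfunP hM _ op (sm_diff smk op)) (tcoord_gamma hM _ cp).
by [].
Qed.

(** For [e] orthogonal to [y] the projections are the identity at the point.  The fields
    themselves are not constant, but their derivatives enter both terms of the covariant derivative
    of C^k and cancel; the derivative of [L] along [e] vanishes. *)
Lemma Fform_chart p e : chart_dom c p -> theta (L \o chart_pt c) e p = 0 ->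
  proj2 L (Fform A L D k) (cst_pvf c e) (cst_pvf c e) (chart_pt c p)
  = 3^-1 * (L (chart_pt c p) ^+ 2 * derR (vert e) (kdot kc e) p).
Proof.
move=> op te; have [cp Ep] := chart_dom_pt hM op.
have smL := lb_smooth lb; have L0 := lb_pos lb op.
(* Both P in the definition of B^k and P.F itself project the arguments, hence twice phi. *)
set X := phi L (cst_pvf c e); set Y := phi L X.
have Xq q : chart_dom c q -> prep c X q = phiv L c q e.
  by move=> oq; rewrite (prep_phi hM hL hB)// prep_cst_pvf.
have Yq q : chart_dom c q -> prep c Y q = phiv L c q e.
  by move=> oq; rewrite (prep_phi hM hL hB)// Xq// phiv_perp// (theta_phiv hM hL hB).
have Ye : prep c Y p = e by rewrite Yq// phiv_perp.
have sY : smooth_on (chart_dom c) (prep c Y).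
  by apply: (smooth_eq oO _ (smooth_phiv hM hL hB c e)) => q oq; rewrite Yq.
rewrite /proj2 -/X /Fform (ell_chart hM hL hB _ op) Xq// phiv_perp// te !mulr0 addr0.
congr (_ * _); rewrite /Bform /proj2 -/Y expr2 -mulrA; congr (_ * _).
have dC : smoothR (chart_dom c) (Cform A L k Y \o chart_pt c).
  apply: (@smooth_eq R V R^o _ (fun q => L (chart_pt c q) * derR (vert (prep c Y q)) kc q)) => //.
    by move=> q oq; rewrite /= Cform_chart.
  apply: (sm_mul oO smL).
  apply: (sm_moving (X := fun q => vert (prep c Y q)) (findimV R n) oO smk).
  exact: (smooth_clin_comp oO (@clin_vert R n) sY).
rewrite /vder1 (dfunP hM _ op (sm_diff dC op)) (tcoord_gamma hM _ cp).
rewrite -[tcoord c _ _]/(prep c Y p) Ye.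
have -> : derR (vert e) (Cform A L k Y \o chart_pt c) p
    = derR (vert e) (fun q => L (chart_pt c q) * derR (vert (prep c Y q)) kc q) p.
  by apply: (derR_eq _ oO op) => q oq; exact: Cform_chart.
have svY : smooth_on (chart_dom c) (fun q => vert (prep c Y q)).
  exact: (smooth_clin_comp oO (@clin_vert R n) sY).
rewrite (derRM _ smL (sm_moving (findimV R n) oO smk svY) op).
rewrite (derR_moving _ (findimV R n) oO op smk (smooth_diff svY op)) Ye.
have -> : derR (vert e) (L \o chart_pt c) p = 0.
  have := derRM (vert e) smL smL op; rewrite -[derR _ (fun q => _ * _) p]/(derR (vert e) (fun q => (L \o chart_pt c) q ^+ 2) p).
  rewrite derR_L2 te mulr0 => H; apply: (mulIf (lt0r_neq0 L0)); rewrite mul0r.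
  by move: H; rewrite /=; lra.
rewrite Cform_chart//.
have -> : prep c (cov D (gammaf A Y) Y) p = der (vert e) (prep c Y) p.
  have [hD _ hT _ _] := hB.
  rewrite (prep_covF hM hD hT _ op sY) (vrep_gammaf hM _ op) Ye/=.
  have [Fl _ _] := lb_bil lb; have := Fl p op e 1 0 0; rewrite !scale1r addr0.
  by move/eqP; rewrite -subr_eq subrr => /eqP <-; rewrite addr0.
have -> : der (vert e) (fun q => vert (prep c Y q)) p = vert (der (vert e) (prep c Y) p).
  rewrite (der_comp (f := prep c Y) (g := @vert R n)).
  - by have [_ ->] := clin_der (prep c Y p) (@clin_vert R n).
  - exact: smooth_diff sY op.
  - by have [] := clin_der (prep c Y p) (@clin_vert R n).
by rewrite mul0r add0r mulrDr addrK.
Qed.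

End InChart.

(** C^k is the vertical derivative of [k] up to the factor [L]. *)
Lemma Fform_zero X Y u : (forall (c : chart A) p a, chart_dom c p -> kdot (k \o chart_pt c) a p = 0) -> slit u ->
  proj2 L (Fform A L D k) X Y u = 0.
Proof.
move=> K0 su; have C0 Z t : slit t -> Cform A L k Z t = 0.
  by move=> /slit_chart[c [p [op <-]]]; rewrite Cform_chart// K0// mulr0.
have d0 (f : func R n M) w : (forall t, slit t -> f t = 0) -> dfun A f u w = 0.
  move=> f0; have [c [p [op Ep]]] := slit_chart su; rewrite -Ep.
  have oO := open_chart_dom hM (c := c).
  have fp q : chart_dom c q -> (f \o chart_pt c) q = 0.
    by move=> oq; apply: f0; have [cq _] := chart_dom_pt hM oq; exact: dom_slit cq.
  have sf : smoothR (chart_dom c) (f \o chart_pt c).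
    by apply: (@smooth_eq R V R^o _ (fun=> 0)) => //; [move=> q /fp ->|exact: smooth_cst].
  rewrite (dfunP hM _ op (sm_diff sf op)) -(derR_cst (0 : R) (tcoord (A := S) c (chart_pt c p) w) p).
  exact: (derR_eq _ oO op fp).
rewrite /proj2 /Fform C0// mulr0 mul0r addr0 /Bform /proj2 /vder1.
rewrite C0// subr0 d0 ?mulr0// => t st; exact: C0.
Qed.

End Main.

Theorem theorem3p6 (R : realType) (n : nat) (M : topologicalType)
    (A : atlas 'rV[R]_n M) (hM : smooth_manifold A) (hconn : connected [set: M])
    (L : func R n M) (hL : finsler A L)
    (D : operator R n M) (hD : berwald A L D)
    (k eps : func R n M)
    (hk : scalar_curvature A L D k) (heps : Hp_scalar_curvature A L D eps) :
  [<-> forall u, slit u -> eps u = k u;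
       constant_curvature A L D k;
       Hp_constant_curvature A L D eps;
       forall X Y u, slit u -> smooth_pvf A X u -> smooth_pvf A Y u ->
         proj2 L (Fform A L D k) X Y u = 0].
Proof.
have n3 : (2 < n)%N by case: hk.
have smk : smooth_func A k by case: hk.
tfae.
- move=> ek; split=> //; apply: (constant_of_locally hM n3 smk _ hconn) => c p w op.
  exact: (derR_zero_of_eq hM hL hD hk heps).
- move=> [_ ck]; split=> //; have [r kr] := ck; exists r => u su.
  have [c [p [op Ep]]] := slit_chart hM su.
  by rewrite -(kr u su) -Ep; exact: (eq_of_constant hM hL hD hk heps ck op).
- move=> [_ ce] X Y u su _ _; apply: (Fform_zero hM hk) => // c p a op.
  exact: (kdot_zero_of_cst hM hL hD hk heps a ce op).
- move=> F0 u su; have [c [p [op <-]]] := slit_chart hM su.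
  have lb := chart_berwald hM hL hD c.
  have [e [te _ ee]] := perp_vector lb n3 0 op.
  have [cp _] := chart_dom_pt hM op.
  have se := smooth_on_pvf hM op (smooth_cst_pvf hM c e).
  have := F0 _ _ _ (dom_slit cp) se se.
  rewrite (Fform_chart hM hL hD hk op te).
  rewrite (hess_perp lb (sm_k hM c hk) (@chart_scalar R n M A hM L hL D hD c k hk)
    n3 (@chart_Hp R n M A hM L hL D hD c eps heps) op te te) => /eqP.
  by rewrite !mulf_eq0 (gt_eqF ee) !invr_eq0 !pnatr_eq0/= orbF subr_eq0 => /eqP.
Qed.
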